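(* Let $k\geq 3$ and let $m_1,\dots,m_{k-1}\geq 1$ and $m_k\geq 2$ be integers. The Euler-genus polynomials of the cubic caterpillar-Halin graphs satisfy $$\mathcal{E}_{m_1,\dots,m_k}(z)=(1+4z)\,\mathcal{E}_{m_1,\dots,m_{k-1},m_k-1}(z)+16z^2\,\mathcal{E}_{m_1,\dots,m_{k-1},m_k-2}(z)+2^{m_k+3}z^2\,\lambda_{m_1,\dots,m_{k-1},m_k-1}(z),$$ with the initial conditions $$\mathcal{E}_{m_1,\dots,m_{k-1},0}(z)=\mathcal{E}_{m_1,\dots,m_{k-2},m_{k-1}+1}(z),\qquad \mathcal{E}_{m_1,\dots,m_{k-1},1}(z)=\mathcal{E}_{m_1,\dots,m_{k-2},m_{k-1}+2}(z).$$
   Context: Euler-genus polynomial. The Euler-genus of a closed surface is $2j$ for the orientable surface with $j$ handles and $c$ for the non-orientable surface with $c$ crosscaps. A pure rotation system of a graph $G$ assigns to every vertex a cyclic permutation of its incident edges; a general rotation system is a pure rotation system together with a map $\tau:E(G)\to\{0,1\}$ (an edge $e$ is twisted if $\tau(e)=1$, untwisted otherwise); it determines a cellular embedding of $G$ in a closed surface. For a fixed spanning tree $T$ of $G$, a $T$-rotation system is a general rotation system with $\tau(e)=0$ for all $e\in E(T)$. Embeddings with equivalent $T$-rotation systems are identified, so the number $\varepsilon_G(i)$ of equivalent embeddings of $G$ into surfaces of Euler-genus $i$ is the number of $T$-rotation systems whose embedding surface has Euler-genus $i$. The Euler-genus polynomial is $\mathcal{E}_G(z)=\sum_{i\ge 0}\varepsilon_G(i)z^i$.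 The graphs $H_{m_1,\dots,m_k}$. Let $k\ge 2$, $m_1,\dots,m_{k-1}\ge 1$ and $m_k\ge 0$. Put $n_1=m_1$, $n_i=m_i+1$ for $1<i<k$, $n_k=m_k$, and $\ell=n_1+\dots+n_k$. Take the path $v_0v_1\cdots v_{\ell+1}$ drawn horizontally and attach to each $v_i$ ($1\le i\le\ell$) a leaf $u_i$; the first $n_1$ of the leaves $u_i$ are drawn above the path, the next $n_2$ below, the next $n_3$ above, and so on alternately. Add a cycle $C$ through all leaves of this tree in their planar order: $v_0$, then the upper leaves $u_i$ in increasing order of index, then $v_{\ell+1}$, then the lower leaves $u_i$ in decreasing order of index. The resulting cubic Halin graph (a cubic caterpillar-Halin graph) is $H_{m_1,\dots,m_k}$. Write $\mathcal{E}_{m_1,\dots,m_k}(z)$ for its Euler-genus polynomial. The polynomials $\lambda$. For $k\ge2$ and $m_1,\dots,m_k\ge 1$, consider symmetric matrices over $\mathbb{Z}_2=\{0,1\}$ of order $k+m_1+\dots+m_k$ whose rows and columns are indexed by symbols $e_i$ ($1\le i\le k$) and $e_{i,l}$ ($1\le i\le k$, $1\le l\le m_i$). A matrix has the form $\Delta_{m_1,\dots,m_k}$ if all its entries vanish except possibly the following (and their transposes), which are arbitrary in $\mathbb{Z}_2$: $(e_i,e_i)=x_i$ and $(e_{i,l},e_{i,l})=x_{i,l}$; $(e_i,e_{i+1})=y_i$ for $1\le i\le k-1$; $(e_{i,l},e_{i,l+1})=y_{i,l}$ for $1\le l\le m_i-1$; $(e_i,e_{i,l})=z_{i,l}$ for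 $1\le l\le m_i$; $(e_i,e_{i-1,m_{i-1}})=z_{i,0}$ for $2\le i\le k$; $(e_i,e_{i+1,1})=z_{i,m_i+1}$ for $1\le i\le k-1$. A matrix has the form $\Lambda_{m_1,\dots,m_k}$ if it has the form $\Delta_{m_1,\dots,m_k}$ and its row and column indexed by $e_k$ are zero. Set $\lambda_{m_1,\dots,m_k}(z)=\sum_j \lambda_{m_1,\dots,m_k}[j]z^j$, where $\lambda_{m_1,\dots,m_k}[j]$ is the number of matrices of the form $\Lambda_{m_1,\dots,m_k}$ of rank $j$. *)

(* Defs.v *)
From HB Require Import structures.
From mathcomp Require Import all_boot all_order all_algebra all_fingroup.

Set Implicit Arguments.
Unset Strict Implicit.
Unset Printing Implicit Defensive.

Import GRing.Theory.

Record sgraph := SGraph {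
  svertex :> finType;
  sedge : rel svertex;
  sedge_sym : symmetric sedge;
  sedge_irr : irreflexive sedge }.

Section RotationSystems.
Variable G : sgraph.

Definition edges : {set {set G}} :=
  [set [set p.1; p.2] | p : G * G in [set p : G * G | sedge p.1 p.2]].

Definition edge := {a : {set G} | a \in edges}.

(* A dart is an edge together with one of its ends, its tail: the dart (x, y) *)
(* is the edge xy seen from x.  As G is simple, the darts with tail x are in  *)
(* bijection with the edges incident with x.                                  *)
Definition dart := {p : G * G | sedge p.1 p.2}.

Definition tail (d : dart) : G := (val d).1.
Definition head (d : dart) : G := (val d).2.

Lemma edge_of_subproof (d : dart) : [set tail d; head d] \in edges.
Proof.
by apply/imsetP; exists (val d); rewrite // inE; exact: (valP d).
Qed.

Definition edge_of (d : dart) : edge :=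
  exist (fun a => a \in edges) _ (edge_of_subproof d).

Lemma rev_dart_subproof (d : dart) : sedge (head d, tail d).1 (head d, tail d).2.
Proof. by rewrite /= sedge_sym; exact: (valP d). Qed.

Definition rev_dart (d : dart) : dart :=
  exist (fun p : G * G => sedge p.1 p.2) _ (rev_dart_subproof d).

(* Pure rotation systems: rho restricts, at every vertex, to one cyclic       *)
(* permutation of the darts leaving that vertex.                              *)
Definition is_rotation (rho : {perm dart}) : bool :=
  [forall d, porbit rho d == [set d' | tail d' == tail d]].

(* A pair (rho, tau); edge a is twisted when tau a = true.                    *)
Definition gen_rotation := ({perm dart} * {ffun edge -> bool})%type.

(* Thicken every vertex to a disc and every edge to a band.  The flag (d, b)  *)
(* is one of the two sides of the band of d, seen from the tail of d: the one *)
(* facing rho d if b = true, the one facing rho^-1 d if b = false.  Along the *)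
(* boundary of the resulting surface, the flag (d, true) is followed through  *)
(* the corner at the tail of d by (rho d, false), and the side of a band seen *)
(* from one end continues to the side seen from the other end, b being        *)
(* reversed exactly when the band is untwisted.                               *)
Definition flag := (dart * bool)%type.

Definition corner (R : gen_rotation) (f g : flag) : bool :=
  [&& f.2, ~~ g.2 & g.1 == R.1 f.1].

Definition band_side (R : gen_rotation) (f g : flag) : bool :=
  (g.1 == rev_dart f.1) && (g.2 == ~~ f.2 (+) R.2 (edge_of f.1)).

Definition boundary (R : gen_rotation) : rel flag :=
  [rel f g | [|| corner R f g, corner R g f | band_side R f g]].

(* The faces are the boundary components of the band surface.                 *)
Definition nfaces (R : gen_rotation) : nat := n_comp (boundary R) predT.

(* The local orientations of the vertex discs can be chosen so that all bands *)
(* become untwisted: sw is the set of vertices at which it is reversed.       *)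
Definition orientable (R : gen_rotation) : bool :=
  [exists sw : {ffun G -> bool},
     [forall d : dart, R.2 (edge_of d) == sw (tail d) (+) sw (head d)]].

(* 2 - (#V - #E + #F); for connected G this is never negative, so truncated   *)
(* subtraction is harmless.                                                   *)
Definition euler_deficit (R : gen_rotation) : nat :=
  2 + #|{: edge}| - (#|G| + nfaces R).

End RotationSystems.

Inductive closed_surface :=
  | Handles of nat    (* orientable, with the given number of handles *)
  | Crosscaps of nat. (* non-orientable, with the given number of crosscaps *)

Definition euler_genus (S : closed_surface) : nat :=
  match S with Handles j => j.*2 | Crosscaps c => c end.

(* The surface is identified by its orientability and Euler characteristic,   *)
(* which is 2 - 2j for j handles and 2 - c for c crosscaps.  This is the      *)
(* surface of the embedding when G is connected and has at least one edge.    *)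
Definition embedding_surface (G : sgraph) (R : gen_rotation G) :
    closed_surface :=
  if orientable R then Handles (euler_deficit R)./2
  else Crosscaps (euler_deficit R).

Section EulerGenusPolynomial.
Variables (G : sgraph) (T : {set edge G}).

Definition tree_rel : rel G :=
  [rel x y | [exists a in T, val a == [set x; y]]].

(* A duplicate-free closed walk of length 2 runs back and forth on one edge.  *)
Definition spanning_tree : Prop :=
  (forall x y : G, connect tree_rel x y) /\
  (forall c : seq G, ucycle tree_rel c -> size c < 3).

Definition T_rotations : {set gen_rotation G} :=
  [set R : gen_rotation G | is_rotation R.1 & [forall a in T, ~~ R.2 a]].

Definition num_embeddings (i : nat) : nat :=
  #|[set R in T_rotations | euler_genus (embedding_surface R) == i]|.

Definition euler_genus_poly : {poly int} :=
  (\sum_(R in T_rotations) 'X^(euler_genus (embedding_surface R)))%R.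

Lemma coef_euler_genus_poly (i : nat) :
  (euler_genus_poly`_i)%R = (num_embeddings i)%:R%R.
Proof.
rewrite /euler_genus_poly coef_sum /num_embeddings -sum1_card natr_sum.
rewrite (eq_bigl (fun R => (R \in T_rotations)
  && (euler_genus (embedding_surface R) == i))) => [|R]; last by rewrite inE.
rewrite [RHS]big_mkcondr; apply: eq_bigr => R _.
by rewrite coefXn eq_sym; case: eqP.
Qed.

End EulerGenusPolynomial.

(* Parameter sequences m = [:: m_1; ...; m_k] are indexed from 0.             *)
Definition halin_params (m : seq nat) : bool :=
  (2 <= size m) && all (leq 1) (take (size m).-1 m).

Section CaterpillarHalin.
Variable m : seq nat.

(* n_1 = m_1, n_k = m_k, and n_i = m_i + 1 in between. *)
Definition block (i : nat) : nat := nth 0 m i + (0 < i < (size m).-1).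

Definition spine : nat := \sum_(i < size m) block i.

Definition sides : seq bool :=
  flatten [seq nseq (block i) (~~ odd i) | i <- iota 0 (size m)].

(* inl i is v_i for 0 <= i <= spine + 1; inr j is the leaf u_(j+1), which is  *)
(* attached to v_(j+1).                                                       *)
Definition halin_vertex := ('I_spine.+2 + 'I_spine)%type.

Definition above (j : 'I_spine) : bool := nth false sides j.

Definition outer_cycle : seq halin_vertex :=
  inl ord0 :: [seq inr j | j <- enum 'I_spine & above j]
  ++ inl ord_max :: rev [seq inr j | j <- enum 'I_spine & ~~ above j].

Definition caterpillar_arc (x y : halin_vertex) : bool :=
  match x, y with
  | inl i, inl j => j == i.+1 :> nat
  | inl i, inr j => i == j.+1 :> nat
  | _, _ => false
  end.

Definition cycle_arc (x y : halin_vertex) : bool :=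
  (x \in outer_cycle) && (y == next outer_cycle x).

Definition halin_arc (x y : halin_vertex) : bool :=
  caterpillar_arc x y || cycle_arc x y.

Definition halin_adj : rel halin_vertex :=
  [rel x y | (x != y) && (halin_arc x y || halin_arc y x)].

Lemma halin_adj_sym : symmetric halin_adj.
Proof. by move=> x y; rewrite /halin_adj /= eq_sym orbC. Qed.

Lemma halin_adj_irr : irreflexive halin_adj.
Proof. by move=> x; rewrite /halin_adj /= eqxx. Qed.

Definition halin : sgraph := SGraph halin_adj_sym halin_adj_irr.

End CaterpillarHalin.

Section Lambda.
Variable m : seq nat.

(* inl i is the symbol e_(i+1) and inr (Tagged _ l), with tag i, is the       *)
(* symbol e_(i+1,l+1).                                                        *)
Definition symb := ('I_(size m) + {i : 'I_(size m) & 'I_(nth 0 m i)})%type.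

(* The positions of the x's, y's and z's, up to transposition.                *)
Definition free_entry (a b : symb) : bool :=
  match a, b with
  | inl i, inl j => (i == j) || (j == i.+1 :> nat)
  | inr p, inr q =>
      (tag p == tag q) &&
      ((tagged p == tagged q :> nat) || (tagged q == (tagged p).+1 :> nat))
  | inl i, inr p =>
      [|| tag p == i,
          (i == (tag p).+1 :> nat) && ((tagged p).+1 == nth 0 m (tag p)) |
          (tag p == i.+1 :> nat) && (tagged p == 0 :> nat)]
  | inr _, inl _ => false
  end.

(* Rows and columns are numbered along an enumeration of the symbols; the     *)
(* rank does not depend on it.                                                *)
Definition symb_matrix := 'M['F_2]_#|{: symb}|.

Definition entry (A : symb_matrix) (a b : symb) : 'F_2 :=
  A (enum_rank a) (enum_rank b).

Definition Delta_form (A : symb_matrix) : bool :=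
  (A^T == A)%R &&
  [forall a, forall b,
     ~~ (free_entry a b || free_entry b a) ==> (entry A a b == 0%R)].

Definition is_last_e (a : symb) : bool :=
  if a is inl i then i.+1 == size m else false.

Definition Lambda_form (A : symb_matrix) : bool :=
  Delta_form A &&
  [forall a, forall b,
     is_last_e a ==> (entry A a b == 0%R) && (entry A b a == 0%R)].

Definition num_Lambda (j : nat) : nat :=
  #|[set A : symb_matrix | Lambda_form A & \rank A == j]|.

Definition lambda_poly : {poly int} :=
  \poly_(j < #|{: symb}|.+1) ((num_Lambda j)%:R)%R.

End Lambda.

(* Main.v *)
Require Import Defs.
From mathcomp Require Import all_boot all_order all_algebra all_fingroup.
From mathcomp Require Import mxabelem zify.

(* For every rotation system of a cubic graph that has a planar embedding with
   face set F, the corner labellings that are constant along the boundary of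
   the band surface are [f = g + c], with [g] a labelling of F and [c] one of
   the vertices; being constant along the bands forces [g] into the kernel of
   the Laplacian of the dual graph weighted by the twists (shifted by a fixed
   cochain).  So the Euler genus is the rank of that Laplacian.  Deleting the
   outer face, which is adjacent to all others in a Halin graph, leaves an
   arbitrary symmetric matrix supported on the dual of the tree, a triangulated
   polygon with fans centred at the [e_i], i.e. a matrix of the form Delta.
   Switching at vertices makes the choice of the spanning tree irrelevant and
   gives E_m = 2 * (rank polynomial of Delta_m).
   The recurrence comes from eliminating the last vertex [w] of the polygon,
   which is adjacent to its predecessor [u] and to the last fan centre [v]:
   pivoting on (w,w), on (w,u), or on (w,v) gives the three kinds of terms, the
   last one being a matrix of the form Lambda since it loses row and column
   [v]. *)

Set Implicit Arguments.
Unset Strict Implicit.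
Unset Printing Implicit Defensive.

Import GRing.Theory.
Local Open Scope ring_scope.

(** * Pivots and ranks *)

(** Faces are counted linearly: a band surface has [2 ^ nfaces] invariant labellings, and these
    correspond to a kernel vector [g] together with one of two potentials [c]. With [N] inner faces
    in the planar embedding this gives [N - rank + 1] faces, and Euler's formula turns the deficit
    into the rank. [embedding_surface] halves the deficit in the orientable case, so the rank has to
    be even there; it is, because the form is then alternating. A cubic vertex has two rotations, so
    all rotation systems are switchings of a single one, and each total twist comes from exactly two
    [T]-rotation systems, whence the factor 2 in E. In the recurrence, 4 counts the rows of w when
    (w,w) = 1; 16 is 2 values of (w,v) times 8 choices of the row of u, none of which affects the
    rank distribution; and the row of v has [m_k + 2] free entries, the factor 2 of E raising the
    exponent to [m_k + 3]. Faces are numbered in the order in which a sweep along the path opens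
    them. Each new face then meets just two earlier ones, which are adjacent, and only the last two
    faces enter the elimination. *)

Section Pivot.
Variables (F : fieldType) (n : nat).

Lemma mxrank_unit_sandwich (m : nat) (P Q A : 'M[F]_m) :
  P \in unitmx -> Q \in unitmx -> \rank (P *m A *m Q) = \rank A.
Proof.
by move=> uP uQ; rewrite mxrankMfree ?row_free_unit // eqmxMfull ?row_full_unit.
Qed.

Lemma lower_block_unit (c : 'cV[F]_n) :
  (block_mx 1%:M 0 c 1%:M : 'M_(1 + n)) \in unitmx.
Proof. by rewrite unitmxE det_lblock !det1 mulr1 unitr1. Qed.

Lemma upper_block_unit (r : 'rV[F]_n) :
  (block_mx 1%:M r 0 1%:M : 'M_(1 + n)) \in unitmx.
Proof. by rewrite unitmxE det_ublock !det1 mulr1 unitr1. Qed.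

(** Elimination with the unit corner; [B - c *m r] is its Schur complement. *)
Lemma mxrank_pivot1 (r : 'rV[F]_n) (c : 'cV_n) (B : 'M[F]_n) :
  \rank (block_mx 1%:M r c B : 'M_(1 + n)) = (1 + \rank (B - c *m r)%R)%N.
Proof.
rewrite -(mxrank_unit_sandwich _ (lower_block_unit (- c))
                                 (upper_block_unit (- r))).
rewrite !mulmx_block !(mul1mx, mulmx1, mul0mx, mulmx0, addr0, add0r).
by rewrite !addNr mul0mx add0r mulNmx rank_diag_block_mx mxrank1 [_ + B]addrC.
Qed.

Lemma mxrank_diag_sandwich m1 m2 m (P : 'M[F]_(m1 + m2, m))
    (A : 'M_m) (Q : 'M_(m, m1 + m2)) (B : 'M[F]_m1) (C : 'M_m2) :
  P *m A *m Q = block_mx B 0 0 C -> (\rank B + \rank C <= \rank A)%N.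
Proof.
move=> E; rewrite -rank_diag_block_mx -E.
exact: leq_trans (mxrankM_maxl _ _) (mxrankM_maxr _ _).
Qed.

(* [0 r; r^T B] is the form B on the hyperplane ker r plus a hyperbolic plane;
   [1 - e r] is the projection onto ker r along e. *)
Lemma mxrank_pivot2 (r : 'rV[F]_n) (e : 'cV_n) (B : 'M[F]_n) :
  r *m e = 1%:M -> let K := 1%:M - e *m r in
  \rank (block_mx 0 r r^T B : 'M_(1 + n)) = (2 + \rank (K^T *m B *m K)%R)%N.
Proof.
move=> re K.
have rK : r *m K = 0 by rewrite mulmxBr mulmx1 mulmxA re mul1mx subrr.
have Ke : K *m e = 0 by rewrite mulmxBl mul1mx -mulmxA re mulmx1 subrr.
have KK : K *m K = K by rewrite {2}/K mulmxBr mulmx1 mulmxA Ke mul0mx subr0.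
have KTe : e^T *m K^T = 0 by rewrite -trmx_mul Ke trmx0.
have KTr : K^T *m r^T = 0 by rewrite -trmx_mul rK trmx0.
have er : e^T *m r^T = 1%:M by rewrite -trmx_mul re trmx1.
have KTK : K^T *m K^T = K^T by rewrite -trmx_mul KK.
set B0 := K^T *m B *m K.
have B0e : B0 *m e = 0 by rewrite /B0 -mulmxA Ke mulmx0.
have eB0 : e^T *m B0 = 0 by rewrite /B0 !mulmxA KTe !mul0mx.
have KB0 : K^T *m B0 = B0 by rewrite /B0 !mulmxA KTK.
have B0K : B0 *m K = B0 by rewrite /B0 -mulmxA KK.
have dK : 1%:M = K + e *m r by rewrite subrK.
pose p : 'cV_n := K^T *m B *m e.
pose q : 'rV_n := e^T *m B.
have -> : block_mx 0 r r^T B = block_mx 1%:M 0 p 1%:M *m block_mx 0 r r^T B0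
   *m (block_mx 1%:M q 0 1%:M) :> 'M_(1 + n).
  have KTB : K^T *m B = B - r^T *m q.
    by rewrite /K linearB /= trmx1 trmx_mul mulmxBl mul1mx mulmxA.
  have -> : B0 = B - r^T *m q - p *m r.
    by rewrite /B0 mulmxBr mulmx1 mulmxA -/p KTB.
  rewrite !mulmx_block !(mul1mx, mulmx1, mul0mx, mulmx0, addr0, add0r).
  by congr block_mx; rewrite [p *m r + _]addrC subrK addrC subrK.
rewrite mxrank_unit_sandwich ?lower_block_unit ?upper_block_unit //.
(* Right multiplication by the involution [Q] yields the diagonal blocks 1 and [r^T *m r + B0]. As
   [B0] kills [e] on both sides, the second block has rank [1 + \rank B0]: subadditivity gives one
   inequality, compression by [e] and [K] the other. *)
pose Q : 'M_(1 + n) := block_mx 0 r e K.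
have QQ : Q *m Q = 1%:M.
  rewrite mulmx_block !(mul0mx, mulmx0, add0r) re rK Ke KK addrC -dK.
  by rewrite -scalar_mx_block.
have uQ : Q \in unitmx by case/mulmx1_unit: QQ.
rewrite -[in LHS](mxrankMfree _ (eq_ind_r is_true uQ (row_free_unit Q))).
rewrite mulmx_block !(mul0mx, mulmx0, add0r) re rK B0e B0K.
rewrite rank_diag_block_mx mxrank1 -[2%N]addn1 -addnA; congr (1 + _)%N.
apply/eqP; rewrite eqn_leq; apply/andP; split.
  apply: leq_trans (mxrank_add _ _) _; rewrite leq_add2r.
  exact: leq_trans (mxrankM_maxl _ _) (rank_leq_col _).
rewrite -[X in (X + _)%N](mxrank1 F 1).
clearbody B0 K; apply: (@mxrank_diag_sandwich _ _ _ (col_mx e^T K^T) _ (row_mx e K)).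
rewrite mul_col_mx mul_col_row !mulmxDr !mulmxDl !mulmxA er KTr eB0 KB0.
by rewrite !mul0mx !add0r !addr0 mul1mx re rK B0e B0K.
Qed.
End Pivot.

(** * Symmetric and alternating matrices over the field with two elements *)

Lemma F2_addrr (x : 'F_2) : x + x = 0.
Proof. exact: (addrr_pchar2 (pchar_Fp (isT : prime 2))). Qed.

Lemma F2_oppr (x : 'F_2) : - x = x.
Proof. exact: (oppr_pchar2 (pchar_Fp (isT : prime 2))). Qed.

Lemma F2_neq0 (x : 'F_2) : (x != 0) = (x == 1).
Proof. by case: x => [[|[|]]]. Qed.

Lemma F2_sum (V : nmodType) (f : 'F_2 -> V) : \sum_x f x = f 0 + f 1.
Proof.
rewrite (bigD1 0) //=; congr (_ + _); apply: big_pred1 => x.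
by rewrite F2_neq0.
Qed.

(** Off-diagonal terms cancel in pairs in characteristic 2. *)
Lemma sum_sym_F2 n (f : 'I_n -> 'I_n -> 'F_2) :
  (forall i j, f i j = f j i) -> \sum_i \sum_j f i j = \sum_i f i i.
Proof.
move=> fC.
have -> : \sum_i \sum_j f i j =
  \sum_(i < n) \sum_(j : 'I_n | (j < i)%N) f i j +
  (\sum_i f i i + \sum_(i < n) \sum_(j : 'I_n | (i < j)%N) f i j).
  rewrite -!big_split; apply: eq_bigr => i _ /=.
  rewrite (bigID (fun j : 'I_n => (j < i)%N)) /=; congr (_ + _).
  rewrite (bigD1 i) ?ltnn //=; congr (_ + _); apply: eq_bigl => j.
  by rewrite -leqNgt [in RHS]ltn_neqAle andbC [i == j :> nat]eq_sym.
rewrite [X in _ + (_ + X)](exchange_big_dep predT) //= addrCA.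
rewrite -[RHS]addr0; congr (_ + _); rewrite -big_split /= big1 // => i _.
by under [X in _ + X]eq_bigr do rewrite fC; rewrite F2_addrr.
Qed.

(** A congruence keeps an alternating form alternating; this carries the induction for the parity of
    the rank through a pivot. *)
Lemma congr_diag0 n (B K : 'M['F_2]_n) :
  B^T = B -> (forall i, B i i = 0) -> forall i, (K^T *m B *m K) i i = 0.
Proof.
move=> BT B0 i; rewrite mxE.
under eq_bigr => j _ do rewrite mxE mulr_suml.
rewrite sum_sym_F2 => [|j k]; first by rewrite big1 // => j _; rewrite B0 mulr0 mul0r.
by rewrite !mxE -[in LHS]BT mxE mulrC mulrA mulrAC.
Qed.

Lemma alternating_rank_even n (A : 'M['F_2]_n) :
  A^T = A -> (forall i, A i i = 0) -> ~~ odd (\rank A).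
Proof.
elim: n A => [|n IHn] A; first by have:= rank_leq_row A; rewrite leqn0 => /eqP ->.
move: A; rewrite -[n.+1]/(1 + n)%N => A AT A0.
pose r := ursubmx A; pose B := drsubmx A.
have defA : A = block_mx 0 r r^T B.
  rewrite -[LHS]submxK trmx_ursub AT; congr block_mx.
  by apply/matrixP=> i j; rewrite !ord1 !mxE.
have BT : B^T = B by rewrite trmx_drsub AT.
have B0 i : B i i = 0 by rewrite !mxE.
have [r0 | ] := eqVneq r 0.
  by rewrite defA r0 trmx0 rank_diag_block_mx mxrank0; exact: IHn.
case/rV0Pn => u; rewrite F2_neq0 => /eqP ru.
have re : r *m delta_mx u 0 = 1%:M.
  apply/matrixP=> i j; rewrite !ord1 mxE (bigD1 u) //= ru !mxE !eqxx mulr1.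
  by rewrite big1 ?addr0 // => k /negPf ku; rewrite [delta_mx _ _ _ _]mxE ku mulr0.
rewrite defA (mxrank_pivot2 B re) oddD /=; apply: IHn; last exact: congr_diag0.
by rewrite !trmx_mul trmxK BT mulmxA.
Qed.

(** * Rank polynomials of symmetric patterns *)

Definition sym_pattern n (pat : rel 'I_n) (A : 'M['F_2]_n) : bool :=
  (A^T == A) && [forall i, forall j, ~~ pat i j ==> (A i j == 0)].

Definition rank_poly n (pat : rel 'I_n) : {poly int} :=
  \sum_(A | sym_pattern pat A) 'X^(\rank A).

Lemma sym_patternP n (pat : rel 'I_n) (A : 'M['F_2]_n) :
  reflect ((forall i j, A i j = A j i) /\ (forall i j, ~~ pat i j -> A i j = 0))
          (sym_pattern pat A).
Proof.
apply: (iffP andP) => [[/eqP AT /forallP A0] | [AT A0]]; split.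
- by move=> i j; rewrite -{1}AT mxE.
- by move=> i j np; have /forallP/(_ j)/implyP/(_ np)/eqP := A0 i.
- by apply/eqP/matrixP => i j; rewrite mxE AT.
by apply/'forall_forallP => i j; apply/implyP => /A0 ->.
Qed.

Lemma mxrank_mxsub_leq n n' (f : 'I_n' -> 'I_n) (A : 'M['F_2]_n) :
  (\rank (mxsub f f A) <= \rank A)%N.
Proof.
rewrite -[A in mxsub _ _ A]mulmx1 mxsub_mul rowsubE -mulmxA.
exact: leq_trans (mxrankM_maxr _ _) (mxrankM_maxl _ _).
Qed.

Lemma rank_poly_iso n n' (pat : rel 'I_n) (pat' : rel 'I_n')
    (f : 'I_n -> 'I_n') :
  bijective f -> (forall i j, pat i j = pat' (f i) (f j)) ->
  rank_poly pat = rank_poly pat'.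
Proof.
move=> [g fK gK] Hpat.
have mK : cancel (mxsub f f : 'M['F_2]_n' -> _) (mxsub g g).
  by move=> A; apply/matrixP => i j; rewrite !mxE !gK.
have mK' : cancel (mxsub g g : 'M['F_2]_n -> _) (mxsub f f).
  by move=> A; apply/matrixP => i j; rewrite !mxE !fK.
rewrite /rank_poly [LHS](reindex (mxsub f f)); last first.
  by apply: onW_bij; exists (mxsub g g).
apply: eq_big => [A | A _].
  apply/sym_patternP/sym_patternP => -[AT A0]; split=> i j.
  - by have := AT (g i) (g j); rewrite !mxE !gK.
  - by have := A0 (g i) (g j); rewrite Hpat !mxE !gK.
  - by rewrite !mxE AT.
  - by rewrite Hpat mxE; exact: A0.
congr ('X^_); apply/eqP; rewrite eqn_leq mxrank_mxsub_leq /=.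
by rewrite -{1}(mK A) mxrank_mxsub_leq.
Qed.

Lemma sym_patternD n (pat : rel 'I_n) (A B : 'M['F_2]_n) :
  sym_pattern pat A -> sym_pattern pat B -> sym_pattern pat (A + B).
Proof.
move=> /sym_patternP[AT A0] /sym_patternP[BT B0]; apply/sym_patternP.
split=> i j; rewrite !mxE; first by rewrite AT BT.
by move=> np; rewrite A0 // B0 // addr0.
Qed.

(** Translation by [M] permutes the matrices of the pattern. It absorbs the correction that a pivot
    adds to the remaining block. *)
Lemma rank_poly_shift n (pat : rel 'I_n) (M : 'M['F_2]_n) :
  sym_pattern pat M ->
  \sum_(A | sym_pattern pat A) 'X^(\rank (A + M)%R) = rank_poly pat.
Proof.
move=> PM.
have MM A : A + M + M = A by apply/matrixP=> i j; rewrite !mxE -addrA F2_addrr addr0.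
rewrite /rank_poly [RHS](reindex (fun A => A + M)); last first.
  by apply: onW_bij; exists (fun A => A + M).
apply: eq_bigl => A; apply/idP/idP => [PA | /sym_patternD/(_ PM)].
  exact: sym_patternD.
by rewrite MM.
Qed.

Definition row_supp n (S : pred 'I_n) (r : 'rV['F_2]_n) : bool :=
  [forall j, ~~ S j ==> (r 0 j == 0)].

Lemma row_suppP n (S : pred 'I_n) (r : 'rV['F_2]_n) :
  reflect (forall j, ~~ S j -> r 0 j = 0) (row_supp S r).
Proof.
by apply: (iffP forallP) => H j; [move=> nS; exact/eqP/(implyP (H j)) | apply/implyP=> /H ->].
Qed.

Lemma card_row_supp n (S : pred 'I_n) : #|[pred r | row_supp S r]| = (2 ^ #|S|)%N.
Proof.
pose f (r : 'rV['F_2]_n) := [ffun j => r 0 j].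
pose g (h : {ffun 'I_n -> 'F_2}) : 'rV['F_2]_n := \row_j h j.
have fK : cancel f g by move=> r; apply/rowP=> j; rewrite mxE ffunE.
have gK : cancel g f by move=> h; apply/ffunP=> j; rewrite ffunE mxE.
rewrite -[X in (X ^ _)%N](card_Fp (isT : prime 2)) -(card_pffun_on 0 S (predT : pred 'F_2)).
rewrite -(card_image (can_inj gK)); apply: eq_card => r.
rewrite -[r in RHS]fK mem_image ?inE; last exact: can_inj gK.
apply/row_suppP/pffun_onP => [H | [H _] j nS].
  split=> //; apply/subsetP=> j; rewrite inE ffunE.
  by apply: contraR => /H ->.
have := contra (subsetP H j) nS.
by rewrite inE ffunE negbK => /eqP.
Qed.

(** The apex gets index 0, so that a matrix of this pattern is a [block_mx] with a 1 by 1 corner.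
    The diagonal entry of the apex is free. *)
Definition cone n (S : pred 'I_n) (pat : rel 'I_n) : rel 'I_(1 + n) :=
  fun i j => match split i, split j with
  | inl _, inl _ => true
  | inl _, inr j' => S j'
  | inr i', inl _ => S i'
  | inr i', inr j' => pat i' j'
  end.

Lemma sym_pattern_cone n (S : pred 'I_n) (pat : rel 'I_n) x (r : 'rV_n) B :
  sym_pattern (cone S pat) (block_mx x%:M r r^T B) =
  row_supp S r && sym_pattern pat B.
Proof.
apply/sym_patternP/andP => [[MT M0] | [/row_suppP r0 /sym_patternP[BT B0]]].
  split.
    apply/row_suppP => j nS; have := M0 (lshift n 0) (rshift 1 j).
    by rewrite block_mxEur; apply; rewrite /cone (unsplitK (inl _)) (unsplitK (inr _)).
  apply/sym_patternP; split=> i j.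
    by have := MT (rshift 1 i) (rshift 1 j); rewrite !block_mxEdr.
  move=> np; have := M0 (rshift 1 i) (rshift 1 j).
  by rewrite block_mxEdr; apply; rewrite /cone !(unsplitK (inr _)).
split=> i j.
  rewrite -(splitK i) -(splitK j).
  case: (split i) => i'; case: (split j) => j' /=; rewrite ?ord1 //.
  - by rewrite block_mxEur block_mxEdl mxE.
  - by rewrite block_mxEur block_mxEdl mxE.
  - by rewrite !block_mxEdr.
rewrite -{2}(splitK i) -{2}(splitK j) /cone.
case: (split i) => i'; case: (split j) => j' //=; rewrite ?ord1.
- by rewrite block_mxEur => /r0.
- by rewrite block_mxEdl mxE => /r0.
- by rewrite block_mxEdr => /B0.
Qed.

Lemma big_sym_pattern_cone n (S : pred 'I_n) (pat : rel 'I_n) (V : nmodType)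
    (f : 'M_(1 + n) -> V) :
  \sum_(A | sym_pattern (cone S pat) A) f A =
  \sum_x \sum_(r | row_supp S r) \sum_(B | sym_pattern pat B)
     f (block_mx x%:M r r^T B).
Proof.
rewrite pair_big pair_big /=.
pose h (t : 'F_2 * 'rV['F_2]_n * 'M['F_2]_n) : 'M['F_2]_(1 + n) :=
  block_mx t.1.1%:M t.1.2 t.1.2^T t.2.
rewrite (reindex h) /=.
  by apply: eq_bigl => -[[x r] B]; rewrite sym_pattern_cone.
exists (fun A : 'M['F_2]_(1 + n) => (A (lshift n 0) (lshift n 0), ursubmx A, drsubmx A)).
  move=> [[x r] B] _; rewrite /h /= block_mxKur block_mxKdr block_mxEul.
  by rewrite mxE eqxx.
move=> A /sym_patternP[AT _]; rewrite /h /= -[RHS]submxK trmx_ursub.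
have -> : A^T = A by apply/matrixP=> i j; rewrite mxE AT.
by congr block_mx; apply/matrixP=> i j; rewrite !ord1 !mxE eqxx.
Qed.

(** The order of the matrix is kept, as in the form Lambda, where row and column of the last [e] are
    zero but present. *)
Definition kill n (pat : rel 'I_n) (v : 'I_n) : rel 'I_n :=
  fun i j => [&& pat i j, i != v & j != v].

Definition clear n (v : 'I_n) (B : 'M['F_2]_n) : 'M['F_2]_n :=
  \matrix_(i, j) if (i == v) || (j == v) then 0 else B i j.

(** The matrices with a given cleared matrix differ only in row and column [v], where the [#|pat v|]
    admissible entries are free. *)
Lemma sum_clear n (pat : rel 'I_n) (v : 'I_n) (V : nmodType) (f : 'M_n -> V) :
  (forall j, pat j v = pat v j) ->
  \sum_(B | sym_pattern pat B) f (clear v B) =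
  (\sum_(B | sym_pattern (kill pat v) B) f B) *+ (2 ^ #|pat v|).
Proof.
move=> patC; rewrite -sumrMnl.
under [RHS]eq_bigr => B _ do rewrite -(card_row_supp (pat v)) -sumr_const.
rewrite pair_big /=.
pose h (t : 'M['F_2]_n * 'rV['F_2]_n) : 'M['F_2]_n :=
  \matrix_(i, j) if i == v then t.2 0 j else if j == v then t.2 0 i else t.1 i j.
have hP t : sym_pattern pat (h t) -> row_supp (pat v) t.2.
  move=> /sym_patternP[_ P0]; apply/row_suppP => j nj.
  by have := P0 v j nj; rewrite mxE eqxx.
have clear_h B r : sym_pattern (kill pat v) B -> clear v (h (B, r)) = B.
  move=> /sym_patternP[_ B0]; apply/matrixP => i j; rewrite !mxE /=.
  have [->|iv] := eqVneq i v; first by rewrite B0 // /kill eqxx andbF.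
  have [->|jv] := eqVneq j v; first by rewrite B0 // /kill eqxx !andbF.
  by [].
have h_clear B : sym_pattern pat B -> h (clear v B, row v B) = B.
  move=> /sym_patternP[BT _]; apply/matrixP => i j; rewrite !mxE /=.
  have [->//|iv] := eqVneq i v.
  by have [->//|jv] := eqVneq j v; rewrite BT.
have kill_clear B : sym_pattern pat B -> sym_pattern (kill pat v) (clear v B).
  move=> /sym_patternP[BT B0]; apply/sym_patternP.
  split=> i j; rewrite !mxE; first by rewrite BT orbC.
  rewrite /kill; have [//|iv] := eqVneq i v.
  by have [//|jv] := eqVneq j v; rewrite andbT /=; exact: B0.
have pat_h B r : sym_pattern (kill pat v) B -> row_supp (pat v) r -> sym_pattern pat (h (B, r)).
  move=> /sym_patternP[BT B0] /row_suppP r0; apply/sym_patternP.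
  split=> i j; rewrite !mxE /=.
    have [->|iv] := eqVneq i v; first by have [->|jv] := eqVneq j v.
    by case: ifP.
  have [->|iv np] := eqVneq i v; first exact: r0.
  case: ifP => [/eqP jv|_]; first by apply: r0; rewrite -patC -jv.
  by apply: B0; rewrite /kill (negPf np).
rewrite [RHS](reindex_onto (fun B => (clear v B, row v B)) h) => [|[B r] /= /andP[PB Pr]]; last first.
  rewrite clear_h //; congr (_, _); apply/rowP => j.
  by rewrite !mxE eqxx.
apply: eq_bigl => B /=; apply/idP/andP => [PB | [/andP[PB Pr] /eqP <-]].
  rewrite kill_clear // h_clear // eqxx; split=> //; apply/row_suppP => j nj.
  by rewrite mxE; case/sym_patternP: PB => _; apply.
exact: pat_h.
Qed.

Lemma sum_row_supp2 n (u v : 'I_n) (V : nmodType) (f : 'rV['F_2]_n -> V) :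
  u != v ->
  \sum_(r | row_supp (pred2 u v) r) f r =
  \sum_a \sum_b f (a *: delta_mx 0 u + b *: delta_mx 0 v).
Proof.
move=> uv; rewrite pair_big /=.
rewrite (reindex_onto (fun p : 'F_2 * 'F_2 => p.1 *: delta_mx 0 u + p.2 *: delta_mx 0 v)
          (fun r : 'rV_n => (r 0 u, r 0 v))) => [|r /row_suppP r0].
  apply: eq_bigl => -[a b] /=; rewrite !mxE !eqxx [v == u]eq_sym (negPf uv) /=.
  rewrite !mulr1 !mulr0 addr0 add0r eqxx andbT; apply/row_suppP => j /=.
  by rewrite negb_or !mxE => /andP[/negPf -> /negPf ->] /=; rewrite !mulr0 addr0.
apply/rowP => j /=; rewrite !mxE eqxx /=.
have [->|ju] := eqVneq j u; first by rewrite (negPf uv) mulr1 mulr0 addr0.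
have [->|jv] := eqVneq j v; first by rewrite mulr1 mulr0 add0r.
by rewrite !mulr0 addr0 r0 //= negb_or ju.
Qed.

Lemma sym_pattern_tensor n (pat : rel 'I_n) (p q : 'rV['F_2]_n) :
  (forall i j, p 0 i != 0 -> q 0 j != 0 -> pat i j && pat j i) ->
  sym_pattern pat (p^T *m q + q^T *m p).
Proof.
move=> H; apply/sym_patternP; split=> i j.
  by rewrite !mxE !big_ord1 !mxE addrC [X in X + _]mulrC [X in _ + X]mulrC.
move=> np; rewrite !mxE !big_ord1 !mxE.
have z a b : p 0 a != 0 -> q 0 b != 0 -> (pat a b && pat b a) = false -> False.
  by move=> pa qb; rewrite H.
have [->|pi] := eqVneq (p 0 i) 0; have [->|qj] := eqVneq (q 0 j) 0;
have [->|pj] := eqVneq (p 0 j) 0; have [->|qi] := eqVneq (q 0 i) 0;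
rewrite ?mul0r ?mulr0 ?addr0 ?add0r //; exfalso;
by [apply: (z i j); rewrite ?(negPf np) | apply: (z j i); rewrite ?(negPf np) ?andbF].
Qed.

(** * Elimination of the last vertex of a triangulated polygon *)

Section ConeCone.
Variables (n : nat) (pat : rel 'I_n) (t v : 'I_n).
Hypotheses (tv : t != v) (pvv : pat v v) (pvt : pat v t) (ptv : pat t v).
Hypothesis patC : symmetric pat.

(** In the notation of the overview, [u1] is u, [v1] is v and the apex of [pat0] is w; the
    neighbours of u in [pat] are [v] and [t]. *)
Let pat1 : rel 'I_(1 + n) := cone (pred2 t v) pat.
Let u1 : 'I_(1 + n) := lshift n 0.
Let v1 : 'I_(1 + n) := rshift 1 v.
Let pat0 : rel 'I_(1 + (1 + n)) := cone (pred2 u1 v1) pat1.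

Let uv1 : u1 != v1. Proof. by rewrite eq_lrshift. Qed.

Let pat1C : symmetric pat1.
Proof.
by move=> i j; rewrite /pat1 /cone; case: (split i) => a; case: (split j) => b.
Qed.

Let pat1uu : pat1 u1 u1. Proof. by rewrite /pat1 /cone (unsplitK (inl _)). Qed.
Let pat1uv : pat1 u1 v1.
Proof. by rewrite /pat1 /cone (unsplitK (inl _)) (unsplitK (inr _)) /= eqxx orbT. Qed.
Let pat1vv : pat1 v1 v1. Proof. by rewrite /pat1 /cone (unsplitK (inr _)). Qed.

(** The Schur complement subtracts [r^T *m r], which is supported on u and v. All four positions are
    free in [pat1], so a shift removes it. *)
Lemma rank_poly_pivot1 (r : 'rV_(1 + n)) : row_supp (pred2 u1 v1) r ->
  \sum_(B | sym_pattern pat1 B) 'X^(\rank (block_mx 1%:M r r^T B)%R) =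
  'X * rank_poly pat1.
Proof.
move=> /row_suppP r0; rewrite -(@rank_poly_shift _ pat1 (- (r^T *m r))).
  rewrite big_distrr /=; apply: eq_bigr => B _.
  by rewrite mxrank_pivot1 exprS.
apply/sym_patternP; split=> i j; rewrite !mxE !big_ord1 !mxE; first by rewrite mulrC.
have [-> _|ri] := eqVneq (r 0 i) 0; first by rewrite mul0r oppr0.
have [-> _|rj] := eqVneq (r 0 j) 0; first by rewrite mulr0 oppr0.
have H k : r 0 k != 0 -> k = u1 \/ k = v1.
  by have [//|/= /norP[/eqP ? /eqP ?]] := boolP (pred2 u1 v1 k); [move=> /= /orP[]/eqP;
    auto | rewrite r0 ?eqxx //= negb_or; apply/andP; split; apply/eqP].
by case: (H i ri) (H j rj) => -> [] -> /negP[] //; rewrite pat1C.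
Qed.

(** With [e] the basis vector of v, the projection [K] deletes coordinate v. Hence [K^T *m B *m K]
    is [B] with row and column v cleared, and the entries of that row only contribute a power of
    2. *)
Lemma rank_poly_pivot_v :
  \sum_(B | sym_pattern pat1 B)
     'X^(\rank (block_mx 0 (delta_mx 0 v1) (delta_mx 0 v1)^T B : 'M['F_2]_(1 + (1 + n)))) =
  2 ^+ #|pat1 v1| *: 'X^2 * rank_poly (kill pat1 v1).
Proof.
have K_diag : 1%:M - delta_mx v1 (0 : 'I_1) *m delta_mx 0 v1 =
    diag_mx (\row_j (j != v1)%:R) :> 'M['F_2]_(1 + n).
  apply/matrixP => i j; rewrite mul_delta_mx !mxE.
  case: (eqVneq i j) => [->|ij].
    by rewrite andbb; case: eqVneq => _; rewrite ?subrr ?subr0.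
  have -> : (i == v1) && (j == v1) = false.
    by apply/negP => /andP[/eqP ei /eqP ej]; rewrite ei ej eqxx in ij.
  by rewrite subr0.
have -> : 2 ^+ #|pat1 v1| *: 'X^2 * rank_poly (kill pat1 v1) =
   (\sum_(B | sym_pattern (kill pat1 v1) B) 'X^2 * 'X^(\rank B)) *+ 2 ^ #|pat1 v1|.
  by rewrite -big_distrr /= -scaler_nat natrX -scalerAl.
rewrite -(sum_clear (fun B => 'X^2 * 'X^(\rank B))); last by move=> j; rewrite pat1C.
apply: eq_bigr => B _; rewrite (@mxrank_pivot2 _ _ _ (delta_mx v1 0)); last first.
  by rewrite mul_delta_mx; apply/matrixP=> i j; rewrite !ord1 !mxE.
rewrite -exprD K_diag tr_diag_mx mul_diag_mx mul_mx_diag; congr ('X^(2 + \rank _)).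
apply/matrixP => i j; rewrite !mxE.
by case: eqP; case: eqP; rewrite ?mul0r ?mulr0 ?mul1r ?mulr1.
Qed.

(** With [e] the basis vector of u, the row of u survives only as a correction of the block on
    [pat]. The 2 diagonal values and the 4 rows supported on [t] and [v] therefore contribute
    equally, which gives 8. *)
Lemma rank_poly_pivot_u (z : 'F_2) :
  \sum_(B | sym_pattern pat1 B)
     'X^(\rank (block_mx 0 (delta_mx 0 u1 + z *: delta_mx 0 v1)
                  (delta_mx 0 u1 + z *: delta_mx 0 v1)^T B : 'M['F_2]_(1 + (1 + n)))) =
  8 *: 'X^2 * rank_poly pat.
Proof.
set r := delta_mx 0 u1 + _; pose r' : 'rV['F_2]_n := z *: delta_mx 0 v.
have r_row : r = row_mx 1%:M r'.
  apply/rowP => j; rewrite -(splitK j); case: (split j) => j' /=.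
    by rewrite row_mxEl ord1 !mxE !eqxx /v1 eq_lrshift mulr0 addr0.
  by rewrite row_mxEr !mxE /= add0r eq_rshift.
pose e : 'cV['F_2]_(1 + n) := col_mx 1%:M 0.
have re : r *m e = 1%:M by rewrite r_row mul_row_col mulmx1 mulmx0 addr0.
rewrite big_sym_pattern_cone.
have step w c : row_supp (pred2 t v) c ->
  \sum_(B | sym_pattern pat B)
    'X^(\rank (block_mx 0 r r^T (block_mx w%:M c c^T B) : 'M['F_2]_(1 + (1 + n)))) =
  'X^2 * rank_poly pat.
  move=> /row_suppP c0.
  (* The lower right block of [K^T *m B *m K] is the old block plus [M]. The correction lives on the
     edge between [t] and [v] and the loop at [v], hence inside the pattern. *)
  pose M := w *: (r'^T *m r') + (r'^T *m c + c^T *m r').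
  have r'0 j : r' 0 j != 0 -> j = v.
    by rewrite !mxE eqxx; case: (j =P v) => // _; rewrite mulr0 eqxx.
  have patM : sym_pattern pat M.
    apply: sym_patternD.
      apply/sym_patternP; split=> i j; rewrite mxE [(_ *m _) _ _]mxE big_ord1.
        by rewrite [RHS]mxE [(_ *m _) j i]mxE big_ord1 [(r'^T) i _]mxE [(r'^T) j _]mxE [X in _ * X]mulrC.
      move=> np; rewrite [(r'^T) _ _]mxE.
      have [->|/r'0 iv] := eqVneq (r' 0 i) 0; first by rewrite mul0r mulr0.
      have [->|/r'0 jv] := eqVneq (r' 0 j) 0; first by rewrite !mulr0.
      by rewrite iv jv pvv in np.
    apply: sym_pattern_tensor => i j /r'0 -> cj.
    have : pred2 t v j by apply: contraR cj => /c0 ->.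
    by move=> /= /orP[] /eqP ->; rewrite ?pvv ?pvt ?ptv.
  rewrite -(rank_poly_shift patM) big_distrr /=; apply: eq_bigr => B _.
  rewrite (mxrank_pivot2 _ re) exprD; congr (_ * 'X^_).
  have -> : 1%:M - e *m r = block_mx 0 (- r') 0 1%:M.
    rewrite r_row mul_col_row scalar_mx_block opp_block_mx add_block_mx.
    by rewrite !mul1mx !mul0mx subrr !subr0 sub0r.
  rewrite tr_block_mx !mulmx_block !trmx0 trmx1.
  rewrite !(mul1mx, mulmx1, mul0mx, mulmx0, addr0, add0r).
  rewrite rank_diag_block_mx mxrank0 add0n; congr (\rank _).
  have -> : - r' = r' by apply/rowP=> j; rewrite mxE F2_oppr.
  rewrite mul_mx_scalar mulmxDl -scalemxAl addrA addrC -[_ + _ *m r' + _]addrA.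
  by congr (_ + (_ + _)); rewrite addrC.
under eq_bigr => w _ do under eq_bigr => c Hc do rewrite step //.
under eq_bigr => w _ do rewrite sumr_const card_row_supp card2 tv.
by rewrite sumr_const card_Fp // -mulrnA -scalerAl -scaler_nat.
Qed.

(** With corner 1, each of the 4 rows of w gives ['X * rank_poly pat1]. With corner 0, the zero row
    gives [rank_poly pat1], the two rows meeting u give 8 + 8, and the row meeting v alone gives the
    [kill] term. *)
Theorem rank_poly_cone_cone :
  rank_poly pat0 = (1 + 4 *: 'X) * rank_poly pat1 + 16 *: 'X^2 * rank_poly pat
    + 2 ^+ #|pat1 v1| *: 'X^2 * rank_poly (kill pat1 v1).
Proof.
rewrite {1}/rank_poly big_sym_pattern_cone F2_sum.
under [X in _ + X]eq_bigr => r Hr do rewrite rank_poly_pivot1 //.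
rewrite sumr_const card_row_supp sum_row_supp2 // !F2_sum.
rewrite !scale0r !add0r !addr0 !scale1r.
rewrite raddf0 rank_poly_pivot_v.
have := rank_poly_pivot_u 0; rewrite scale0r addr0 => ->.
have := rank_poly_pivot_u 1; rewrite scale1r => ->.
rewrite trmx0; under eq_bigr => B _ do rewrite rank_diag_block_mx mxrank0 add0n.
rewrite card2 uv1 -[_ *+ 2 ^ 2]scaler_nat mulrDl mul1r -!scalerAl -scalerDl.
rewrite -/(rank_poly pat1) -[8 + 8]/(16 : int) addrAC -!addrA; congr (_ + _).
by rewrite addrC -!addrA; congr (_ + _); rewrite addrC.
Qed.
End ConeCone.

(** * Darts, edges and spanning trees *)

Local Notation head := Defs.head.

(** The values at the component representatives are arbitrary and determine the function. Counting
    components thus becomes counting solutions of linear equations. *)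
Lemma card_invariant_ffun (X : finType) (e : rel X) : connect_sym e ->
  #|[set f : {ffun X -> 'F_2} | [forall x, forall y, e x y ==> (f x == f y)]]|
  = (2 ^ n_comp e predT)%N.
Proof.
move=> eC.
pose B := [set g in pffun_on (0 : 'F_2) (roots e) (predT : pred 'F_2)].
pose h (g : {ffun X -> 'F_2}) := [ffun x => g (fingraph.root e x)].
have Bz g x : g \in B -> ~~ roots e x -> g x = 0.
  rewrite inE => /pffun_onP[/subsetP s _] nr; apply/eqP.
  by apply: contraR nr => gx; apply: s.
have h_inj : {in B &, injective h}.
  move=> g g' gB g'B /ffunP E; apply/ffunP => x.
  have [rx|nr] := boolP (roots e x); last by rewrite !Bz.
  by have := E x; rewrite !ffunE (eqP rx).
have -> : [set f : {ffun X -> 'F_2} | [forall x, forall y, e x y ==> (f x == f y)]] = h @: B.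
  apply/setP => f; rewrite inE; apply/'forall_forallP/imsetP => [H | [g _ ->] x y].
    have Hc x y : connect e x y -> f x = f y.
      case/connectP => p; elim: p x => [|z p IH] x /=; first by move=> _ ->.
      by case/andP => /(implyP (H x z))/eqP -> /IH.
    exists [ffun x => if roots e x then f x else 0].
      rewrite inE; apply/pffun_onP; split=> //; apply/subsetP => x.
      by rewrite !inE ffunE; case: ifP; rewrite ?eqxx.
    by apply/ffunP => x; rewrite !ffunE roots_root //; apply: Hc; apply: connect_root.
  apply/implyP => exy; rewrite !ffunE; apply/eqP; congr (g _).
  by apply/eqP; rewrite root_connect // connect1.
rewrite card_in_imset // cardsE card_pffun_on card_Fp //; congr (2 ^ _)%N.
by apply: eq_card => x; rewrite !inE andbT.
Qed.

Lemma card_kermx_F2 n (A : 'M['F_2]_n) :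
  #|[set g : 'rV_n | g *m A == 0]| = (2 ^ (n - \rank A))%N.
Proof.
rewrite -mxrank_ker -[X in (X ^ _)%N](card_Fp (isT : prime 2)).
by rewrite -card_rowg; apply: eq_card => g; rewrite inE mem_rowg sub_kermx.
Qed.

Section Darts.
Variable G : sgraph.
Implicit Types (d : dart G) (e : edge G).

Lemma rev_dartK : involutive (@rev_dart G).
Proof. by move=> [[x y] p]; apply: val_inj. Qed.

Lemma edge_of_rev d : edge_of (rev_dart d) = edge_of d.
Proof. by apply: val_inj; rewrite /= setUC. Qed.

Lemma tail_neq_head d : tail d != head d.
Proof. by apply: contraTneq (valP d) => E; rewrite -/(tail d) -/(head d) E sedge_irr. Qed.

Lemma rev_dart_neq d : rev_dart d != d.
Proof. by apply: contraNneq (tail_neq_head d) => E; rewrite -{1}E. Qed.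

Lemma dart_ext d d' : tail d = tail d' -> head d = head d' -> d = d'.
Proof.
case: d d' => [[x y] p] [[x' y'] p']; rewrite /tail /head /= => E1 E2.
by apply: val_inj; rewrite /= E1 E2.
Qed.

Lemma edge_of_eq d d' : edge_of d = edge_of d' -> d' = d \/ d' = rev_dart d.
Proof.
move=> /(congr1 val)/setP E.
have := E (tail d); have := E (head d); have := E (tail d'); have := E (head d').
rewrite !inE !eqxx ?orbT /= => h1 t1 h2 t2.
have tn := tail_neq_head d'.
case/orP: t1 => /eqP t1; case/orP: h1 => /eqP h1.
- by rewrite t1 h1 eqxx in tn.
- by left; apply: dart_ext.
- by right; apply: dart_ext.
- by rewrite t1 h1 eqxx in tn.
Qed.

Lemma edge_ofP e : exists d, edge_of d = e.
Proof.
case: e => a ea; have /imsetP[p] := ea; rewrite inE => sp E.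
by exists (exist _ p sp); apply: val_inj; rewrite /= E.
Qed.

Lemma sum_edge_darts (V : nmodType) (f : dart G -> V) d :
  \sum_(d' | edge_of d' == edge_of d) f d' = f d + f (rev_dart d).
Proof.
rewrite (bigD1 d) //=; congr (_ + _); apply: big_pred1 => d'.
apply/andP/eqP => [[/eqP E nd]|->]; last by rewrite edge_of_rev eqxx rev_dart_neq.
by case: (edge_of_eq (esym E)) nd => -> //; rewrite eqxx.
Qed.

Lemma sum_darts (V : nmodType) (f : dart G -> V) :
  \sum_d f d = \sum_e \sum_(d | edge_of d == e) f d.
Proof. exact: (partition_big (@edge_of G) predT). Qed.

Lemma card_darts : #|{: dart G}| = (#|{: edge G}|).*2.
Proof.
rewrite -sum1_card sum_darts -mul2n mulnC -sum_nat_const.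
apply: eq_bigr => e _; have [d <-] := edge_ofP e.
by rewrite (sum_edge_darts (fun _ => 1%N)).
Qed.

(** The coboundary modulo 2; the sum over both darts of the edge spares the choice of an
    orientation. *)
Definition cobound (c : G -> 'F_2) e : 'F_2 := \sum_(d | edge_of d == e) c (tail d).

Lemma cobound_edge c d : cobound c (edge_of d) = c (tail d) + c (head d).
Proof. exact: sum_edge_darts. Qed.

Lemma sum_cobound (a : edge G -> 'F_2) c :
  \sum_e a e * cobound c e = \sum_d a (edge_of d) * c (tail d).
Proof.
rewrite sum_darts; apply: eq_bigr => e _; rewrite big_distrr /=.
by apply: eq_bigr => d /eqP ->.
Qed.

(* Both properties hold for spanning trees: the cut function of e is the
   indicator of one of the two components left after deleting e. *)
Definition tree_like (T : {set edge G}) : Prop :=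
  (forall c : G -> 'F_2, (forall e, e \in T -> cobound c e = 0) ->
     forall x y, c x = c y) /\
  (forall e, e \in T -> exists C : G -> 'F_2,
     forall e', e' \in T -> cobound C e' = (e' == e)%:R).

Lemma tree_relP (T : {set edge G}) x y :
  reflect (exists2 d, edge_of d \in T & tail d = x /\ head d = y) (tree_rel T x y).
Proof.
apply: (iffP existsP) => [[e /andP[eT /eqP E]] | [d dT [<- <-]]]; last first.
  by exists (edge_of d); rewrite dT eqxx.
have [d de] := edge_ofP e.
have := congr1 val de; rewrite /= E => /setP S.
have := S x; have := S y; have := S (tail d); have := S (head d).
rewrite !inE !eqxx ?orbT /= => h t hy hx.
have tn := tail_neq_head d.
case/esym/orP: t => /eqP t; case/esym/orP: h => /eqP h.
- by rewrite t h eqxx in tn.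
- by exists d; rewrite ?de.
- by exists (rev_dart d); rewrite ?edge_of_rev ?de.
- by rewrite t h eqxx in tn.
Qed.

Lemma tree_rel_sym (T : {set edge G}) : symmetric (tree_rel T).
Proof. by move=> x y; apply: eq_existsb => e; rewrite setUC. Qed.

(** The cut function of [e0] is the indicator of the component of one end of [e0] in [T :\ e0];
    acyclicity keeps the other end out of it. *)
Lemma spanning_tree_like (T : {set edge G}) : spanning_tree T -> tree_like T.
Proof.
move=> [conn acyc]; split=> [c cT x y | e0 e0T].
  have /connectP[p] := conn x y; elim: p x => [|z p IH] x /=; first by move=> _ ->.
  case/andP => /tree_relP[d dT [<- <-]] pth /(IH _ pth) <-.
  apply/eqP; rewrite -subr_eq0 -[- _]F2_oppr opprK -cobound_edge; exact/eqP/cT.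
have [d0 de0] := edge_ofP e0.
pose tr := tree_rel (T :\ e0).
have trC : connect_sym tr by apply: sym_connect_sym; apply: tree_rel_sym.
have sub x y : tr x y -> tree_rel T x y.
  by case/tree_relP => d; rewrite inE => /andP[_ dT] [<- <-]; apply/tree_relP; exists d.
have ncon : connect tr (tail d0) (head d0) = false.
  apply/negP => /connectP[p0 pth0 last0].
  case: (shortenP pth0) last0 => p pth uni _ lastE.
  have /acyc : ucycle (tree_rel T) (tail d0 :: p).
    rewrite /ucycle uni andbT /= rcons_path (sub_path sub pth) -lastE.
    by rewrite tree_rel_sym; apply/tree_relP; exists d0; rewrite ?de0.
  (* A simple path joining the ends of [e0] closes up to a cycle of fewer than three vertices, so it
     is empty or a single edge; that edge would be [e0] itself, which was deleted. *)
  case: p pth uni lastE => [|y [|]] //= pth _ lastE.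
    by have := tail_neq_head d0; rewrite -lastE eqxx.
  move: pth; rewrite andbT -lastE => /tree_relP[d] + [td hd].
  by rewrite (dart_ext td hd) inE de0 inE eqxx.
exists (fun x => (connect tr (tail d0) x)%:R) => e.
have [d <-] := edge_ofP e => dT; rewrite cobound_edge.
have [E|ne] := eqVneq (edge_of d) e0.
  by move: E; rewrite -de0 => /esym/edge_of_eq[] ->;
    rewrite ?[tail (rev_dart _)]/(head _) ?[head (rev_dart _)]/(tail _) connect0 ncon ?addr0 ?add0r.
have td : tr (tail d) (head d) by apply/tree_relP; exists d; rewrite ?inE ?ne.
by rewrite (same_connect_r trC (connect1 td)) F2_addrr.
Qed.

(** Superposing the cut functions gives one solution, and connectedness makes any two solutions
    differ by one of the two constants. *)
Lemma card_potentials (T : {set edge G}) (x0 : G) (q : edge G -> 'F_2) :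
  tree_like T ->
  #|[set c : {ffun G -> 'F_2} | [forall e in T, cobound c e == q e]]| = 2%N.
Proof.
move=> [conn cuts].
have coboundD c c' e : cobound (fun x => c x + c' x) e = cobound c e + cobound c' e.
  by rewrite /cobound -big_split.
have [C HC] : exists C : edge G -> G -> 'F_2,
    forall e, e \in T -> forall e', e' \in T -> cobound (C e) e' = (e' == e)%:R.
  apply: (@fin_all_exists _ _ (fun e C => e \in T -> forall e', e' \in T -> cobound C e' = (e'
    == e)%:R)).
  move=> e; have [eT|_] := boolP (e \in T); last by exists (fun=> 0).
  by have [C HC] := cuts e eT; exists C.
pose c0 x := \sum_(e in T) q e * C e x.
have Hc0 e : e \in T -> cobound c0 e = q e.
  move=> eT; rewrite /cobound exchange_big /=.
  under eq_bigr => e' e'T do rewrite -big_distrr /= -/(cobound (C e') e) HC //.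
  rewrite (bigD1 e) //= eqxx mulr1 big1 ?addr0 // => e' /andP[_ ne].
  by rewrite eq_sym (negPf ne) mulr0.
have -> : [set c : {ffun G -> 'F_2} | [forall e in T, cobound c e == q e]] =
    [set [ffun x => c0 x + b] | b in {: 'F_2}].
  apply/setP => c; rewrite inE; apply/'forall_implyP/imsetP => [Hc | [b _ ->] e eT].
    exists (c0 x0 + c x0) => //; apply/ffunP => x; rewrite ffunE.
    have := conn (fun x => c0 x + c x) _ x0 x.
    move=> -> => [|e eT]; first by rewrite addrA F2_addrr add0r.
    by rewrite coboundD Hc0 // (eqP (Hc e eT)) F2_addrr.
  have [d de] := edge_ofP e; rewrite -(Hc0 e eT) -de !cobound_edge !ffunE.
  by rewrite addrACA F2_addrr addr0.
rewrite card_imset ?card_Fp // => b b' /ffunP/(_ x0).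
by rewrite !ffunE => /addrI.
Qed.

(** A cycle modulo 2 is orthogonal to every cut, and the cut of [e] meets the tree in [e] alone. *)
Lemma cycle_in_tree (T : {set edge G}) (a : edge G -> 'F_2) :
  tree_like T -> (forall x, \sum_(d | tail d == x) a (edge_of d) = 0) ->
  (forall e, e \notin T -> a e = 0) -> forall e, a e = 0.
Proof.
move=> [_ cuts] even supp e; have [eT|] := boolP (e \in T); last exact: supp.
have [C HC] := cuts e eT.
have : \sum_e' a e' * cobound C e' = 0.
  rewrite sum_cobound (partition_big (@tail G) predT) //=.
  rewrite big1 // => x _.
  transitivity ((\sum_(d | tail d == x) a (edge_of d)) * C x).
    by rewrite big_distrl; apply: eq_bigr => d /eqP ->.
  by rewrite even mul0r.
rewrite (bigD1 e) //= HC // eqxx mulr1 big1 ?addr0 // => e' ne.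
have [e'T|nT] := boolP (e' \in T); last by rewrite supp // mul0r.
by rewrite HC // (negPf ne) mulr0.
Qed.

End Darts.

(** * Cubic graphs with a dual *)

Section Rotations.
Variable G : sgraph.
Implicit Types (d : dart G) (rho : {perm dart G}).

Lemma rotation_exists : exists rho : {perm dart G}, is_rotation rho.
Proof.
pose s d := enum [pred d' | tail d' == tail d].
have s_tail d d' : tail d = tail d' -> s d = s d' by rewrite /s => ->.
have mem_s d d' : (d' \in s d) = (tail d' == tail d) by rewrite mem_enum.
have uniq_s d : uniq (s d) := enum_uniq _.
have tail_next d : tail (next (s d) d) = tail d.
  by apply/eqP; rewrite -mem_s mem_next mem_s.
have inj : injective (fun d => next (s d) d).
  apply: (can_inj (g := fun d => prev (s d) d)) => d.
  by rewrite (s_tail _ d) ?tail_next // prev_next.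
exists (perm inj); apply/forallP => d; apply/eqP/setP => d'.
rewrite inE -mem_s.
have -> : (d' \in porbit (perm inj) d) = fconnect (perm inj) d d'.
  apply/porbitP/idP => [[i ->]|/iter_findex <-]; first by rewrite permX fconnect_iter.
  by exists (findex (perm inj) d d'); rewrite permX.
have cyc : fcycle (perm inj) (s d).
  have := cycle_next (uniq_s d); apply: sub_in_cycle (allss _) => x y; rewrite !mem_s => /eqP xd _.
  by rewrite /= permE (s_tail x d).
by rewrite (fconnect_cycle cyc) // mem_s.
Qed.

Lemma rotation_tail rho d : is_rotation rho -> tail (rho d) = tail d.
Proof.
move=> /forallP/(_ d)/eqP/setP/(_ (rho d)); rewrite inE => E.
by apply/eqP; rewrite -E -{1}[rho]expg1 mem_porbit.
Qed.

Hypothesis cubic : forall x : G, #|[set d | tail d == x]| = 3%N.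
Variable rho : {perm dart G}.
Hypothesis rot : is_rotation rho.

Let card_orbit d : #|porbit rho d| = 3%N.
Proof. by move/forallP: rot => /(_ d)/eqP ->. Qed.

Lemma rotation3 d : rho (rho (rho d)) = d.
Proof. by have := iter_porbit rho d; rewrite card_orbit. Qed.

Lemma rotation_uniq d : uniq [:: d; rho d; rho (rho d)].
Proof. by have := uniq_traject_porbit rho d; rewrite card_orbit. Qed.

Lemma rotation_mem d d' : tail d' = tail d -> d' \in [:: d; rho d; rho (rho d)].
Proof.
move=> E; have := porbit_traject rho d d'; rewrite card_orbit => <-.
by move/forallP: rot => /(_ d)/eqP ->; rewrite inE E.
Qed.

Lemma sum_rotation (V : nmodType) (f : dart G -> V) (P : pred G) :
  \sum_(d | P (tail d)) f (rho d) = \sum_(d | P (tail d)) f d.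
Proof.
rewrite [RHS](reindex_inj (@perm_inj _ rho)) /=.
by apply: eq_bigl => d; rewrite rotation_tail.
Qed.

End Rotations.

Lemma eq_pairs (X : eqType) (a b c d : X) : a != b -> c != d ->
  (forall i, (a == i) || (b == i) = (c == i) || (d == i)) ->
  (a = c /\ b = d) \/ (a = d /\ b = c).
Proof.
move=> ab cd E; have := E a; have := E b; have := E c.
rewrite !eqxx ?orbT /= => /orP[]/eqP H1 /esym/orP[]/eqP H2 /esym/orP[]/eqP H3; subst;
  rewrite ?eqxx in ab cd; auto; done.
Qed.

Lemma F2_addb (a b : bool) : (a (+) b)%:R = a%:R + b%:R :> 'F_2.
Proof. by apply/eqP; case: a b => [] []. Qed.

(** * Face labellings and the rank of the border form *)

Section FaceData.
Variables (G : sgraph) (N : nat) (kappa : dart G -> option 'I_N).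
Implicit Types (d : dart G) (e : edge G).

(* [kappa d] is the face at the corner of the cubic vertex [tail d] that is
   opposite to [d]; [None] is the outer face.  The edge of [d] borders the
   other two faces at [tail d]. *)
Definition borders e (i : option 'I_N) : bool :=
  [exists d, (edge_of d == e) &&
     [exists d', [&& tail d' == tail d, d' != d & kappa d' == i]]].

Definition border_coef e (j : 'I_N) : 'F_2 := (borders e (Some j))%:R.

(* The Laplacian of the dual graph with edge weights [t], without the row and
   column of the outer face. *)
Definition border_form (t : edge G -> 'F_2) : 'M['F_2]_N :=
  \matrix_(i, j) \sum_e t e * border_coef e i * border_coef e j.

Definition face_val (g : 'rV['F_2]_N) (i : option 'I_N) : 'F_2 :=
  if i is Some j then g 0 j else 0.

Definition face_diff (g : 'rV['F_2]_N) e : 'F_2 :=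
  \sum_j border_coef e j * g 0 j.

(* The twists that turn [rho] into the planar embedding with corner faces
   [kappa]. *)
Definition mismatch (rho : {perm dart G}) e : bool :=
  [exists d, (edge_of d == e) && (kappa (rho (rho d)) != kappa (rho (rev_dart d)))].

(** The flag [(d, true)] lies in the corner between [d] and [rho d], which is opposite to the third
    dart [rho (rho d)]; likewise [(d, false)] lies opposite to [rho d]. *)
Definition side (rho : {perm dart G}) d (b : bool) : option 'I_N :=
  kappa (if b then rho (rho d) else rho d).

Hypothesis cubic : forall x : G, #|[set d | tail d == x]| = 3%N.
Hypothesis kappa_inj : forall d d', tail d = tail d' -> kappa d = kappa d' -> d = d'.
Hypothesis kappa_edge : forall d d', tail d' = tail d -> d' != d ->
  exists d'', [/\ tail d'' = head d, d'' != rev_dart d & kappa d'' = kappa d'].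

(** [T0] is a reference tree, independent of the tree in the definition of the polynomial. Among the
    inner faces, [cyc j] borders only [j], so its twist acts on the entry [(j, j)] alone. [euler_eq]
    is Euler's formula for the planar embedding with [N] inner faces. *)
Variables (T0 : {set edge G}) (cyc : 'I_N -> edge G).
Hypothesis T0_tree : tree_like T0.
Hypothesis T0_cyc : forall e, e \notin T0 -> exists j, e = cyc j.
Hypothesis cyc_border : forall j i, border_coef (cyc j) i = (i == j)%:R.
Hypothesis euler_eq : (#|{: edge G}|.+1 = #|G| + N)%N.

Section OneRotation.
Variable rho : {perm dart G}.
Hypothesis rot : is_rotation rho.

Let rot_neq d : (rho d == d = false) * (rho (rho d) == d = false) * (rho d == rho (rho d) = false).
Proof.
have := rotation_uniq cubic rot d; rewrite /= !inE !negb_or.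
case/andP => /andP[/negPf h1 /negPf h2] /andP[/negPf h3 _].
by rewrite h3 eq_sym h1 eq_sym h2.
Qed.

Lemma bordersE d i :
  borders (edge_of d) i = (kappa (rho d) == i) || (kappa (rho (rho d)) == i).
Proof.
have key d' : tail d' = tail d -> d' != d -> kappa d' == i ->
    (kappa (rho d) == i) || (kappa (rho (rho d)) == i).
  move=> /(rotation_mem cubic rot); rewrite !inE => /or3P[]/eqP -> //; rewrite ?eqxx //.
    by move=> _ ->.
  by move=> _ ->; rewrite orbT.
apply/existsP/idP => [[d1 /andP[/eqP E /existsP[d' /and3P[/eqP td nd kd]]]] | ].
  case: (edge_of_eq E) => Ed; first by apply: (key d'); rewrite ?Ed.
  have [d'' [td'' nd'' kd'']] := kappa_edge td nd.
  by apply: (key d''); rewrite ?kd'' // ?td'' ?Ed.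
move=> H; exists d; rewrite eqxx; apply/existsP; case/orP: H => H.
  by exists (rho d); rewrite rotation_tail // eqxx rot_neq.
by exists (rho (rho d)); rewrite !rotation_tail // eqxx rot_neq.
Qed.

Lemma kappa_rot_neq d : kappa (rho d) != kappa (rho (rho d)).
Proof.
apply/eqP => /kappa_inj; rewrite !rotation_tail // => /(_ erefl)/eqP.
by rewrite rot_neq.
Qed.

Lemma border_nat d i :
  borders (edge_of d) i = ((kappa (rho d) == i) + (kappa (rho (rho d)) == i))%N :> nat.
Proof.
rewrite bordersE; have := kappa_rot_neq d.
case: (kappa (rho d) =P i) => [->|_] /=; last by rewrite add0n.
by rewrite eq_sym => /negPf ->.
Qed.

Lemma border_coefE d j :
  border_coef (edge_of d) j =
  (kappa (rho d) == Some j)%:R + (kappa (rho (rho d)) == Some j)%:R.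
Proof.
by rewrite /border_coef border_nat natrD.
Qed.

Lemma face_diffE g d :
  face_diff g (edge_of d) = face_val g (kappa (rho d)) + face_val g (kappa (rho (rho d))).
Proof.
have H k : \sum_j (k == Some j)%:R * g 0 j = face_val g k.
  case: k => [j|] /=; last by rewrite big1 // => j _; rewrite mul0r.
  rewrite (bigD1 j) //= eqxx mul1r big1 ?addr0 // => i ij.
  by rewrite (inj_eq (@Some_inj _)) eq_sym (negPf ij) mul0r.
rewrite -!H -big_split; apply: eq_bigr => j _ /=.
by rewrite border_coefE mulrDl.
Qed.

(** Both ends of an edge see the same two faces, in parallel or crossed; [mismatch] tells these
    cases apart. *)
Lemma border_pairs d :
  (kappa (rho d) = kappa (rho (rev_dart d)) /\
   kappa (rho (rho d)) = kappa (rho (rho (rev_dart d)))) \/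
  (kappa (rho d) = kappa (rho (rho (rev_dart d))) /\
   kappa (rho (rho d)) = kappa (rho (rev_dart d))).
Proof.
apply: eq_pairs; rewrite ?kappa_rot_neq // => i.
by rewrite -!bordersE edge_of_rev.
Qed.

Lemma mismatchE d :
  mismatch rho (edge_of d) = (kappa (rho (rho d)) != kappa (rho (rev_dart d))).
Proof.
apply/existsP/idP => [[d1 /andP[/eqP E H]]|H]; last by exists d; rewrite eqxx.
case: (edge_of_eq E) => Ed; subst d.
  by [].
by move: H; rewrite rev_dartK; case: (border_pairs d1) => -[-> ->] //; rewrite !eqxx.
Qed.

(** A band twisted exactly according to [mismatch] joins flags of the same planar face. *)
Lemma side_band d b : side rho (rev_dart d) (~~ b (+) mismatch rho (edge_of d)) = side rho d b.
Proof.
rewrite mismatchE /side; have n := kappa_rot_neq (rev_dart d); rewrite eq_sym in n.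
by case: (border_pairs d) => -[E1 E2]; rewrite E2 ?n ?eqxx; case: b => //=; rewrite ?E1 ?E2.
Qed.

Lemma face_diff_side g d b :
  face_diff g (edge_of d) = face_val g (side rho d b) + face_val g (side rho d (~~ b)).
Proof. by rewrite face_diffE /side; case: b => //=; rewrite addrC. Qed.

(** The boundary of a face is a cycle: each of its corners contributes the value of [c] at the
    corner vertex twice. *)
Lemma sum_face_cobound (c : G -> 'F_2) j :
  \sum_e border_coef e j * cobound c e = 0.
Proof.
rewrite sum_cobound.
under eq_bigr => d _ do rewrite border_coefE mulrDl.
have H d : tail d = tail (rho d) by rewrite rotation_tail.
rewrite big_split /= [X in X + _](eq_bigr (fun d => (kappa (rho d) == Some j)%:R * c (tail (rho
  d)))); last by move=> d _; rewrite -H.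
rewrite [X in _ + X](eq_bigr (fun d => (kappa (rho (rho d)) == Some j)%:R * c (tail (rho (rho
  d))))); last by move=> d _; rewrite -!H.
rewrite (sum_rotation rot (fun d => (kappa (rho d) == Some j)%:R * c (tail (rho d))) predT).
by rewrite F2_addrr.
Qed.

Variable tau : {ffun edge G -> bool}.
Let t e : 'F_2 := (tau e (+) mismatch rho e)%:R.

Definition face_labelling (p : 'rV['F_2]_N * {ffun G -> 'F_2}) : {ffun flag G -> 'F_2} :=
  [ffun x => face_val p.1 (side rho x.1 x.2) + p.2 (tail x.1)].

(** If the total twist [t] vanishes, the two flags lie in the same planar face and only the vertex
    terms differ; otherwise they lie in the two different faces along the edge. *)
Lemma band_labelling p d b :
  face_labelling p (d, b) + face_labelling p (rev_dart d, ~~ b (+) tau (edge_of d)) =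
  cobound p.2 (edge_of d) + t (edge_of d) * face_diff p.1 (edge_of d).
Proof.
rewrite !ffunE /= -[tail (rev_dart d)]/(head d) addrACA -cobound_edge addrC.
congr (_ + _); rewrite /t (face_diff_side _ _ b).
have [E|] := eqVneq (tau (edge_of d)) (mismatch rho (edge_of d)).
  by rewrite E addbb mul0r side_band F2_addrr.
move=> ne; have -> : tau (edge_of d) = ~~ mismatch rho (edge_of d).
  by case: (tau _) (mismatch _ _) ne => [] [].
have -> : ~~ b (+) ~~ mismatch rho (edge_of d) = ~~ ~~ b (+) mismatch rho (edge_of d).
  by rewrite addbN -addNb.
by rewrite side_band addNb addbb mul1r.
Qed.

Definition invariant_labellings : {set {ffun flag G -> 'F_2}} :=
  [set f : {ffun flag G -> 'F_2} |
    [forall x, forall y, boundary (rho, tau) x y ==> (f x == f y)]].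

Lemma invariant_labellingP (f : {ffun flag G -> 'F_2}) :
  reflect ((forall d, f (d, true) = f (rho d, false)) /\
           (forall d b, f (d, b) = f (rev_dart d, ~~ b (+) tau (edge_of d))))
          (f \in invariant_labellings).
Proof.
rewrite inE; apply: (iffP 'forall_'forall_implyP) => [H | [H1 H2] [d b] [d' b']].
  split=> [d | d b]; apply/eqP/H; first by rewrite /boundary /= /corner /= eqxx.
  by rewrite /boundary /= /band_side /= !eqxx !orbT.
rewrite /boundary /= => /or3P[/and3P[] | /and3P[] | /andP[]] /=.
- by case: b => //; case: b' => // _ _ /eqP ->; rewrite H1.
- by case: b' => //; case: b => // _ _ /eqP ->; rewrite H1.
- by move=> /eqP -> /eqP ->; rewrite -H2.
Qed.

Lemma card_invariant_labellings :
  #|invariant_labellings| = (2 ^ nfaces (rho, tau))%N.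
Proof.
apply: card_invariant_ffun; apply: sym_connect_sym => -[d b] [d' b'].
rewrite /boundary /=.
rewrite orbCA; congr [|| _, _ | _]; rewrite /band_side /=.
apply/andP/andP => -[/eqP -> /eqP ->]; rewrite rev_dartK edge_of_rev eqxx.
  by split=> //; case: b (tau _) => [] [].
by split=> //; case: b' (tau _) => [] [].
Qed.

Definition labelling_data : {set 'rV['F_2]_N * {ffun G -> 'F_2}} :=
  [set p : 'rV['F_2]_N * {ffun G -> 'F_2} | [forall e, cobound p.2 e == t e * face_diff p.1 e]].

Lemma face_labelling_inv p :
  p \in labelling_data -> face_labelling p \in invariant_labellings.
Proof.
rewrite inE => /forallP H; apply/invariant_labellingP; split=> [d | d b].
  by rewrite !ffunE /= rotation_tail.
apply/eqP; rewrite -subr_eq0 F2_oppr band_labelling (eqP (H _)).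
by rewrite F2_addrr.
Qed.

Lemma face_diff_cyc g j : face_diff g (cyc j) = g 0 j.
Proof.
rewrite /face_diff (bigD1 j) //= cyc_border eqxx mul1r big1 ?addr0 // => i ij.
by rewrite cyc_border (negPf ij) mul0r.
Qed.

Lemma face_labelling_diff p d :
  face_labelling p (d, true) + face_labelling p (d, false) = face_diff p.1 (edge_of d).
Proof.
by rewrite !ffunE /= addrACA F2_addrr addr0 (face_diff_side _ _ true).
Qed.

Lemma dart_at (x : G) : exists d, tail d = x.
Proof.
have : (0 < #|[set d : dart G | tail d == x]|)%N by rewrite cubic.
by case/card_gt0P => d; rewrite inE => /eqP; exists d.
Qed.

Lemma face_labelling_inj : injective face_labelling.
Proof.
move=> [g c] [g' c'] E.
have Eg : g = g'.
  apply/rowP => j; have [d dj] := edge_ofP (cyc j).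
  by rewrite -!face_diff_cyc -dj -(face_labelling_diff (g, c)) E face_labelling_diff.
congr (_, _) => //; apply/ffunP => x; have [d <-] := dart_at x.
move/ffunP: E => /(_ (d, true)); rewrite !ffunE /= Eg; exact: addrI.
Qed.

(** The jump [a] of [f] across the edges is a cycle modulo 2, so it should bound a set [g] of inner
    faces. Reading [g] off the edges [cyc j] makes the difference a cycle inside the tree, hence
    zero. What remains of [f] after subtracting [g] is constant around each vertex and defines
    [c]. *)
Lemma face_labelling_surj (f : {ffun flag G -> 'F_2}) :
  f \in invariant_labellings -> exists2 p, p \in labelling_data & f = face_labelling p.
Proof.
move=> /invariant_labellingP[f_rot f_rev].
have [rep repE] := fin_all_exists (@edge_ofP G).
pose a e := f (rep e, true) + f (rep e, false).
have aE d : a (edge_of d) = f (d, true) + f (d, false).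
  rewrite /a; case: (edge_of_eq (esym (repE (edge_of d)))) => [->|->] //.
  by rewrite (f_rev d true) (f_rev d false); case: (tau _) => /=; rewrite // addrC.
pose g : 'rV['F_2]_N := \row_j a (cyc j).
have ag e : a e = face_diff g e.
  apply/eqP; rewrite -subr_eq0 F2_oppr; apply/eqP.
  apply: (cycle_in_tree T0_tree (a := fun e => a e + face_diff g e)) => [x | e' e'T].
    under eq_bigr => d _ do rewrite aE face_diffE f_rot.
    have S h := sum_rotation rot h (fun y => y == x).
    rewrite !big_split /= (S _ (fun d => f (d, false))) F2_addrr.
    by rewrite (S _ (fun d => face_val g (kappa (rho d)))) F2_addrr addr0.
  by have [j ->] := T0_cyc e'T; rewrite face_diff_cyc mxE F2_addrr.
pose h d := f (d, true) + face_val g (side rho d true).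
have hE d : h d = f (d, false) + face_val g (side rho d false).
  rewrite /h; apply/eqP; rewrite -subr_eq0 F2_oppr addrACA -aE ag (face_diff_side g d true).
  by rewrite F2_addrr.
have h_rot d : h (rho d) = h d by rewrite hE -f_rot.
have [at_ atE] := fin_all_exists dart_at.
pose c := [ffun x => h (at_ x)].
have cE d : c (tail d) = h d.
  rewrite ffunE; have /(rotation_mem cubic rot) : tail (at_ (tail d)) = tail d by [].
  by rewrite !inE => /or3P[]/eqP ->; rewrite ?h_rot.
have fE : f = face_labelling (g, c).
  apply/ffunP => -[d b]; rewrite ffunE /= cE.
  by case: b; [rewrite /h | rewrite hE]; rewrite addrCA F2_addrr addr0.
exists (g, c) => //; rewrite inE; apply/forallP => e; have [d <-] := edge_ofP e.
rewrite -subr_eq0 F2_oppr -(band_labelling (g, c) d true) -fE -f_rev.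
by rewrite F2_addrr.
Qed.

(** The equations on the tree have two solutions [c]. Summing all equations around face [j]
    eliminates [c] and leaves entry [j] of [g *m border_form t]; given the tree equations, this sum
    is the equation of [cyc j]. *)
Lemma labelling_data_kernel (g : 'rV['F_2]_N) (x0 : G) :
  #|[set c | (g, c) \in labelling_data]| = if g *m border_form t == 0 then 2%N else 0%N.
Proof.
have gA j : (g *m border_form t) 0 j = \sum_e border_coef e j * (t e * face_diff g e).
  rewrite mxE; under eq_bigr => i _ do rewrite mxE big_distrr.
  rewrite exchange_big; apply: eq_bigr => e _ /=; rewrite !big_distrr /=.
  apply: eq_bigr => i _; rewrite mulrC [RHS]mulrC -!mulrA.
  by congr (_ * (_ * _)); rewrite mulrC.
have [/rowP gA0 | gA0] := eqVneq.
  rewrite -[RHS](card_potentials x0 (fun e => t e * face_diff g e) T0_tree).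
  apply: eq_card => c; rewrite !inE /=; apply/forallP/forallP => H e.
    by apply/implyP => _; apply: H.
  have [eT|/T0_cyc[j ->]] := boolP (e \in T0); first exact: (implyP (H e)).
  have : \sum_e border_coef e j * (cobound c e + t e * face_diff g e) = 0.
    under eq_bigr => e' _ do rewrite mulrDr.
    by rewrite big_split /= sum_face_cobound add0r -gA gA0 mxE.
  rewrite (bigD1 (cyc j)) //= cyc_border eqxx mul1r big1 ?addr0 => [/eqP|e' ne'].
    by rewrite addr_eq0 F2_oppr.
  have [e'T|/T0_cyc[i Ei]] := boolP (e' \in T0).
    by rewrite (eqP (implyP (H e') e'T)) F2_addrr mulr0.
  rewrite Ei cyc_border eq_sym; case: eqP => [ji|_]; last by rewrite mul0r.
  by rewrite Ei ji eqxx in ne'.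
apply: eq_card0 => c; rewrite !inE /=; apply: contraNF gA0 => /forallP H.
apply/eqP/rowP => j; rewrite gA mxE -[RHS](sum_face_cobound c j).
by apply: eq_bigr => e _; rewrite (eqP (H e)).
Qed.

Lemma nfacesE (x0 : G) : nfaces (rho, tau) = (N - \rank (border_form t)).+1.
Proof.
apply: (@expnI 2); rewrite // -card_invariant_labellings expnS mulnC.
have -> : invariant_labellings = face_labelling @: labelling_data.
  apply/setP => f; apply/idP/imsetP => [/face_labelling_surj//|[p Wp ->]].
  exact: face_labelling_inv.
rewrite card_imset; last exact: face_labelling_inj.
rewrite -card_kermx_F2 -sum_nat_const.
have -> : #|labelling_data| = (\sum_g #|[set c | (g, c) \in labelling_data]|)%N.
  rewrite -sum1_card; under [RHS]eq_bigr => g _ do rewrite -sum1dep_card.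
  by rewrite pair_big_dep; apply: eq_bigl => -[].
rewrite [RHS]big_mkcond; apply: eq_bigr => g _ /=.
by rewrite (labelling_data_kernel g x0) inE.
Qed.

(** An edge of face [j] is mismatched precisely when the face is on the [true] side of both or of
    neither of its darts. Each corner of the face is on the [true] side of exactly one dart, and a
    face has as many edges as corners, so the parities cancel. *)
Lemma sum_border_mismatch j :
  \sum_e border_coef e j * (mismatch rho e)%:R = 0 :> 'F_2.
Proof.
pose s d : 'F_2 := (kappa (rho (rho d)) == Some j)%:R.
have step e : border_coef e j * (mismatch rho e)%:R =
    border_coef e j + \sum_(d | edge_of d == e) s d.
  have [d <-] := edge_ofP e; rewrite sum_edge_darts /s.
  have := kappa_rot_neq (rev_dart d); rewrite border_coefE mismatchE eq_sym.
  case: (border_pairs d) => -[-> ->] n; first by rewrite n mulr1 F2_addrr addr0.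
  by rewrite eqxx mulr0 addrACA [X in _ + X]addrC F2_addrr.
under eq_bigr => e _ do rewrite step.
rewrite big_split /= -sum_darts /s.
have sumE : (\sum_e borders e (Some j) = \sum_d (kappa d == Some j))%N.
  apply: double_inj; rewrite -!addnn.
  rewrite -[in RHS](sum_rotation rot (fun d => (kappa d == Some j) : nat) predT).
  rewrite -[X in (_ = _ + X)%N](sum_rotation rot (fun d => (kappa (rho d) == Some j) : nat) predT).
  rewrite -!big_split /= sum_darts; apply: eq_bigr => e _.
  have [d <-] := edge_ofP e; rewrite -edge_of_rev {2}edge_of_rev.
  by rewrite sum_edge_darts /= -!border_nat edge_of_rev.
rewrite (sum_rotation rot (fun d => (kappa (rho d) == Some j)%:R) predT).
rewrite (sum_rotation rot (fun d => (kappa d == Some j)%:R) predT).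
by rewrite -!natr_sum sumE F2_addrr.
Qed.

(** For a switching of the untwisted system, each diagonal entry sums a coboundary and [mismatch]
    around a face. Both sums vanish, so the form is alternating and halving the deficit loses
    nothing. *)
Lemma orientable_even : orientable (rho, tau) -> ~~ odd (\rank (border_form t)).
Proof.
case/existsP => sw /forallP H; apply: alternating_rank_even.
  apply/matrixP => i j; rewrite !mxE; apply: eq_bigr => e _.
  by rewrite -!mulrA; congr (_ * _); rewrite mulrC.
move=> j; rewrite mxE.
transitivity (\sum_e border_coef e j * cobound (fun x => (sw x)%:R) e +
  \sum_e border_coef e j * (mismatch rho e)%:R); last first.
  by rewrite sum_face_cobound sum_border_mismatch addr0.
rewrite -big_split /=; apply: eq_bigr => e _.
have [d <-] := edge_ofP e; have /eqP /= Hd := H d.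
rewrite cobound_edge -mulrDr /t Hd -mulrA mulrC; congr (_ * _).
  by rewrite /border_coef; case: borders; rewrite ?mulr1 ?mulr0.
by rewrite !F2_addb.
Qed.

Lemma embedding_genus (x0 : G) :
  euler_genus (embedding_surface (rho, tau)) = \rank (border_form t).
Proof.
have def : euler_deficit (rho, tau) = \rank (border_form t).
  rewrite /euler_deficit (nfacesE x0); have := rank_leq_row (border_form t).
  by have := euler_eq; lia.
rewrite /embedding_surface; case: ifP => [/orientable_even ev|_] /=; rewrite def //.
by rewrite -[RHS]odd_double_half (negPf ev).
Qed.

End OneRotation.

(* [rho (rho d)] is [rho^-1 d], since the vertices are cubic. *)
Definition flip_fun (rho : {perm dart G}) (c : {ffun G -> 'F_2}) d : dart G :=
  if c (tail d) == 0 then rho d else rho (rho d).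

Lemma flip_fun_inj rho c : is_rotation rho -> injective (flip_fun rho c).
Proof.
move=> rot; pose f d := if c (tail d) == 0 then rho (rho d) else rho d.
apply: (can_inj (g := f)) => d; rewrite /f /flip_fun.
by have [cd|/negPf cd] := boolP (c (tail d) == 0); rewrite !rotation_tail // cd (rotation3 cubic rot).
Qed.

Lemma flip_rotation rho c (rot : is_rotation rho) :
  is_rotation (perm (@flip_fun_inj rho c rot)).
Proof.
set rho' := perm _; apply/forallP => d; apply/eqP/setP => d'; rewrite inE.
have tl x : tail (rho' x) = tail x.
  by rewrite permE /flip_fun; case: ifP => _; rewrite !rotation_tail.
have tlX n x : tail ((rho' ^+ n)%g x) = tail x.
  by elim: n => [|n IH]; rewrite ?expg0 ?perm1 // expgSr permM tl.
apply/porbitP/eqP => [[n ->]|/(rotation_mem cubic rot)]; first by rewrite tlX.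
have E x : tail x = tail d -> rho' x = if c (tail d) == 0 then rho x else rho (rho x).
  by rewrite permE /flip_fun => ->.
rewrite !inE => /or3P[]/eqP ->; first by exists 0%N; rewrite expg0 perm1.
  have [cd|cd] := boolP (c (tail d) == 0).
    by exists 1%N; rewrite expg1 E // cd.
  by exists 2%N; rewrite expgS expg1 permM (E (rho' d)) ?tl // E // (negPf cd) (rotation3 cubic rot).
have [cd|cd] := boolP (c (tail d) == 0).
  by exists 2%N; rewrite expgS expg1 permM (E (rho' d)) ?tl // E // cd.
by exists 1%N; rewrite expg1 E // (negPf cd).
Qed.

(** Three darts have two cyclic orders, inverse to each other; disagreement at one dart forces it at
    the whole vertex. *)
Lemma rotation_flip rho rho' (rot : is_rotation rho) : is_rotation rho' ->
  exists c, rho' = perm (@flip_fun_inj rho c rot).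
Proof.
move=> rot'; exists [ffun x => if [exists d, (tail d == x) && (rho' d != rho d)] then 1 else 0].
apply/permP => d; rewrite permE /flip_fun ffunE.
case: existsP => [[d' /andP[/eqP td' ne]]|H] /=; last first.
  by apply/eqP; apply: contraT => ne; case: H; exists d; rewrite eqxx.
have e1 : rho' d' = rho (rho d').
  have := rotation_mem cubic rot (rotation_tail d' rot'); rewrite !inE (negPf ne).
  have := rotation_uniq cubic rot' d'; rewrite /= !inE !negb_or => /andP[/andP[+ _] _].
  by rewrite eq_sym => /negPf -> /= /eqP.
have e2 : rho' (rho (rho d')) = rho d'.
  have := rotation_mem cubic rot (etrans (rotation_tail (rho' d') rot') (rotation_tail d' rot')).
  have := rotation_uniq cubic rot' d'; rewrite -e1 /= !inE !negb_or.
  move=> /andP[/andP[_ n1] /andP[n2 _]].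
  rewrite [_ == d']eq_sym [_ == rho' d']eq_sym (negPf n1) (negPf n2) /= orbF.
  by move=> /eqP.
have e3 : rho' (rho d') = d' by rewrite -e2 -e1 (rotation3 cubic rot').
have /(rotation_mem cubic rot) : tail d = tail d' by [].
by rewrite !inE => /or3P[]/eqP ->; rewrite ?e1 ?e2 ?e3 ?(rotation3 cubic rot).
Qed.

(** Reversing the rotation at a vertex exchanges the two sides of its bands there and so toggles the
    mismatch of its three edges. *)
Lemma mismatch_flip rho c (rot : is_rotation rho) e :
  (mismatch (perm (@flip_fun_inj rho c rot)) e)%:R = (mismatch rho e)%:R + cobound c e.
Proof.
have [d <-] := edge_ofP e; have rot' := flip_rotation c rot.
rewrite (mismatchE rot') (mismatchE rot) cobound_edge.
have n := kappa_rot_neq rot (rev_dart d); have n' := n; rewrite eq_sym in n'.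
have F2_case (x : 'F_2) : x = if x == 0 then 0 else 1.
  by case: (eqVneq x 0) => // ; rewrite F2_neq0 => /eqP.
have F2_11 : 1 + (1 + 1) = 1 :> 'F_2 by rewrite F2_addrr addr0.
rewrite !permE /flip_fun -[tail (rev_dart d)]/(head d) [in RHS](F2_case (c (tail d))) [in
  RHS](F2_case (c (head d))).
have [ct|/negPf ct] := boolP (c (tail d) == 0); rewrite !rotation_tail // ct ?(rotation3 cubic rot);
have [ch|/negPf ch] := boolP (c (head d) == 0);
by case: (border_pairs rot d) => -[E1 E2];
  rewrite ?E1 ?E2 ?eqxx ?n ?n' ?F2_addrr ?addr0 ?add0r ?F2_11 ?F2_addrr.
Qed.

(** Given the total twist [s], the flip [c] determines both the rotation and [tau]. That [tau]
    vanishes on [T] prescribes the coboundary of [c] there, which leaves two potentials whatever the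
    tree. *)
Lemma card_T_rotations_mismatch (T : {set edge G}) (x0 : G) (s : {ffun edge G -> bool}) :
  tree_like T ->
  #|[set R in T_rotations T | [ffun e => R.2 e (+) mismatch R.1 e] == s]| = 2%N.
Proof.
move=> tT; have [rho rot] := rotation_exists G.
rewrite -[RHS](card_potentials x0 (fun e => (s e (+) mismatch rho e)%:R) tT).
pose f (c : {ffun G -> 'F_2}) : gen_rotation G :=
  let rho' := perm (@flip_fun_inj rho c rot) in (rho', [ffun e => s e (+) mismatch rho' e]).
have f_inj : injective f.
  move=> c c' [/permP E _]; apply/ffunP => x; have [d <-] := dart_at x.
  have := E d; rewrite !permE /flip_fun.
  have := kappa_rot_neq rot d.
  have [/eqP c0|n0] := boolP (c (tail d) == 0);
  have [/eqP c0'|n0'] := boolP (c' (tail d) == 0) => n e.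
  - by rewrite c0 c0'.
  - by rewrite -e eqxx in n.
  - by rewrite e eqxx in n.
  by move: n0 n0'; rewrite !F2_neq0 => /eqP -> /eqP ->.
rewrite -(card_imset _ f_inj); apply: eq_card => -[rho' tau]; rewrite !inE /=.
apply/andP/imsetP => [[/andP[rot' /forall_inP tau0] /eqP/ffunP Es] | [c]].
  have [c Ec] := rotation_flip rot rot'; exists c.
    rewrite inE; apply/forall_inP => e eT; have := mismatch_flip c rot e; rewrite -Ec.
    have := Es e; rewrite ffunE (negPf (tau0 e eT)) /= => -> E.
    by rewrite F2_addb E addrC addrA F2_addrr add0r.
  rewrite /f -Ec; congr (_, _); apply/ffunP => e.
  by rewrite ffunE -(Es e) ffunE addbK.
rewrite inE => /forall_inP Hc [-> ->]; split.
  apply/andP; split; first exact: flip_rotation.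
  apply/forall_inP => e eT; rewrite ffunE; have /eqP := Hc e eT.
  have := mismatch_flip c rot e => + E; rewrite E F2_addb addrCA F2_addrr addr0.
  by case: mismatch (s e) => [] [].
by apply/eqP/ffunP => e; rewrite !ffunE addbK.
Qed.

Lemma euler_genus_polyE (T : {set edge G}) (x0 : G) : tree_like T ->
  euler_genus_poly T =
  2 *: \sum_(s : {ffun edge G -> bool}) 'X^(\rank (border_form (fun e => (s e)%:R))).
Proof.
move=> tT; rewrite /euler_genus_poly.
pose F (s : {ffun edge G -> bool}) : {poly int} := 'X^(\rank (border_form (fun e => (s e)%:R))).
pose h (R : gen_rotation G) : {ffun edge G -> bool} := [ffun e => R.2 e (+) mismatch R.1 e].
rewrite (eq_bigr (fun R => F (h R))) => [|[rho tau]]; last first.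
  rewrite inE => /andP[rot _]; rewrite (embedding_genus rot tau x0) /F.
  by congr ('X^(mxrank _)); apply/matrixP => i j; rewrite !mxE; apply: eq_bigr => e _; rewrite ffunE.
rewrite (partition_big h predT) //= scaler_sumr; apply: eq_bigr => s _.
rewrite (eq_bigr (fun=> F s)) => [|R /andP[_ /eqP ->] //].
rewrite sumr_const scaler_nat; congr (_ *+ _).
by rewrite -(card_T_rotations_mismatch x0 s tT); apply: eq_card => R; rewrite [RHS]inE.
Qed.

(** * From twists to arbitrary matrices on the dual graph *)

Definition dual_adj : rel 'I_N :=
  fun i j => [exists e, borders e (Some i) && borders e (Some j)].

Hypothesis T0_inner : forall e, e \in T0 -> ~~ borders e None.
Hypothesis dual_simple : forall e e' i j, i != j ->
  borders e (Some i) -> borders e (Some j) ->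
  borders e' (Some i) -> borders e' (Some j) -> e = e'.

Lemma border_form_offdiag (t : edge G -> 'F_2) e i j : i != j ->
  borders e (Some i) -> borders e (Some j) -> border_form t i j = t e.
Proof.
move=> ij ei ej; rewrite mxE (bigD1 e) //= /border_coef ei ej !mulr1.
rewrite big1 ?addr0 // => e' ne.
have [e'i|_] := boolP (borders e' (Some i)); last by rewrite mulr0 mul0r.
have [e'j|_] := boolP (borders e' (Some j)); last by rewrite mulr0.
by rewrite (dual_simple ij ei ej e'i e'j) eqxx in ne.
Qed.

Lemma borders_two e i j k : i != j -> borders e (Some i) -> borders e (Some j) ->
  borders e (Some k) -> k = i \/ k = j.
Proof.
have [rho rot] := rotation_exists G; have [d <-] := edge_ofP e.
rewrite !(bordersE rot) => ij.
move=> /orP[]/eqP Ei /orP[]/eqP Ej /orP[]/eqP Ek; move: Ek; rewrite ?Ei ?Ej => -[]; auto.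
- by move: Ej; rewrite Ei => -[ij']; rewrite ij' eqxx in ij.
- by move: Ej; rewrite Ei => -[ij']; rewrite ij' eqxx in ij.
Qed.

(** The twists correspond bijectively to the matrices of the pattern. A tree edge separates two
    inner faces and is the only edge between them, so its twist is an off-diagonal entry; afterwards
    the twist of [cyc j] sets entry [(j, j)]. *)
Lemma sum_border_form :
  \sum_(s : {ffun edge G -> bool}) 'X^(\rank (border_form (fun e => (s e)%:R))) =
  rank_poly dual_adj.
Proof.
pose f (s : {ffun edge G -> bool}) := border_form (fun e => (s e)%:R).
have cyc_bord j i : borders (cyc j) (Some i) = (i == j).
  have := cyc_border j i; rewrite /border_coef.
  by case: (borders _ _); case: (i == j) => // /eqP.
have [rho rot] := rotation_exists G.
have f_inj : injective f.
  move=> s s' E.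
  have ET e : e \in T0 -> s e = s' e.
    move=> eT; have := T0_inner eT; have [d de] := edge_ofP e; subst e.
    have := kappa_rot_neq rot d; have := bordersE rot d.
    case: (kappa (rho d)) (kappa (rho (rho d))) => [i|] [j|] H n.
    - move=> _; have ij : i != j by apply: contra_neq n => ->.
      have bi : borders (edge_of d) (Some i) by rewrite H eqxx.
      have bj : borders (edge_of d) (Some j) by rewrite H eqxx orbT.
      have := border_form_offdiag (fun e => (s e)%:R) ij bi bj.
      rewrite -/(f s) E /f (border_form_offdiag _ ij bi bj).
      by case: (s _) (s' _) => [] [] // /eqP.
    - by rewrite H eqxx orbT.
    - by rewrite H eqxx.
    - by rewrite H eqxx.
  apply/ffunP => e; have [|/T0_cyc[j ->]] := boolP (e \in T0); first exact: ET.
  move/matrixP: E => /(_ j j); rewrite !mxE.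
  rewrite (bigD1 (cyc j)) //= [in RHS](bigD1 (cyc j)) //= /border_coef cyc_bord eqxx !mulr1.
  set x := \sum_(i | _) _; set y := \sum_(i | _) _.
  have <- : x = y.
    apply: eq_bigr => e' ne; have [/ET -> //|/T0_cyc[i Ei]] := boolP (e' \in T0).
    rewrite Ei cyc_bord; case: (eqVneq j i) => [ji|_]; last by rewrite !mulr0.
    by rewrite Ei ji eqxx in ne.
  by move=> /addIr; case: (s _) (s' _) => [] [] // /eqP.
rewrite /rank_poly -(big_imset (fun A => 'X^(\rank A)) (in2W f_inj)) /=.
apply: eq_bigl => A; apply/imsetP/idP => [[s _ ->] | /sym_patternP[AT A0]].
  apply/sym_patternP; split=> i j; rewrite !mxE; first by apply: eq_bigr => e _; rewrite mulrAC.
  move=> /existsPn H; apply: big1 => e _; have := H e; rewrite /border_coef.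
  by case: (borders e _); case: (borders e _) => //; rewrite ?mulr0 ?mul0r.
(* [t1] reads the tree twists off the entries above the diagonal, so that each pair of faces counts
   once, and vanishes on the edges [cyc j]; [t2] uses those edges to correct the diagonal. *)
pose t1 e : 'F_2 := \sum_(i < N) \sum_(j < N | (i < j)%N) border_coef e i * border_coef e j * A i j.
pose t2 e : 'F_2 := \sum_j (e == cyc j)%:R * (A j j + border_form t1 j j).
exists [ffun e => t1 e + t2 e != 0] => //.
apply/matrixP => i j; rewrite !mxE.
have F2_bool (x : 'F_2) : (x != 0)%:R = x.
  by case: (eqVneq x 0) => [->//|]; rewrite F2_neq0 => /eqP ->.
under eq_bigr => e _ do rewrite ffunE F2_bool 2!mulrDl.
rewrite big_split /=.
have -> : \sum_e t1 e * border_coef e i * border_coef e j = border_form t1 i j by rewrite mxE.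
have -> : \sum_e t2 e * border_coef e i * border_coef e j =
    (i == j)%:R * (A i i + border_form t1 i i).
  under eq_bigr => e _ do rewrite 2!big_distrl /=.
  rewrite exchange_big (bigD1 i) //= [X in _ + X]big1 ?addr0 => [|k ki].
    rewrite (bigD1 (cyc i)) //= eqxx /border_coef !cyc_bord eqxx eq_sym [_ * _ * 1]mulr1.
    rewrite mul1r mulrC big1 ?addr0 // => e ne.
    by rewrite (negPf ne) !mul0r.
  apply: big1 => e _; case: eqP => [->|_]; last by rewrite !mul0r.
  by rewrite /border_coef cyc_bord eq_sym (negPf ki) mulr0 mul0r.
have [<-|ij] := eqVneq i j; first by rewrite mul1r addrCA F2_addrr addr0.
rewrite mul0r addr0.
have off (k l : 'I_N) : (k < l)%N -> border_form t1 k l = A k l.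
  move=> kl; have kl' : k != l by apply: contraTneq kl => ->; rewrite ltnn.
  have [/existsP[e /andP[ek el]]|nkl] := boolP (dual_adj k l); last first.
    rewrite A0 // mxE big1 // => e _; move/existsPn: nkl => /(_ e).
    rewrite /border_coef.
    by case: (borders e _); case: (borders e _) => //; rewrite ?mulr0 ?mul0r.
  rewrite (border_form_offdiag _ kl' ek el) /t1 (bigD1 k) //= (bigD1 l) //=.
  rewrite /border_coef ek el !mul1r big1 ?addr0 => [|l' /andP[kl'' ne]]; last first.
    have [el'|_] := boolP (borders e (Some l')); last by rewrite mulr0 mul0r.
    case: (borders_two kl' ek el el') kl'' ne => ->; rewrite ?ltnn ?eqxx //.
  rewrite big1 ?addr0 // => k' nk'; apply: big1 => l' kl''.
  have [ek'|_] := boolP (borders e (Some k')); last by rewrite !mul0r.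
  have [el'|_] := boolP (borders e (Some l')); last by rewrite mulr0 mul0r.
  case: (borders_two kl' ek el ek') nk' kl'' => ->; rewrite ?eqxx // => _.
  by case: (borders_two kl' ek el el') => ->; rewrite ?ltnn // ltnNge ltnW.
have form_sym k l : border_form t1 k l = border_form t1 l k.
  by rewrite !mxE; apply: eq_bigr => e _; rewrite mulrAC.
case: (ltngtP i j) => [/off //|ji|/val_inj E]; last by rewrite E eqxx in ij.
by rewrite form_sym AT off.
Qed.

End FaceData.

(** * The faces along the spine *)

Local Close Scope ring_scope.

Lemma iota_rcons n : iota 0 n.+1 = rcons (iota 0 n) n.
Proof. by rewrite -addn1 iotaD add0n cats1. Qed.

Section FanState.
Variable S : seq bool.

(* The inner faces are numbered from 0 in the order in which they appear from
   left to right: spine edge [v_n v_(n+1)] lies between the faces [upper n] and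
   [lower n], and the leaf attached to [v_(n+1)], on the side [nth false S n],
   closes one of them and opens the face [n.+2]. *)
Fixpoint upper (n : nat) : nat :=
  if n is n'.+1 then if nth false S n' then n.+1 else upper n' else 1.

Fixpoint lower (n : nat) : nat :=
  if n is n'.+1 then if nth false S n' then lower n' else n.+1 else 0.

Definition kept (n : nat) : nat := if nth false S n then lower n else upper n.
Definition closed (n : nat) : nat := if nth false S n then upper n else lower n.

(** A face [b >= 2] opens at [v_(b-1)] and meets the two faces present there: the kept one along the
    next spine edge, the closed one along the stem of the leaf. For [b = 1] the subtraction
    truncates to 0, and [a < b] selects face 0. *)
Definition parent (a b : nat) : bool :=
  (a < b) && ((a == upper (b - 2)) || (a == lower (b - 2))).

Definition fan_adj : rel nat :=
  [rel a b | [|| a == b, parent a b | parent b a]].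

Lemma upper_leq n : upper n <= n.+1.
Proof. by elim: n => //= n IH; case: ifP => // _; exact: leqW. Qed.

Lemma lower_leq n : lower n <= n.+1.
Proof. by elim: n => //= n IH; case: ifP => // _; exact: leqW. Qed.

Lemma upper_neq_lower n : upper n != lower n.
Proof.
elim: n => //= n IH; have := upper_leq n; have := lower_leq n.
by case: ifP => _ l u; lia.
Qed.

Lemma kept_leq n : kept n <= n.+1.
Proof. by rewrite /kept; case: ifP => _; rewrite ?upper_leq ?lower_leq. Qed.

Lemma closed_leq n : closed n <= n.+1.
Proof. by rewrite /closed; case: ifP => _; rewrite ?upper_leq ?lower_leq. Qed.

Lemma kept_neq_closed n : kept n != closed n.
Proof. by rewrite /kept /closed; case: ifP; rewrite ?upper_neq_lower // eq_sym upper_neq_lower. Qed.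

Lemma kept_closed n f :
  (f == upper n) || (f == lower n) = (f == kept n) || (f == closed n).
Proof. by rewrite /kept /closed; case: ifP => _ //; rewrite orbC. Qed.

Lemma upper_lowerS n f :
  (f == upper n.+1) || (f == lower n.+1) = (f == n.+2) || (f == kept n).
Proof. by rewrite /kept /=; case: ifP => _ //; rewrite orbC. Qed.

Lemma newest_face n : (upper n == n.+1) || (lower n == n.+1).
Proof. by case: n => //= n; case: ifP; rewrite eqxx ?orbT. Qed.

Lemma fan_adjC : symmetric fan_adj.
Proof. by move=> a b; rewrite /fan_adj /= eq_sym; congr (_ || _); rewrite orbC. Qed.

Lemma upper_lower_adj n : fan_adj (upper n) (lower n).
Proof.
case: n => [|n]; first by rewrite /fan_adj /= /parent.
have P x : (x == upper n) || (x == lower n) -> x <= n.+1 -> parent x n.+2.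
  by move=> H xn; rewrite /parent ltnS xn subSS subSS subn0.
rewrite /fan_adj /=; have := upper_leq n; have := lower_leq n.
case: ifP => _ l u; [rewrite [parent (lower n) _]P ?orbT // | rewrite [parent (upper n) _]P ?orbT //].
  by rewrite eqxx orbT.
by rewrite eqxx.
Qed.

Lemma closed_adj n : fan_adj (closed n) n.+2.
Proof.
rewrite /fan_adj /= /parent ltnS closed_leq subSS subSS subn0 kept_closed eqxx.
by rewrite !orbT.
Qed.

(** The pairs are the incoming and outgoing labels of the upper leaves. Together with [path_lower],
    which runs backwards, this says that consecutive vertices of the outer cycle agree on the face
    between them. *)
Lemma path_upper n a :
  let s := [seq (upper j, j.+2) | j <- iota 0 n & nth false S j] in
  path (fun p q : nat * nat => p.2 == q.1) (a, 1) s /\ (last (a, 1) s).2 = upper n.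
Proof.
elim: n => [|n [IHp IHl]] s //; rewrite /s iota_rcons filter_rcons /=.
by case: ifP => _ //; rewrite map_rcons rcons_path last_rcons IHp IHl /=.
Qed.

Lemma path_lower n a :
  let s := rev [seq (j.+2, lower j) | j <- iota 0 n & ~~ nth false S j] in
  path (fun p q : nat * nat => p.2 == q.1) (a, lower n) s /\
  (last (a, lower n) s).2 = 0.
Proof.
elim: n a => [|n IH] a s //; rewrite /s iota_rcons filter_rcons /=.
case: ifP => _ /=; first exact: IH.
by rewrite map_rcons rev_rcons /= eqxx; exact: IH.
Qed.

End FanState.

Lemma eq_upper_lower S S' n :
  {in gtn n, forall i, nth false S i = nth false S' i} ->
  upper S n = upper S' n /\ lower S n = lower S' n.
Proof.
elim: n => //= n IH H; have Hn : nth false S n = nth false S' n by apply: H; rewrite inE.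
rewrite Hn; have [|-> ->] := IH; first by move=> i; rewrite !inE => /ltnW; apply: H.
by [].
Qed.

(** * The caterpillar-Halin graphs *)

Lemma next_neq_prev (T : eqType) (p : seq T) x :
  uniq p -> 2 < size p -> x \in p -> next p x != prev p x.
Proof.
move=> Up Sp xp; apply/eqP => E.
have : next p (next p x) = x by rewrite E next_prev.
case: (rot_to xp) => i q Eq; rewrite -!(next_rot i Up) Eq.
have : uniq (x :: q) by rewrite -Eq rot_uniq.
have : 2 < size (x :: q) by rewrite -Eq size_rot.
case: q {Eq} => [|y [|z q]] //= _; rewrite !inE !negb_or => /and3P[/and3P[xy xz _] _ _].
rewrite eqxx [y == x]eq_sym (negPf xy) eqxx => zx; by rewrite zx eqxx in xz.
Qed.

Section HalinFaces.
Variable m : seq nat.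
Let ell := spine m.
Let S := sides m.
Hypothesis ell_gt0 : 0 < ell.
Implicit Types (x y : halin_vertex m).

Definition spine_vertex (k : nat) : halin_vertex m := inl (inord k).
Definition leaf_vertex (k : nat) : halin_vertex m :=
  if insub k : option 'I_(spine m) is Some j then inr j else inl ord0.

Definition on_cycle x : bool :=
  if x is inl i then (i == 0 :> nat) || (i == (spine m).+1 :> nat) else true.

Definition stem x : halin_vertex m :=
  match x with
  | inl i => if i == 0 :> nat then spine_vertex 1 else spine_vertex (spine m)
  | inr j => spine_vertex j.+1
  end.

(* The cycle edges entering and leaving a vertex of the outer cycle are named
   after the inner face that they border. *)
Definition label_in x : nat :=
  match x with
  | inl i => if i == 0 :> nat then 0 else upper (sides m) (spine m)
  | inr j => if above j then upper (sides m) j else j.+2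
  end.

Definition label_out x : nat :=
  match x with
  | inl i => if i == 0 :> nat then 1 else lower (sides m) (spine m)
  | inr j => if above j then j.+2 else lower (sides m) j
  end.

Definition nbrs x : seq (halin_vertex m) :=
  if on_cycle x then [:: stem x; next (outer_cycle m) x; prev (outer_cycle m) x]
  else if x is inl i then
    [:: spine_vertex i.-1; leaf_vertex i.-1; spine_vertex i.+1]
  else [::].

(* The faces at a vertex, each opposite to the neighbour with the same index;
   the outer face is numbered [(spine m).+2]. *)
Definition labels x : seq nat :=
  if on_cycle x then [:: (spine m).+2; label_in x; label_out x]
  else if x is inl i then
    [:: i.+1; kept (sides m) i.-1; closed (sides m) i.-1]
  else [::].

Lemma mem_outer_cycle x : (x \in outer_cycle m) = on_cycle x.
Proof.
rewrite /outer_cycle inE mem_cat inE mem_rev; case: x => [i|j] /=.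
  have N s : (inl i : halin_vertex m) \in [seq inr j | j <- s] = false.
    by apply/negP => /mapP[].
  by rewrite !N orbF /= !(inj_eq (@inl_inj _ _)) -!val_eqE.
rewrite !(mem_map (@inr_inj _ _)) mem_filter [X in _ || X]mem_filter !mem_enum !andbT /=.
by case: (above j).
Qed.

Lemma uniq_outer_cycle : uniq (outer_cycle m).
Proof.
rewrite /outer_cycle /= mem_cat inE mem_rev cat_uniq /= rev_uniq mem_rev.
have N i s : (inl i : halin_vertex m) \in [seq inr j | j <- s] = false.
  by apply/negP => /mapP[].
have U a : uniq [seq j <- enum 'I_(spine m) | a j] by rewrite filter_uniq // enum_uniq.
rewrite !N /= !(map_inj_uniq (@inr_inj _ _)) !U /= andbT.
apply/hasPn => x; rewrite mem_rev => /mapP[j]; rewrite mem_filter => /andP[nj _] ->.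
by rewrite (mem_map (@inr_inj _ _)) mem_filter (negPf nj).
Qed.

Lemma size_outer_cycle : size (outer_cycle m) = ell.+2.
Proof.
rewrite /outer_cycle /= size_cat /= size_rev !size_map !size_filter.
by rewrite addnS count_predC size_enum_ord.
Qed.

Lemma cycle_labels x : x \in outer_cycle m ->
  label_out x = label_in (next (outer_cycle m) x).
Proof.
move=> xC; apply/eqP.
pose io y := (label_in y, label_out y).
suff : path.cycle (relpre io (fun p q => p.2 == q.1)) (outer_cycle m) by move/next_cycle; exact.
rewrite -cycle_map /outer_cycle /= map_cat /= map_rev -!map_comp.
have mapE (T : Type) (f : 'I_(spine m) -> T) (g : nat -> T) (a : pred nat) :
    (forall j : 'I_(spine m), a j -> f j = g j) ->
    [seq f j | j <- [seq j : 'I_(spine m) <- enum 'I_(spine m) | a j]] = [seq g j | j <- iota 0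
      (spine m) & a j].
  move=> fg; rewrite -val_enum_ord filter_map -map_comp.
  by apply/eq_in_map => j; rewrite mem_filter => /andP[aj _]; exact: fg.
rewrite (mapE _ _ (fun j => (upper S j, j.+2)) (nth false S)); last first.
  by move=> j aj; rewrite /= /io /= /above aj.
rewrite (mapE _ _ (fun j => (j.+2, lower S j)) (fun j => ~~ nth false S j)); last first.
  by move=> j /negPf aj; rewrite /= /io /= /above aj.
rewrite rcons_cat cat_path /=.
have [-> ->] := path_upper S (spine m) 0; rewrite /= eqxx /= rcons_path.
have [-> ->] := path_lower S (spine m) (upper S (spine m)).
by [].
Qed.

Lemma val_spine_vertex k : k < ell.+2 -> nat_of_ord (inord k : 'I_(spine m).+2) = k.
Proof. exact: inordK. Qed.

Lemma leaf_vertexE (j : 'I_(spine m)) : leaf_vertex j = inr j.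
Proof. by rewrite /leaf_vertex valK. Qed.

Lemma spine_vertexE (i : 'I_(spine m).+2) : spine_vertex i = inl i.
Proof. by rewrite /spine_vertex inord_val. Qed.

Lemma halin_vertexP x :
  (exists2 k, k < ell.+2 & x = spine_vertex k) \/
  (exists2 k, k < ell & x = leaf_vertex k).
Proof.
by case: x => [i|j]; [left; exists i | right; exists j]; rewrite ?spine_vertexE ?leaf_vertexE.
Qed.

Lemma spine_vertex_inj k k' : k < ell.+2 -> k' < ell.+2 ->
  (spine_vertex k == spine_vertex k') = (k == k').
Proof.
by move=> kl kl'; rewrite (inj_eq (@inl_inj _ _)) -val_eqE /= !val_spine_vertex.
Qed.

Lemma leaf_vertex_inj k k' : k < ell -> k' < ell ->
  (leaf_vertex k == leaf_vertex k') = (k == k').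
Proof.
move=> kl kl'; rewrite -[k]/(val (Ordinal kl)) -[k']/(val (Ordinal kl')).
by rewrite !leaf_vertexE (inj_eq (@inr_inj _ _)).
Qed.

Lemma spine_neq_leaf k k' : k' < ell -> (spine_vertex k == leaf_vertex k') = false.
Proof. by move=> kl; rewrite -[k']/(val (Ordinal kl)) leaf_vertexE. Qed.

Lemma on_cycle_spine k : k < ell.+2 -> on_cycle (spine_vertex k) = (k == 0) || (k == ell.+1).
Proof. by move=> kl; rewrite /on_cycle /spine_vertex val_spine_vertex. Qed.

Lemma on_cycle_leaf k : k < ell -> on_cycle (leaf_vertex k).
Proof. by move=> kl; rewrite -[k]/(val (Ordinal kl)) leaf_vertexE. Qed.

Lemma labels_cycle x : on_cycle x -> labels x = [:: ell.+2; label_in x; label_out x].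
Proof. by rewrite /labels => ->. Qed.

Lemma nbrs_cycle x : on_cycle x ->
  nbrs x = [:: stem x; next (outer_cycle m) x; prev (outer_cycle m) x].
Proof. by rewrite /nbrs => ->. Qed.

Lemma labels_interior k : k < ell ->
  labels (spine_vertex k.+1) = [:: k.+2; kept S k; closed S k].
Proof.
move=> kl; rewrite /labels on_cycle_spine; last by lia.
by rewrite eqSS /= ltn_eqF // val_spine_vertex //; lia.
Qed.

Lemma nbrs_interior k : k < ell ->
  nbrs (spine_vertex k.+1) = [:: spine_vertex k; leaf_vertex k; spine_vertex k.+2].
Proof.
move=> kl; rewrite /nbrs on_cycle_spine; last by lia.
by rewrite eqSS /= ltn_eqF // val_spine_vertex //; lia.
Qed.

Lemma stem_spine0 : stem (spine_vertex 0) = spine_vertex 1.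
Proof. by rewrite /= val_spine_vertex. Qed.

Lemma stem_spine_last : stem (spine_vertex ell.+1) = spine_vertex ell.
Proof. by rewrite /= val_spine_vertex. Qed.

Lemma stem_leaf k : k < ell -> stem (leaf_vertex k) = spine_vertex k.+1.
Proof. by move=> kl; rewrite -[k]/(val (Ordinal kl)) leaf_vertexE. Qed.

Lemma labels_spine0 : labels (spine_vertex 0) = [:: ell.+2; 0; 1].
Proof. by rewrite labels_cycle ?on_cycle_spine //= val_spine_vertex. Qed.

Lemma labels_spine k : k <= ell ->
  labels (spine_vertex k.+1) =i [:: k.+2; upper S k; lower S k].
Proof.
rewrite leq_eqVlt => /orP[/eqP ->|kl] f.
  by rewrite labels_cycle ?on_cycle_spine ?eqxx ?orbT //= val_spine_vertex.
by rewrite labels_interior // !inE -kept_closed.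
Qed.

Lemma labels_leaf k : k < ell ->
  labels (leaf_vertex k) =i [:: ell.+2; k.+2; closed S k].
Proof.
move=> kl f; rewrite labels_cycle ?on_cycle_leaf // -[k]/(val (Ordinal kl)) leaf_vertexE.
rewrite /label_in /label_out /above /closed /= !inE -/S.
by case: (nth false S k) => //; congr (_ || _); rewrite orbC.
Qed.

Lemma label_in_out x : on_cycle x -> label_in x < ell.+2 /\ label_out x < ell.+2 /\ label_in x
  != label_out x.
Proof.
case: (halin_vertexP x) => -[k kl ->].
  rewrite on_cycle_spine // => /orP[]/eqP ->; rewrite /= val_spine_vertex //=.
  by have := upper_leq S ell; have := lower_leq S ell; have := upper_neq_lower S ell; rewrite !ltnS.
rewrite -[k]/(val (Ordinal kl)) leaf_vertexE /= => _.
have := upper_leq S k; have := lower_leq S k; rewrite -/S.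
by case: ifP => _ h1 h2; rewrite ?[upper S _ == _]eq_sym; lia.
Qed.

Lemma next_neq x : on_cycle x -> next (outer_cycle m) x != x.
Proof.
move=> xC; have := label_in_out xC; rewrite cycle_labels ?mem_outer_cycle //.
by move=> [_ [_]]; apply: contra_neq => ->.
Qed.

Lemma prev_neq x : on_cycle x -> prev (outer_cycle m) x != x.
Proof.
move=> xC; have yC : on_cycle (prev (outer_cycle m) x).
  by rewrite -mem_outer_cycle mem_prev mem_outer_cycle.
by have := next_neq yC; rewrite next_prev ?uniq_outer_cycle // eq_sym.
Qed.

Lemma on_cycle_next x : on_cycle (next (outer_cycle m) x) = on_cycle x.
Proof. by rewrite -!mem_outer_cycle mem_next. Qed.

Lemma on_cycle_prev x : on_cycle (prev (outer_cycle m) x) = on_cycle x.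
Proof. by rewrite -!mem_outer_cycle mem_prev. Qed.

Lemma on_cycle_stem x : on_cycle x -> on_cycle (stem x) = false.
Proof.
case: (halin_vertexP x) => -[k kl ->]; last first.
  rewrite stem_leaf // on_cycle_spine; last by lia.
  by rewrite eqSS /= ltn_eqF.
rewrite on_cycle_spine // => /orP[]/eqP ->.
  by rewrite stem_spine0 on_cycle_spine //= eqSS /= ltn_eqF.
rewrite stem_spine_last on_cycle_spine //.
by rewrite [ell == 0]gtn_eqF //= ltn_eqF.
Qed.

Lemma uniq_nbrs x : uniq (nbrs x).
Proof.
have [xC|] := boolP (on_cycle x).
  have np := next_neq_prev uniq_outer_cycle _ (_ : x \in outer_cycle m).
  rewrite nbrs_cycle // !cons_uniq !inE negb_or np ?size_outer_cycle ?mem_outer_cycle // !andbT.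
  by apply/andP; split; apply/eqP => /(congr1 on_cycle);
     rewrite ?on_cycle_next ?on_cycle_prev xC on_cycle_stem.
case: (halin_vertexP x) => -[k kl ->]; last by rewrite on_cycle_leaf.
rewrite on_cycle_spine //; case: k kl => //= k kl kn.
have {kn} kl' : k < ell by lia.
rewrite nbrs_interior //= !inE !negb_or [leaf_vertex k == _]eq_sym !spine_neq_leaf // !andbT.
by rewrite spine_vertex_inj //; lia.
Qed.

Lemma size_nbrs x : size (nbrs x) = 3.
Proof.
have [xC|] := boolP (on_cycle x); first by rewrite nbrs_cycle.
case: (halin_vertexP x) => -[k kl ->]; last by rewrite on_cycle_leaf.
rewrite on_cycle_spine //; case: k kl => //= k kl kn.
by rewrite nbrs_interior //; lia.
Qed.

Lemma cycle_arcE x y : cycle_arc x y || cycle_arc y x =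
  on_cycle x && ((y == next (outer_cycle m) x) || (y == prev (outer_cycle m) x)).
Proof.
rewrite /cycle_arc !mem_outer_cycle andb_orr; congr (_ || _).
apply/andP/andP => [[yC /eqP ->]|[xC /eqP ->]].
  by rewrite on_cycle_next prev_next ?uniq_outer_cycle.
by rewrite on_cycle_prev next_prev ?uniq_outer_cycle.
Qed.

Lemma caterpillar_spine k k' : k < ell.+2 -> k' < ell.+2 ->
  caterpillar_arc (spine_vertex k) (spine_vertex k') = (k' == k.+1).
Proof. by move=> kl kl'; rewrite /= !val_spine_vertex. Qed.

Lemma caterpillar_spine_leaf k k' : k < ell.+2 -> k' < ell ->
  caterpillar_arc (spine_vertex k) (leaf_vertex k') = (k == k'.+1).
Proof.
by move=> kl kl'; rewrite -[k']/(val (Ordinal kl')) leaf_vertexE /= val_spine_vertex.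
Qed.

Lemma caterpillar_leaf k x : k < ell -> caterpillar_arc (leaf_vertex k) x = false.
Proof. by move=> kl; rewrite -[k]/(val (Ordinal kl)) leaf_vertexE; case: x. Qed.

Lemma caterpillar_arcE x y : caterpillar_arc x y || caterpillar_arc y x =
  if on_cycle x then y == stem x else y \in nbrs x.
Proof.
case: (halin_vertexP x) => -[k kl ->]; last first.
  rewrite on_cycle_leaf // stem_leaf // caterpillar_leaf //.
  case: (halin_vertexP y) => -[k' kl' ->].
    by rewrite caterpillar_spine_leaf // spine_vertex_inj //; lia.
  by rewrite caterpillar_leaf // [leaf_vertex k' == _]eq_sym spine_neq_leaf.
have : k = 0 \/ k = ell.+1 \/ exists2 k', k' < ell & k = k'.+1.
  case: k kl => [|k] kl; first by left.
  by right; have [kl'|kl'] := ltnP k ell; [right; exists k | left; lia].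
case=> [->|[->|[k' kl' ->]]] {k kl}.
- rewrite on_cycle_spine // eqxx orTb stem_spine0; case: (halin_vertexP y) => -[k kl ->].
    by rewrite !caterpillar_spine // spine_vertex_inj //; lia.
  by rewrite caterpillar_spine_leaf // caterpillar_leaf // [leaf_vertex k == _]eq_sym spine_neq_leaf.
- rewrite on_cycle_spine // eqxx orbT stem_spine_last; case: (halin_vertexP y) => -[k kl ->].
    by rewrite !caterpillar_spine // spine_vertex_inj //; lia.
  by rewrite caterpillar_spine_leaf // caterpillar_leaf // [leaf_vertex k == _]eq_sym
    spine_neq_leaf //; lia.
have kl1 : k'.+1 < ell.+2 by lia.
rewrite on_cycle_spine // eqSS orFb ltn_eqF // nbrs_interior // !inE.
case: (halin_vertexP y) => -[k kl ->].
  rewrite !caterpillar_spine // !spine_vertex_inj ?spine_neq_leaf //; lia.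
rewrite caterpillar_spine_leaf // caterpillar_leaf // ![leaf_vertex k == spine_vertex _]eq_sym.
by rewrite !spine_neq_leaf // leaf_vertex_inj // eqSS !orbF eq_sym.
Qed.

Lemma nbrs_neq x y : y \in nbrs x -> x != y.
Proof.
have [xC|] := boolP (on_cycle x).
  rewrite nbrs_cycle // !inE => /or3P[]/eqP ->; rewrite eq_sym ?next_neq ?prev_neq //.
  by apply/eqP => /(congr1 on_cycle); rewrite xC on_cycle_stem.
case: (halin_vertexP x) => -[k kl ->]; last by rewrite on_cycle_leaf.
rewrite on_cycle_spine //; case: k kl => //= k kl kn.
have {kn} kl' : k < ell by lia.
rewrite nbrs_interior // !inE => /or3P[]/eqP ->; rewrite ?spine_neq_leaf //.
  by rewrite spine_vertex_inj //; lia.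
by rewrite spine_vertex_inj //; lia.
Qed.

Lemma halin_adjE x y : halin_adj x y = (y \in nbrs x).
Proof.
rewrite /halin_adj /= /halin_arc orbACA cycle_arcE caterpillar_arcE.
have [xC|xC] := boolP (on_cycle x); rewrite /= ?orbF.
  have := @nbrs_neq x y; rewrite nbrs_cycle // !inE.
  by case: (_ || _) => [->|] //; rewrite andbF.
by apply/andP/idP => [[]//|yx]; rewrite nbrs_neq.
Qed.

Definition opposite x y : nat := nth 0 (labels x) (index y (nbrs x)).

(** The six kinds of darts: along the spine, along a stem and along the cycle, each in both
    directions. The two ends of the path count as spine vertices in the first two cases. *)
Lemma nbrs_ind (P : halin_vertex m -> halin_vertex m -> Prop) :
  (forall k, k <= ell -> P (spine_vertex k) (spine_vertex k.+1)) ->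
  (forall k, k <= ell -> P (spine_vertex k.+1) (spine_vertex k)) ->
  (forall k, k < ell -> P (spine_vertex k.+1) (leaf_vertex k)) ->
  (forall k, k < ell -> P (leaf_vertex k) (spine_vertex k.+1)) ->
  (forall x, on_cycle x -> P x (next (outer_cycle m) x)) ->
  (forall x, on_cycle x -> P x (prev (outer_cycle m) x)) ->
  forall x y, y \in nbrs x -> P x y.
Proof.
move=> Hs Hs' Hl Hl' Hn Hp x y; have [xC|] := boolP (on_cycle x).
  rewrite nbrs_cycle // !inE => /or3P[]/eqP ->; [|exact: Hn|exact: Hp].
  move: xC; case: (halin_vertexP x) => -[k kl ->]; last by rewrite stem_leaf // => _; exact: Hl'.
  rewrite on_cycle_spine // => /orP[]/eqP ->; first by rewrite stem_spine0; exact: Hs.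
  by rewrite stem_spine_last; exact: Hs'.
case: (halin_vertexP x) => -[k kl ->]; last by rewrite on_cycle_leaf.
rewrite on_cycle_spine //; case: k kl => //= k kl kn.
have {kn} kl' : k < ell by lia.
rewrite nbrs_interior // !inE => /or3P[]/eqP ->; [exact/Hs'/ltnW|exact: Hl|exact: Hs].
Qed.

Lemma opposite_spine k : k <= ell ->
  opposite (spine_vertex k) (spine_vertex k.+1) = if k is k'.+1 then closed S k' else ell.+2.
Proof.
move=> kl; rewrite /opposite; case: k kl => [|k] kl.
  by rewrite labels_spine0 nbrs_cycle ?on_cycle_spine // stem_spine0 /= eqxx.
rewrite labels_interior // nbrs_interior //= spine_vertex_inj; try lia.
by rewrite [leaf_vertex k == _]eq_sym spine_neq_leaf // eqxx ltn_eqF.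
Qed.

Lemma opposite_spine_back k : k <= ell ->
  opposite (spine_vertex k.+1) (spine_vertex k) = k.+2.
Proof.
rewrite leq_eqVlt /opposite => /orP[/eqP ->|kl].
  rewrite labels_cycle ?nbrs_cycle ?on_cycle_spine ?eqxx ?orbT //.
  by rewrite stem_spine_last /= eqxx.
by rewrite labels_interior // nbrs_interior //= eqxx.
Qed.

Lemma opposite_leaf k : k < ell ->
  opposite (spine_vertex k.+1) (leaf_vertex k) = kept S k.
Proof.
move=> kl; rewrite /opposite labels_interior // nbrs_interior //=.
by rewrite spine_neq_leaf // eqxx.
Qed.

Lemma opposite_stem x : on_cycle x -> opposite x (stem x) = ell.+2.
Proof. by move=> xC; rewrite /opposite labels_cycle // nbrs_cycle //= eqxx. Qed.

Lemma opposite_next x : on_cycle x ->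
  opposite x (next (outer_cycle m) x) = label_in x.
Proof.
move=> xC; have := uniq_nbrs x; rewrite /opposite labels_cycle // nbrs_cycle //.
rewrite [uniq _]/= !inE negb_or => /andP[/andP[/negPf n1 _] _].
by rewrite [index _ _]/= n1 eqxx.
Qed.

Lemma opposite_prev x : on_cycle x ->
  opposite x (prev (outer_cycle m) x) = label_out x.
Proof.
move=> xC; have := uniq_nbrs x; rewrite /opposite labels_cycle // nbrs_cycle //.
rewrite [uniq _]/= !inE negb_or => /andP[/andP[_ /negPf n1] /andP[/negPf n2 _]].
by rewrite [index _ _]/= n1 n2 eqxx.
Qed.

(** The vertex from which the cycle edge bordering face [k] departs. The cycle runs rightwards above
    and leftwards below, so the edge of the face opened by a leaf leaves that leaf above and enters
    it below. *)
Definition cycle_vertex (k : nat) : halin_vertex m :=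
  match k with
  | 0 => prev (outer_cycle m) (spine_vertex 0)
  | 1 => spine_vertex 0
  | j.+2 => if nth false (sides m) j then leaf_vertex j
            else prev (outer_cycle m) (leaf_vertex j)
  end.

Lemma on_cycle_cycle_vertex k : k < ell.+2 -> on_cycle (cycle_vertex k).
Proof.
case: k => [|[|j]] jl; rewrite /cycle_vertex ?on_cycle_prev ?on_cycle_spine //.
by case: ifP => _; rewrite ?on_cycle_prev on_cycle_leaf.
Qed.

Lemma label_out_prev x : on_cycle x -> label_out (prev (outer_cycle m) x) = label_in x.
Proof.
move=> xC; rewrite cycle_labels ?mem_prev ?mem_outer_cycle //.
by rewrite next_prev ?uniq_outer_cycle.
Qed.

Lemma label_out_cycle_vertex k : k < ell.+2 -> label_out (cycle_vertex k) = k.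
Proof.
case: k => [|[|j]] jl; rewrite /cycle_vertex.
- by rewrite label_out_prev ?on_cycle_spine // /label_in /= val_spine_vertex.
- by rewrite /label_out /= val_spine_vertex.
have jl' : j < ell by lia.
case: ifP => aj; rewrite ?label_out_prev ?on_cycle_leaf //;
by rewrite -[j]/(val (Ordinal jl')) leaf_vertexE /= /above /= aj.
Qed.

(** All [ell.+2] inner faces occur as outgoing labels, and the cycle has just [ell.+2] vertices. *)
Lemma label_out_inj x y : on_cycle x -> on_cycle y -> label_out x = label_out y -> x = y.
Proof.
have U : uniq (map label_out (outer_cycle m)).
  apply: (leq_size_uniq (iota_uniq 0 ell.+2)).
    move=> k; rewrite mem_iota => /andP[_ kl]; apply/mapP.
    by exists (cycle_vertex k); rewrite ?mem_outer_cycle ?on_cycle_cycle_vertex ?label_out_cycle_vertex.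
  by rewrite size_map size_outer_cycle size_iota.
rewrite -!mem_outer_cycle => xC yC E.
rewrite -(nth_index x xC) -(nth_index x yC); congr nth; apply/eqP.
have lx := xC; have ly := yC; rewrite -index_mem in lx; rewrite -index_mem in ly.
rewrite -(nth_uniq 0 _ _ U) ?size_map // !(nth_map x) //.
by rewrite !nth_index // E.
Qed.

(** The local form of planarity: along an edge exactly the two faces bordering it pass to the other
    end. On the cycle this uses that the cycle has more than two vertices. *)
Lemma labels_opposite x y f : y \in nbrs x -> f \in labels x ->
  (f \in labels y) = (f != opposite x y).
Proof.
move=> yx; move: x y yx f.
apply: nbrs_ind => [k kl f|k kl f|k kl f|k kl f|x xC f|x xC f].
- rewrite opposite_spine // labels_spine //; case: k kl => [|k] kl.
    by rewrite labels_spine0 !inE /=; lia.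
  rewrite labels_interior // !inE upper_lowerS.
  have := kept_leq S k; have := closed_leq S k; have := kept_neq_closed S k; lia.
- rewrite opposite_spine_back // labels_spine //; case: k kl => [|k] kl.
    by rewrite labels_spine0 !inE /=; lia.
  rewrite labels_interior // !inE upper_lowerS.
  have := kept_leq S k; have := closed_leq S k; have := kept_neq_closed S k; lia.
- rewrite opposite_leaf // labels_leaf // labels_interior // !inE.
  have := kept_leq S k; have := closed_leq S k; have := kept_neq_closed S k; lia.
- rewrite -stem_leaf // opposite_stem ?on_cycle_leaf // stem_leaf //.
  rewrite labels_leaf // labels_interior // !inE.
  have := kept_leq S k; have := closed_leq S k; have := kept_neq_closed S k; lia.
- rewrite opposite_next // !labels_cycle ?on_cycle_next // -cycle_labels ?mem_outer_cycle //.
  have [i_lt [o_lt io]] := label_in_out xC.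
  have ne : label_in x != label_out (next (outer_cycle m) x).
    apply/eqP; rewrite -label_out_prev // => /label_out_inj.
    rewrite on_cycle_prev on_cycle_next => /(_ xC xC) /esym/eqP.
    by apply/negP/next_neq_prev; rewrite ?uniq_outer_cycle ?size_outer_cycle ?mem_outer_cycle.
  by rewrite !inE; lia.
rewrite opposite_prev // !labels_cycle ?on_cycle_prev // label_out_prev //.
have [i_lt [o_lt io]] := label_in_out xC.
have ne : label_out x != label_in (prev (outer_cycle m) x).
  apply/eqP; rewrite -label_out_prev ?on_cycle_prev // => /label_out_inj.
  rewrite !on_cycle_prev => /(_ xC xC) /(congr1 (next (outer_cycle m))).
  rewrite next_prev ?uniq_outer_cycle // => /eqP.
  by apply/negP/next_neq_prev; rewrite ?uniq_outer_cycle ?size_outer_cycle ?mem_outer_cycle.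
by rewrite !inE; lia.
Qed.

Lemma uniq_labels x : uniq (labels x).
Proof.
have [xC|] := boolP (on_cycle x).
  by have := label_in_out xC; rewrite labels_cycle //= !inE => -[? [? ?]]; lia.
case: (halin_vertexP x) => -[k kl ->]; last by rewrite on_cycle_leaf.
rewrite on_cycle_spine //; case: k kl => //= k kl kn.
have {kn} kl' : k < ell by lia.
rewrite labels_interior //= !inE.
have := kept_leq S k; have := closed_leq S k; have := kept_neq_closed S k; lia.
Qed.

Lemma labels_leq x f : f \in labels x -> f < ell.+3.
Proof.
have [xC|] := boolP (on_cycle x).
  by have := label_in_out xC; rewrite labels_cycle //= !inE => -[? [? ?]]; lia.
case: (halin_vertexP x) => -[k kl ->]; last by rewrite on_cycle_leaf.
rewrite on_cycle_spine //; case: k kl => //= k kl kn.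
have {kn} kl' : k < ell by lia.
rewrite labels_interior //= !inE.
have := kept_leq S k; have := closed_leq S k; lia.
Qed.

Lemma size_labels x : size (labels x) = 3.
Proof.
have [xC|] := boolP (on_cycle x); first by rewrite labels_cycle.
case: (halin_vertexP x) => -[k kl ->]; last by rewrite on_cycle_leaf.
rewrite on_cycle_spine //; case: k kl => //= k kl kn.
by rewrite labels_interior //; lia.
Qed.

Lemma mem_opposite x y : y \in nbrs x -> opposite x y \in labels x.
Proof. by move=> yx; rewrite mem_nth // size_labels -(size_nbrs x) index_mem. Qed.

Lemma opposite_inj x y y' : y \in nbrs x -> y' \in nbrs x ->
  opposite x y = opposite x y' -> y = y'.
Proof.
move=> yx y'x /eqP; rewrite /opposite nth_uniq ?uniq_labels // ?size_labels -?(size_nbrs x)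
  ?index_mem //.
by move=> /eqP E; rewrite -(nth_index y yx) E nth_index.
Qed.

Lemma opposite_surj x f : f \in labels x -> exists2 y, y \in nbrs x & opposite x y = f.
Proof.
move=> fx; have fi := fx; rewrite -index_mem size_labels -(size_nbrs x) in fi.
exists (nth x (nbrs x) (index f (labels x))); first exact: mem_nth.
by rewrite /opposite index_uniq ?uniq_nbrs // nth_index.
Qed.

Lemma labels_interior_lt x f : f \in labels x -> ~~ on_cycle x -> f < ell.+2.
Proof.
case: (halin_vertexP x) => -[k kl ->]; last by rewrite on_cycle_leaf.
move=> + nC; rewrite on_cycle_spine // in nC; case: k kl nC => //= k kl kn.
have {kn} kl' : k < ell by lia.
by rewrite labels_interior //= !inE; have := kept_leq S k; have := closed_leq S k; lia.
Qed.

(** * The Halin graph as a cubic graph with a dual *)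

Let G := halin m.
Let N := (spine m).+2.

Lemma head_nbrs (d : dart G) : (head d : halin_vertex m) \in nbrs (tail d).
Proof. by rewrite -halin_adjE; exact: (valP d). Qed.

Lemma dart_of_nbr x y : y \in nbrs x -> exists d : dart G, tail d = x /\ head d = y.
Proof. by rewrite -halin_adjE => p; exists (exist _ (x, y) p). Qed.

(** [insub] sends the number [N] of the outer face to [None]. *)
Definition halin_kappa (d : dart G) : option 'I_N :=
  insub (opposite (tail d : halin_vertex m) (head d)).

Definition face_code (i : option 'I_N) : nat := if i is Some j then j else N.

Lemma face_code_inj : injective face_code.
Proof.
move=> [i|] [j|] //= E; first by congr Some; apply: val_inj.
  by have := ltn_ord i; rewrite E ltnn.
by have := ltn_ord j; rewrite -E ltnn.
Qed.

Lemma face_code_kappa d : face_code (halin_kappa d) = opposite (tail d : halin_vertex m) (head d).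
Proof.
rewrite /halin_kappa; case: insubP => [i _ /= -> //|] /=.
have := labels_leq (mem_opposite (head_nbrs d)); rewrite /N -/ell; lia.
Qed.

Lemma halin_cubic (x : G) : #|[set d : dart G | tail d == x]| = 3.
Proof.
rewrite -(size_nbrs x) -(card_uniqP (uniq_nbrs x)).
have inj : {in [set d : dart G | tail d == x] &, injective (@Defs.head G)}.
  move=> d d'; rewrite !inE => /eqP t /eqP t' h.
  by apply: dart_ext; rewrite ?t ?t'.
rewrite -(card_in_imset inj); apply: eq_card => y; apply/imsetP/idP.
  by case=> d; rewrite inE => /eqP <- ->; exact: head_nbrs.
by move=> /dart_of_nbr[d [td hd]]; exists d; rewrite ?inE ?td.
Qed.

Lemma halin_kappa_inj (d d' : dart G) :
  tail d = tail d' -> halin_kappa d = halin_kappa d' -> d = d'.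
Proof.
move=> td /(congr1 face_code); rewrite !face_code_kappa => E.
apply: dart_ext => //; apply: (@opposite_inj (tail d)); rewrite ?head_nbrs //.
  by rewrite td head_nbrs.
by rewrite E td.
Qed.

Lemma halin_kappa_edge (d d' : dart G) : tail d' = tail d -> d' != d ->
  exists d'', [/\ tail d'' = head d, d'' != rev_dart d & halin_kappa d'' = halin_kappa d'].
Proof.
move=> td nd; have hd := head_nbrs d; have hd' := head_nbrs d'; rewrite td in hd'.
have ne : opposite (tail d : halin_vertex m) (head d') != opposite (tail d : halin_vertex m) (head d).
  by apply: contraNneq nd => E; apply/eqP/dart_ext => //; apply: opposite_inj E.
have := labels_opposite hd (mem_opposite hd'); rewrite ne => /opposite_surj[y yh Ey].
have [d'' [t'' h'']] := dart_of_nbr yh.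
exists d''; split=> //; last first.
  by apply: face_code_inj; rewrite !face_code_kappa t'' h'' Ey td.
apply/eqP => Ed; have := mem_opposite hd'; rewrite -Ey -t'' -h'' Ed.
have hr := head_nbrs (rev_dart d).
by rewrite (labels_opposite hr (mem_opposite hr)) eqxx.
Qed.

Lemma halin_bordersE (d : dart G) i : borders halin_kappa (edge_of d) i =
  (face_code i \in labels (tail d)) && (face_code i \in labels (head d)).
Proof.
have hd := head_nbrs d.
apply/existsP/andP => [[d1 /andP[/eqP E /existsP[d' /and3P[/eqP td nd /eqP kd]]]] | [it ih]].
  have hd1 := head_nbrs d1; have hd' := head_nbrs d'; rewrite td in hd'.
  have Ei : face_code i = opposite (tail d1 : halin_vertex m) (head d').
    by rewrite -kd face_code_kappa td.
  have i1 : face_code i \in labels (tail d1) by rewrite Ei mem_opposite.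
  have i2 : face_code i \in labels (head d1).
    rewrite (labels_opposite hd1 i1) Ei; apply: contraNneq nd => E'.
    by apply/eqP/dart_ext => //; apply: opposite_inj E'.
  by case: (edge_of_eq E) => ->.
have [y yt Ey] := opposite_surj it; have [d' [t' h']] := dart_of_nbr yt.
exists d; rewrite eqxx; apply/existsP; exists d'; rewrite t' eqxx /=.
apply/andP; split.
  by apply/eqP => Ed; move: ih; rewrite (labels_opposite hd it) -Ey -h' Ed eqxx.
by apply/eqP/face_code_inj; rewrite face_code_kappa t' h'.
Qed.

(** The caterpillar, which serves as the reference tree [T0]. *)
Definition halin_tree : {set edge G} :=
  [set e | [exists d : dart G, (edge_of d == e) && ~~ on_cycle (tail d)]].

Lemma mem_halin_tree (d : dart G) :
  (edge_of d \in halin_tree) = ~~ on_cycle (tail d) || ~~ on_cycle (head d).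
Proof.
rewrite inE; apply/existsP/orP => [[d' /andP[/eqP E nC]]|[]].
- by case: (edge_of_eq (esym E)) nC => -> nC; [left | right].
- by exists d; rewrite eqxx.
by exists (rev_dart d); rewrite edge_of_rev eqxx.
Qed.

Lemma halin_treeP e : e \in halin_tree -> exists2 d : dart G, edge_of d = e &
  (exists2 k, k <= ell & tail d = spine_vertex k /\ head d = spine_vertex k.+1) \/
  (exists2 k, k < ell & tail d = spine_vertex k.+1 /\ head d = leaf_vertex k).
Proof.
have [d <-] := edge_ofP e; rewrite mem_halin_tree => H.
pose Q (d : dart G) := (exists2 k, k <= ell & tail d = spine_vertex k /\ head d = spine_vertex k.+1) \/
  (exists2 k, k < ell & tail d = spine_vertex k.+1 /\ head d = leaf_vertex k).
suff : Q d \/ Q (rev_dart d).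
  by case=> Hq; [exists d | exists (rev_dart d); rewrite ?edge_of_rev].
have := head_nbrs d; rewrite /Q /= -[tail (rev_dart d)]/(head d) -[head (rev_dart d)]/(tail d).
move: (tail d : halin_vertex m) (head d : halin_vertex m) H => x y H yx; move: x y yx H.
apply: nbrs_ind => [k kl|k kl|k kl|k kl|x xC|x xC].
- by move=> _; left; left; exists k.
- by move=> _; right; left; exists k.
- by move=> _; left; right; exists k.
- by move=> _; right; right; exists k.
- by rewrite on_cycle_next xC.
by rewrite on_cycle_prev xC.
Qed.

Lemma borders_spine (d : dart G) k (j : 'I_N) : k <= ell ->
  tail d = spine_vertex k -> head d = spine_vertex k.+1 ->
  borders halin_kappa (edge_of d) (Some j) = ((j : nat) == upper S k) || ((j : nat) == lower S k).
Proof.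
move=> kl td hd; rewrite halin_bordersE td hd [face_code _]/=.
have jN := ltn_ord j; rewrite labels_spine //; case: k kl td hd => [|k] kl td hd.
  by rewrite labels_spine0 !inE /= /N in jN *; lia.
rewrite labels_interior // !inE upper_lowerS.
have := kept_leq S k; have := closed_leq S k; have := kept_neq_closed S k; lia.
Qed.

Lemma borders_stem (d : dart G) k (j : 'I_N) : k < ell ->
  tail d = spine_vertex k.+1 -> head d = leaf_vertex k ->
  borders halin_kappa (edge_of d) (Some j) = ((j : nat) == k.+2) || ((j : nat) == closed S k).
Proof.
move=> kl td hd; rewrite halin_bordersE td hd /=.
have jN := ltn_ord j; rewrite labels_interior // labels_leaf // !inE /N -/ell in jN *.
have := kept_leq S k; have := closed_leq S k; have := kept_neq_closed S k; lia.
Qed.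

Lemma halin_tree_inner e : e \in halin_tree -> ~~ borders halin_kappa e None.
Proof.
have [d <-] := edge_ofP e; rewrite mem_halin_tree halin_bordersE /= => H.
by apply/negP => /andP[/labels_interior_lt Ht /labels_interior_lt Hh];
  case/orP: H => [/Ht|/Hh]; rewrite ltnn.
Qed.

Lemma halin_cycle_edges : exists2 cyc : 'I_N -> edge G,
  (forall e, e \notin halin_tree -> exists j, e = cyc j) &
  (forall j i, borders halin_kappa (cyc j) (Some i) = (i == j)).
Proof.
have /fin_all_exists[cyc cycP] (j : 'I_N) : exists e, exists d : dart G,
    [/\ edge_of d = e, tail d = cycle_vertex j &
        head d = next (outer_cycle m) (cycle_vertex j)].
  have xC := on_cycle_cycle_vertex (ltn_ord j).
  have [|d [td hd]] := @dart_of_nbr (cycle_vertex j) (next (outer_cycle m) (cycle_vertex j)).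
    by rewrite nbrs_cycle // !inE eqxx orbT.
  by exists (edge_of d), d.
exists cyc => [e | j i].
  have H (d : dart G) : on_cycle (tail d) -> (head d : halin_vertex m) = next (outer_cycle m) (tail d) ->
      exists j, edge_of d = cyc j.
    move=> tC hd; have [_ [lN _]] := label_in_out tC.
    exists (Ordinal lN); have [d' [<- td' hd']] := cycP (Ordinal lN).
    have E : cycle_vertex (Ordinal lN) = tail d.
      by apply: label_out_inj; rewrite ?on_cycle_cycle_vertex ?label_out_cycle_vertex.
    by congr edge_of; apply: dart_ext; rewrite ?td' ?hd' ?E.
  have [d <-] := edge_ofP e; rewrite mem_halin_tree negb_or !negbK => /andP[tC hC].
  have := head_nbrs d; rewrite nbrs_cycle // !inE => /or3P[]/eqP hd.
  - by rewrite hd on_cycle_stem in hC.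
  - exact: H.
  rewrite -edge_of_rev; apply: H => //.
  by rewrite -[tail (rev_dart d)]/(head d) hd next_prev // uniq_outer_cycle.
have [d [<- td hd]] := cycP j; rewrite halin_bordersE td hd /=.
have xC := on_cycle_cycle_vertex (ltn_ord j).
have [_ [_ io]] := label_in_out xC.
have nb : next (outer_cycle m) (cycle_vertex j) \in nbrs (cycle_vertex j).
  by rewrite nbrs_cycle // !inE eqxx orbT.
have jE := label_out_cycle_vertex (ltn_ord j).
have iN := ltn_ord i.
have [iL|] := boolP ((i : nat) \in labels (cycle_vertex j)); rewrite -[i == j]/((i : nat) == j) /=.
  rewrite (labels_opposite nb iL) opposite_next //.
  rewrite jE in io; move: iL iN; rewrite labels_cycle // !inE jE.
  move=> /or3P[]/eqP ->; first by rewrite ltnn.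
    by rewrite eqxx (negPf io).
  by rewrite eqxx eq_sym io.
rewrite labels_cycle // !inE jE => /norP[_ /norP[_ /negPf]].
by [].
Qed.

(** The larger face number of the pair is [k.+1] on the spine edge from [v_k] and [k.+2] on the stem
    at [v_(k+1)]. The two edges sharing the larger number [k.+2] lead to [kept S k] and
    [closed S k], which differ. *)
Lemma halin_dual_simple e e' (i j : 'I_N) : i != j ->
  borders halin_kappa e (Some i) -> borders halin_kappa e (Some j) ->
  borders halin_kappa e' (Some i) -> borders halin_kappa e' (Some j) -> e = e'.
Proof.
have [cyc cycT cycB] := halin_cycle_edges => ij ei ej e'i e'j.
have inT e0 : borders halin_kappa e0 (Some i) -> borders halin_kappa e0 (Some j) -> e0 \in halin_tree.
  move=> bi bj; apply: contraNT ij => /cycT[k Ek]; move: bi bj.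
  by rewrite Ek !cycB => /eqP -> /eqP ->.
have [d de Hd] := halin_treeP (inT e ei ej); have [d' de' Hd'] := halin_treeP (inT e' e'i e'j).
move: ei ej e'i e'j ij; rewrite -de -de' -val_eqE /= => ei ej e'i e'j ij.
have upper_facts k := (upper_leq S k, lower_leq S k, newest_face S k, upper_neq_lower S k).
case: Hd => -[k kl [td hd]]; case: Hd' => -[k' kl' [td' hd']]; move: ei ej e'i e'j.
- rewrite !(borders_spine _ kl td hd) !(borders_spine _ kl' td' hd').
  have := upper_facts k; have := upper_facts k' => -[[[u' l'] n'] ne'] [[[u l] n] ne] *.
  have E : k = k' by lia.
  by congr edge_of; apply: dart_ext; rewrite ?td ?td' ?hd ?hd' E.
- rewrite !(borders_spine _ kl td hd) !(borders_stem _ kl' td' hd').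
  have := upper_facts k => -[[[u l] n] ne]; have := closed_leq S k' => c.
  have := kept_neq_closed S k' => kc i1 j1 i2 j2; exfalso.
  have E : k = k'.+1 by lia.
  by rewrite E !upper_lowerS in i1 j1; lia.
- rewrite !(borders_spine _ kl' td' hd') !(borders_stem _ kl td hd).
  have := upper_facts k' => -[[[u l] n] ne]; have := closed_leq S k => c.
  have := kept_neq_closed S k => kc i1 j1 i2 j2; exfalso.
  have E : k' = k.+1 by lia.
  by rewrite E !upper_lowerS in i2 j2; lia.
rewrite !(borders_stem _ kl td hd) !(borders_stem _ kl' td' hd').
have := closed_leq S k; have := closed_leq S k' => *.
have E : k = k' by lia.
by congr edge_of; apply: dart_ext; rewrite ?td ?td' ?hd ?hd' E.
Qed.

Lemma halin_spine_dart k : k <= ell -> exists d : dart G,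
  tail d = spine_vertex k /\ head d = spine_vertex k.+1.
Proof.
move=> kl; apply: dart_of_nbr; case: k kl => [|k] kl.
  by rewrite nbrs_cycle ?on_cycle_spine // stem_spine0 mem_head.
by rewrite nbrs_interior // !inE eqxx !orbT.
Qed.

Lemma halin_stem_dart k : k < ell -> exists d : dart G,
  tail d = spine_vertex k.+1 /\ head d = leaf_vertex k.
Proof. by move=> kl; apply: dart_of_nbr; rewrite nbrs_interior // !inE eqxx !orbT. Qed.

Lemma halin_dual_adj (i j : 'I_N) : dual_adj halin_kappa i j = fan_adj S i j.
Proof.
have [cyc cycT cycB] := halin_cycle_edges.
have [->|ij] := eqVneq i j.
  by rewrite /fan_adj /= eqxx; apply/existsP; exists (cyc j); rewrite cycB eqxx.
have ij' : (i : nat) != j by [].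
apply/existsP/idP => [[e /andP[ei ej]] | ].
  have eT : e \in halin_tree.
    apply: contraNT ij => /cycT[k Ek]; move: ei ej.
    by rewrite Ek !cycB => /eqP -> /eqP ->.
  have [d de Hd] := halin_treeP eT; move: ei ej; rewrite -de.
  case: Hd => -[k kl [td hd]].
    rewrite !(borders_spine _ kl td hd) => ei ej.
    have [[-> ->]|[-> ->]] : ((i : nat) = upper S k /\ (j : nat) = lower S k) \/
        ((i : nat) = lower S k /\ (j : nat) = upper S k) by lia.
      exact: upper_lower_adj.
    by rewrite fan_adjC upper_lower_adj.
  rewrite !(borders_stem _ kl td hd) => ei ej.
  have [[-> ->]|[-> ->]] : ((i : nat) = closed S k /\ (j : nat) = k.+2) \/
      ((i : nat) = k.+2 /\ (j : nat) = closed S k) by lia.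
    exact: closed_adj.
  by rewrite fan_adjC closed_adj.
have parentP (a b : 'I_N) : parent S a b ->
    exists2 e, borders halin_kappa e (Some a) & borders halin_kappa e (Some b).
  case/andP; case: b => -[|[|b]] bN //= ab.
    have [d [td hd]] := halin_spine_dart (leq0n ell).
    move=> _; exists (edge_of d); rewrite (borders_spine _ _ td hd) //=.
    by move: ab; rewrite ltnS leqn0 => /eqP ->.
  rewrite subSS subSS subn0 kept_closed => /orP[]/eqP aE.
    have bl : b.+1 <= ell by rewrite /N in bN; lia.
    have [d [td hd]] := halin_spine_dart bl.
    by exists (edge_of d); rewrite (borders_spine _ bl td hd) upper_lowerS ?aE eqxx ?orbT.
  have bl : b < ell by rewrite /N in bN; lia.
  have [d [td hd]] := halin_stem_dart bl.
  by exists (edge_of d); rewrite (borders_stem _ bl td hd) ?aE eqxx ?orbT.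
rewrite /fan_adj /= (negPf ij') orFb => /orP[] pij; have [e e1 e2] := parentP _ _ pij;
  by exists e; rewrite e1 e2.
Qed.

Lemma halin_tree_like : tree_like halin_tree.
Proof.
split=> [c c0 | e eT].
  have cs k : k <= ell -> c (spine_vertex k) = c (spine_vertex k.+1).
    move=> kl; have [d [td hd]] := halin_spine_dart kl.
    have : edge_of d \in halin_tree.
      rewrite mem_halin_tree td hd !on_cycle_spine; lia.
    by move=> /c0; rewrite cobound_edge td hd => /eqP; rewrite addr_eq0 F2_oppr => /eqP.
  have cl k : k < ell -> c (spine_vertex k.+1) = c (leaf_vertex k).
    move=> kl; have [d [td hd]] := halin_stem_dart kl.
    have : edge_of d \in halin_tree.
      by rewrite mem_halin_tree td hd !on_cycle_spine; lia.
    by move=> /c0; rewrite cobound_edge td hd => /eqP; rewrite addr_eq0 F2_oppr => /eqP.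
  have c1 k : k < ell.+2 -> c (spine_vertex k) = c (spine_vertex 0).
    by elim: k => // k IH kl; rewrite -cs ?IH //; lia.
  have c2 x : c x = c (spine_vertex 0).
    case: (halin_vertexP x) => -[k kl ->]; first exact: c1.
    by rewrite -cl // c1 //; lia.
  by move=> x y; rewrite !c2.
have [d de Hd] := halin_treeP eT.
have finish (C : halin_vertex m -> 'F_2) : cobound (C : G -> 'F_2) e = 1%R ->
    (forall e', e' \in halin_tree -> cobound (C : G -> 'F_2) e' = 0%R \/ e' = e) ->
    exists C : G -> 'F_2, forall e', e' \in halin_tree -> cobound C e' = (e' == e)%:R%R.
  move=> C1 H; exists C => e' /H[C0|->]; last by rewrite eqxx.
  by case: eqP => [E|_] //; rewrite E C1 in C0.
case: Hd => -[k kl [td hd]].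
  (* The cut of a spine edge is the part of the caterpillar on its left; the leaf [inr j] hangs from
     [v_(j+1)], hence the strict inequality. *)
  pose C (x : halin_vertex m) : 'F_2 :=
    match x with inl i => (i <= k)%:R%R | inr j => (j < k)%:R%R end.
  have C_spine k' : k' < ell.+2 -> C (spine_vertex k') = (k' <= k)%:R%R.
    by move=> kl'; rewrite /C /= val_spine_vertex.
  have C_leaf k' : k' < ell -> C (leaf_vertex k') = (k' < k)%:R%R.
    by move=> kl'; rewrite -[k']/(val (Ordinal kl')) leaf_vertexE.
  apply: (finish C).
    rewrite -de cobound_edge td hd !C_spine ?ltnn ?leqnn ?addr0 //; lia.
  move=> e' /halin_treeP[d' <- [] [k' kl' [td' hd']]]; rewrite cobound_edge td' hd'.
    have [E|ne] := eqVneq k' k.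
      by right; rewrite -de; congr edge_of; apply: dart_ext; rewrite ?td ?td' ?hd ?hd' E.
    left; rewrite !C_spine; try lia.
    have -> : (k' < k) = (k' <= k) by lia.
    by rewrite F2_addrr.
  by left; rewrite C_spine ?C_leaf ?F2_addrr //; lia.
apply: (finish (fun x => (x == leaf_vertex k)%:R%R)).
  by rewrite -de cobound_edge td hd spine_neq_leaf // eqxx add0r.
move=> e' /halin_treeP[d' <- [] [k' kl' [td' hd']]]; rewrite cobound_edge td' hd'.
  by left; rewrite !spine_neq_leaf // addr0.
rewrite spine_neq_leaf // leaf_vertex_inj //.
have [E|ne] := eqVneq k' k; last by left; rewrite addr0.
by right; rewrite -de; congr edge_of; apply: dart_ext; rewrite ?td ?td' ?hd ?hd' E.
Qed.

Lemma halin_euler : (#|{: edge G}|.+1 = #|G| + N)%N.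
Proof.
apply: double_inj; rewrite doubleS -card_darts.
have -> : #|{: dart G}| = (#|G| * 3)%N.
  rewrite -sum1_card (partition_big (@tail G) predT) //= -sum_nat_const.
  apply: eq_bigr => x _; rewrite -(halin_cubic x) -sum1_card.
  by apply: eq_bigl => d; rewrite inE.
have -> : #|G| = (ell.+2 + ell)%N by rewrite card_sum !card_ord.
rewrite /N -/ell -!muln2; lia.
Qed.

Theorem halin_genus_poly (T : {set edge G}) : tree_like T ->
  euler_genus_poly T = (2 *: rank_poly (fun i j : 'I_N => fan_adj S i j))%R.
Proof.
move=> tT; have [cyc cycT cycB] := halin_cycle_edges.
have border_cyc j i : border_coef halin_kappa (cyc j) i = (i == j)%:R%R.
  by rewrite /border_coef cycB.
rewrite (euler_genus_polyE halin_cubic halin_kappa_inj halin_kappa_edge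
  halin_tree_like cycT border_cyc halin_euler (spine_vertex 0) tT).
rewrite (sum_border_form halin_cubic halin_kappa_inj halin_kappa_edge
  cycT border_cyc halin_tree_inner halin_dual_simple).
congr (_ *: _)%R; apply: (@rank_poly_iso _ _ _ _ id) => [|i j]; first by exists id.
exact: halin_dual_adj.
Qed.

End HalinFaces.

(** * Adding faces at the end of a fan *)

Local Open Scope ring_scope.

Definition fan_poly (S : seq bool) (n : nat) : {poly int} :=
  rank_poly (fun i j : 'I_n => fan_adj S i j).

(** The newest face [n - 1] looks at [upper] and [lower] of [n - 3], which depend on the sides below
    [n - 3] only. With [n = spine m + 2] the side of the last leaf is thus ignored, which is the
    source of the second initial condition. *)
Lemma eq_fan_adj S S' n a b :
  {in gtn (n - 3)%N, forall i, nth false S i = nth false S' i} ->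
  (a < n)%N -> (b < n)%N -> fan_adj S a b = fan_adj S' a b.
Proof.
move=> H an bn.
have P x y : (x < n)%N -> (y < n)%N -> parent S x y = parent S' x y.
  move=> xn yn; rewrite /parent.
  have [|-> -> //] := @eq_upper_lower S S' (y - 2)%N.
  by move=> i; rewrite inE => iy; apply: H; rewrite inE; lia.
by rewrite /fan_adj /= !P.
Qed.

Lemma eq_rank_poly n (pat pat' : rel 'I_n) : pat =2 pat' -> rank_poly pat = rank_poly pat'.
Proof. by move=> E; apply: (@rank_poly_iso _ _ _ _ id) => //; exists id. Qed.

Lemma eq_fan_poly S S' n :
  {in gtn (n - 3)%N, forall i, nth false S i = nth false S' i} ->
  fan_poly S n = fan_poly S' n.
Proof. by move=> H; apply: eq_rank_poly => i j; apply: (eq_fan_adj H). Qed.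

Lemma card_ord_mem n (s : seq nat) : uniq s -> all (gtn n) s ->
  #|[pred i : 'I_n | (i : nat) \in s]| = size s.
Proof.
move=> Us sn; have Up : uniq (pmap insub s : seq 'I_n) by rewrite pmap_sub_uniq.
transitivity #|(pmap insub s : seq 'I_n)|.
  by apply: eq_card => i; rewrite !inE mem_pmap_sub.
by rewrite (card_uniqP Up) size_pmap_sub; apply/eqP; rewrite -all_count.
Qed.

Section FanRecurrence.
Variable S : seq bool.

(** The order is reversed because [cone] puts its apex at index 0, while the sweep adds faces at the
    end. *)
Let rfan n : rel 'I_n := fun i j => fan_adj S (rev_ord i) (rev_ord j).

Let rfan_poly n : fan_poly S n = rank_poly (@rfan n).
Proof.
apply: (@rank_poly_iso _ _ _ _ (@rev_ord n)) => [|i j].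
  exact: (Bijective (@rev_ordK n) (@rev_ordK n)).
by rewrite /rfan !rev_ordK.
Qed.

Let rfan_cone n (i j : 'I_(1 + n)) :
  rfan i j = cone (fun j : 'I_n => parent S (rev_ord j) n) (@rfan n) i j.
Proof.
have P (a : 'I_n) : fan_adj S n (n - a.+1)%N = parent S (n - a.+1)%N n.
  have := ltn_ord a => an; rewrite /fan_adj /= /parent.
  have -> : (n == n - a.+1)%N = false by lia.
  have -> : (n < n - a.+1)%N = false by lia.
  by [].
rewrite /cone -{1}(splitK i) -{1}(splitK j).
case: (split i) => i'; case: (split j) => j' /=; rewrite /rfan /= ?ord1 ?subSS ?subn0.
- by rewrite /fan_adj /= eqxx.
- exact: P.
- by rewrite fan_adjC; exact: P.
by [].
Qed.

(** Here w is face [n.+3] and u is face [n.+2]. The earlier neighbours of w are u and v =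
    [kept S n], and those of u are v and t = [closed S n]. *)
Theorem fan_poly_rec n : let v : 'I_n.+3 := inord (kept S n) in
  fan_poly S n.+4 = (1 + 4 *: 'X) * fan_poly S n.+3 + 16 *: 'X^2 * fan_poly S n.+2
    + 2 ^+ #|[pred a : 'I_n.+3 | fan_adj S (kept S n) a]| *: 'X^2 *
      rank_poly (kill (fun i j : 'I_n.+3 => fan_adj S i j) v).
Proof.
move=> v; rewrite !rfan_poly.
have kn : (kept S n < n.+2)%N by rewrite ltnS kept_leq.
have cn : (closed S n < n.+2)%N by rewrite ltnS closed_leq.
pose t0 : 'I_n.+2 := rev_ord (Ordinal cn); pose v0 : 'I_n.+2 := rev_ord (Ordinal kn).
have vE : v = rev_ord (rshift 1 v0 : 'I_(1 + n.+2)).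
  by apply: val_inj; rewrite /= inordK ?(ltnW kn) //; lia.
have rev_eq (j : 'I_n.+2) f (fn : (f < n.+2)%N) :
    (rev_ord j == f :> nat) = (j == rev_ord (Ordinal fn)).
  by rewrite -[j in RHS]rev_ordK (inj_eq rev_ord_inj).
have E3 i j : rfan i j = cone (pred2 t0 v0) (@rfan n.+2) i j.
  rewrite (@rfan_cone n.+2) /cone; case: (split i) => i'; case: (split j) => j' //.
  - rewrite /parent -[(n.+2 - 2)%N]/(n - 0)%N subn0 kept_closed !rev_eq ltn_ord.
    by rewrite /= orbC.
  - rewrite /parent -[(n.+2 - 2)%N]/(n - 0)%N subn0 kept_closed !rev_eq ltn_ord.
    by rewrite /= orbC.
have E4 i j : rfan i j = cone (pred2 (lshift n.+2 0) (rshift 1 v0)) (cone (pred2 t0 v0) (@rfan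
  n.+2)) i j.
  have PE (j' : 'I_n.+3) : parent S (rev_ord j') n.+3 =
      pred2 (lshift n.+2 0 : 'I_(1 + n.+2)) (rshift 1 v0 : 'I_(1 + n.+2)) j'.
    rewrite /parent -[(n.+3 - 2)%N]/(n.+1 - 0)%N subn0 upper_lowerS ltn_ord /=.
    have -> : (j' == (lshift n.+2 0 : 'I_(1 + n.+2))) = ((j' : nat) == 0%N) by [].
    have -> : (j' == (rshift 1 v0 : 'I_(1 + n.+2))) =
        ((j' : nat) == (1 + (n.+2 - (kept S n).+1))%N) by [].
    by have := ltn_ord j'; lia.
  rewrite (@rfan_cone n.+3) /cone; case: (split i) => i'; case: (split j) => j' //.
rewrite (eq_rank_poly E4) (eq_rank_poly E3).
have cl : fan_adj S (kept S n) (closed S n).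
  by rewrite /kept /closed; case: ifP => _; [rewrite fan_adjC|]; exact: upper_lower_adj.
have rv0 : rev_ord v0 = kept S n :> nat by rewrite rev_ordK.
have rt0 : rev_ord t0 = closed S n :> nat by rewrite rev_ordK.
rewrite (@rank_poly_cone_cone _ (@rfan n.+2) t0 v0); first last.
- by move=> i j; rewrite /rfan fan_adjC.
- by rewrite /rfan rv0 rt0 fan_adjC.
- by rewrite /rfan rv0 rt0.
- by rewrite /rfan /fan_adj /= eqxx.
- by rewrite (inj_eq rev_ord_inj) -val_eqE /= eq_sym kept_neq_closed.
have rv1 : rev_ord (rshift 1 v0 : 'I_(1 + n.+2)) = kept S n :> nat by rewrite -vE inordK // ltnW.
congr (_ + _ + 2 ^+ _ *: 'X^2 * _).
  rewrite -!sum1_card [RHS](reindex_inj (@rev_ord_inj n.+3)) /=.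
  by apply: eq_bigl => a; rewrite -[RHS]/(fan_adj S (kept S n) (rev_ord a)) -rv1 -[RHS]/(rfan _ _) E3.
symmetry; apply: (@rank_poly_iso _ _ _ _ (@rev_ord n.+3)) => [|i j].
  exact: (Bijective (@rev_ordK n.+3) (@rev_ordK n.+3)).
have H (x : 'I_n.+3) : (x == v) = (rev_ord x == (rshift 1 v0 : 'I_(1 + n.+2))).
  by rewrite vE -(inj_eq rev_ord_inj) rev_ordK.
by rewrite /kill !H -E3 /rfan !rev_ordK.
Qed.

End FanRecurrence.

(** * Faces and symbols *)

Local Close Scope ring_scope.

Lemma size_flatten_nseq (f : nat -> nat) (g : nat -> bool) n :
  size (flatten [seq nseq (f i) (g i) | i <- iota 0 n]) = \sum_(i < n) f i.
Proof.
elim: n => [|n IH]; first by rewrite big_ord0.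
by rewrite iota_rcons map_rcons flatten_rcons size_cat IH size_nseq big_ord_recr.
Qed.

Lemma nth_flatten_nseq (f : nat -> nat) (g : nat -> bool) n i j : i < n -> j < f i ->
  nth false (flatten [seq nseq (f i) (g i) | i <- iota 0 n]) (\sum_(i' < i) f i' + j) = g i.
Proof.
elim: n => // n IH; rewrite ltnS leq_eqVlt => /orP[/eqP -> | iln] jf;
  rewrite iota_rcons map_rcons flatten_rcons nth_cat size_flatten_nseq.
  by rewrite ltnNge leq_addr /= addKn nth_nseq jf.
rewrite ifT ?IH //; apply: leq_trans (_ : \sum_(i' < i.+1) f i' <= _).
  by rewrite big_ord_recr /= ltn_add2l.
rewrite -!(big_mkord predT f) (@big_cat_nat _ _ _ i.+1 0 n) //=.
exact: leq_addr.
Qed.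

Lemma size_sides m : size (sides m) = spine m.
Proof. exact: size_flatten_nseq. Qed.

Section Positions.
Variable m : seq nat.
Hypothesis m_size : 1 < size m.
Hypothesis m_gt0 : forall i, i < size m -> 0 < nth 0 m i.
Let S := sides m.

Definition offset (i : nat) : nat := \sum_(j < i) (nth 0 m j).+1.

(* The face that corresponds to the symbol [e_(i+1)] if [l = 0], and to
   [e_(i+1, l)] otherwise. *)
Definition position (i l : nat) : nat := offset i + l.

Lemma offsetS i : offset i.+1 = position i (nth 0 m i).+1.
Proof. by rewrite /offset big_ord_recr. Qed.

Lemma offset0 : offset 0 = 0.
Proof. by rewrite /offset big_ord0. Qed.

(** Fan [j] has [m_j + 1] symbols and, before block [i], as many leaves, except that the first block
    has one leaf fewer. *)
Lemma offset_block i : 0 < i < size m -> offset i = (\sum_(j < i) block m j).+1.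
Proof.
case: i => // i; elim: i => [_|i IH /andP[_ im]].
  by rewrite offsetS /position offset0 big_ord_recr big_ord0 /= /block /= addn0.
rewrite offsetS /position IH ?(ltnW im) // [in RHS]big_ord_recr /= [block m i.+1]/block /=.
have -> : (i.+1 < (size m).-1) by lia.
lia.
Qed.

Lemma offset_size : offset (size m) = (spine m).+2.
Proof.
have [k Ek] : exists k, size m = k.+2 by exists (size m).-2; lia.
have bE : block m k.+1 = nth 0 m k.+1 by rewrite /block Ek /= ltnn addn0.
have -> : spine m = \sum_(i < k.+1) block m i + nth 0 m k.+1.
  by rewrite /spine Ek big_ord_recr /= bE.
rewrite Ek offsetS /position offset_block ?Ek //; lia.
Qed.

(** The leaf with index [(position i l).-1] opens the face [(position i l).+1]. So block [i] opens
    the rest of its own fan and then the next centre. The conditions exclude the two faces present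
    from the start and a centre after the last block. *)
Lemma side_at i l : i < size m -> l <= nth 0 m i -> 0 < position i l ->
  (l < nth 0 m i) || (i.+1 < size m) -> nth false S (position i l).-1 = ~~ odd i.
Proof.
move=> im lm p0 H; case: i im lm p0 H => [|i] im lm p0 H.
  rewrite /position offset0 add0n in p0 *.
  have := @nth_flatten_nseq (block m) (fun i => ~~ odd i) _ _ l.-1 im.
  by rewrite big_ord0 add0n; apply; rewrite /block; lia.
have := @nth_flatten_nseq (block m) (fun i => ~~ odd i) _ _ l im.
rewrite /position offset_block //=; apply.
by rewrite /block /=; case: (ltnP i.+1 (size m).-1); lia.
Qed.

Definition side_face (n : nat) (b : bool) := if b then upper S n else lower S n.

Lemma side_faceS n b :
  side_face n.+1 b = if nth false S n == b then n.+2 else side_face n b.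
Proof. by rewrite /side_face /=; case: b; case: nth. Qed.

Lemma offset_gt0 i : 0 < i -> 0 < offset i.
Proof. by case: i => // i _; rewrite offsetS /position addnS. Qed.

(** The invariant of the sweep: during block [i] the newest face lies on the side of the leaves and
    the centre [offset i] stays on the other side. When a new centre opens, the previous centre is
    still across the spine. *)
Lemma side_faces : forall i, i < size m ->
  (0 < i -> side_face (offset i).-1 (odd i) = offset i /\
            side_face (offset i).-1 (~~ odd i) = offset i.-1) /\
  (forall l, 0 < l <= nth 0 m i ->
     side_face (position i l).-1 (~~ odd i) = position i l /\
     side_face (position i l).-1 (odd i) = offset i).
Proof.
have A i : i < size m ->
  (0 < i -> side_face (offset i).-1 (odd i) = offset i /\
            side_face (offset i).-1 (~~ odd i) = offset i.-1) ->
  forall l, 0 < l <= nth 0 m i ->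
     side_face (position i l).-1 (~~ odd i) = position i l /\
     side_face (position i l).-1 (odd i) = offset i.
  move=> im B; case=> // l /andP[_]; elim: l => [|l IH] lm.
    case: i im B lm => [|i] im B lm; first by rewrite /position offset0.
    have [B1 B2] := B isT; have o0 := @offset_gt0 i.+1 isT.
    have E : (position i.+1 1).-1 = (offset i.+1).-1.+1 by rewrite /position; lia.
    have sd := @side_at i.+1 0 im; rewrite /position addn0 in sd.
    rewrite E !side_faceS. rewrite sd ?eqxx //; last by rewrite m_gt0.
    rewrite B1; split; first by rewrite /position; lia.
    by case: (odd i.+1).
  have [I1 I2] := IH (ltnW lm).
  have E : (position i l.+2).-1 = (position i l.+1).-1.+1 by rewrite /position; lia.
  rewrite E !side_faceS side_at ?eqxx ?I2 ?lm //; [|exact: ltnW|by rewrite /position addnS].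
  by split; [rewrite /position; lia | case: (odd i)].
elim=> [|i IH] im.
  by split=> //; apply: A.
suff B : 0 < i.+1 -> side_face (offset i.+1).-1 (odd i.+1) = offset i.+1 /\
            side_face (offset i.+1).-1 (~~ odd i.+1) = offset i by split=> //; apply: A.
move=> _; have [_ /(_ (nth 0 m i))[|A1 A2]] := IH (ltnW im).
  by rewrite leqnn m_gt0 // ltnW.
have m0 := m_gt0 (ltnW im).
have E : (offset i.+1).-1 = (position i (nth 0 m i)).-1.+1 by rewrite offsetS /position; lia.
rewrite E !side_faceS side_at ?im ?orbT ?(ltnW im) //; last by rewrite /position; lia.
rewrite /= negbK eqxx A2; split; last by case: (odd i).
by rewrite offsetS /position; lia.
Qed.

Lemma parent_side_face a b s :
  parent S a b = (a < b) && ((a == side_face (b - 2) s) || (a == side_face (b - 2) (~~ s))).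
Proof. by rewrite /parent /side_face; case: s => //=; rewrite orbC. Qed.

Lemma position_mono i i' l : i < i' -> l <= nth 0 m i -> position i l < offset i'.
Proof.
elim: i' => // i' IH; rewrite ltnS leq_eqVlt => /orP[/eqP <-|ii'] li.
  by rewrite offsetS /position ltn_add2l.
by rewrite offsetS /position; have := IH ii' li; rewrite /position; lia.
Qed.

Lemma position_eq i l i' l' : l <= nth 0 m i -> l' <= nth 0 m i' ->
  (position i l == position i' l') = (i == i') && (l == l').
Proof.
move=> li li'; case: (ltngtP i i') => [ii'|ii'|->] /=; last by rewrite eqn_add2l.
  by have := position_mono ii' li; rewrite /position; lia.
by have := position_mono ii' li'; rewrite /position; lia.
Qed.

(** The off-diagonal entries of Delta, directed from the earlier to the later symbol; 0 stands for
    the centre of a fan. Each symbol after the first two has two predecessors. *)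
Definition symb_parent (i l i' l' : nat) : bool :=
  match l' with
  | 0 => (i' == i.+1) && ((l == 0) || (l == nth 0 m i))
  | 1 => (l == 0) && ((i' == i) || (i' == i.+1))
  | l''.+1 => (i' == i) && ((l == l'') || (l == 0))
  end.

Lemma parent_offset a i : 0 < i < size m ->
  parent S a (offset i) = (a == (offset i).-1) || (a == offset i.-1).
Proof.
case: i => // i /andP[_ im]; have im' := ltnW im.
have m0 := m_gt0 im'.
have [_ /(_ (nth 0 m i))[|A1 A2]] := side_faces im'; first by rewrite leqnn m0.
have E : offset i.+1 - 2 = (position i (nth 0 m i)).-1 by rewrite offsetS /position; lia.
rewrite (parent_side_face _ _ (~~ odd i)) E A1 negbK A2 /=.
rewrite offsetS /position; lia.
Qed.

Lemma parent_position a i l : i < size m -> 1 < l <= nth 0 m i ->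
  parent S a (position i l) = (a == position i l.-1) || (a == offset i).
Proof.
move=> im; case: l => [|[|l]] //= lm.
have [_ /(_ l.+1)[|A1 A2]] := side_faces im; first by rewrite /= ltnW.
have E : position i l.+2 - 2 = (position i l.+1).-1 by rewrite /position; lia.
rewrite (parent_side_face _ _ (~~ odd i)) E A1 negbK A2 /position; lia.
Qed.

Lemma parent_position1 a i : 0 < i < size m ->
  parent S a (position i 1) = (a == offset i) || (a == offset i.-1).
Proof.
case/andP => i0 im; have [/(_ i0)[B1 B2] _] := side_faces im.
have E : position i 1 - 2 = (offset i).-1 by rewrite /position; lia.
rewrite (parent_side_face _ _ (odd i)) E B1 B2 /position.
have : offset i.-1 <= offset i.
  by case: i i0 {im B1 B2 E} => // i _; rewrite /= offsetS /position leq_addr.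
lia.
Qed.

Lemma parent_symb i l i' l' : i < size m -> l <= nth 0 m i ->
  i' < size m -> l' <= nth 0 m i' ->
  parent S (position i l) (position i' l') = symb_parent i l i' l'.
Proof.
move=> im lm im' lm'.
have posE a : offset a = position a 0 by rewrite /position addn0.
case: l' lm' => [|[|l']] lm' /=.
- case: i' im' lm' => [|i'] im' lm'; first by rewrite /position offset0 /parent ltn0.
  rewrite -posE parent_offset // offsetS.
  have -> : (position i' (nth 0 m i').+1).-1 = position i' (nth 0 m i') by rewrite /position; lia.
  rewrite [offset _]posE !position_eq // eqSS; rewrite eq_sym; have [->|n] /= := eqVneq i' i;
    first by rewrite orbC.
  by [].
- case: i' im' lm' => [|i'] im' lm'.
    rewrite /parent /position offset0 /= add0n ltnS leqn0 addn_eq0.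
    case: i im lm => [|i] im lm; first by rewrite offset0; case: l lm.
    by rewrite (negPf (lt0n_neq0 (offset_gt0 _))) //= andbF.
  rewrite parent_position1 // [offset i'.+1]posE [offset _]posE !position_eq //.
  by rewrite eqSS [i == _]eq_sym [i == i']eq_sym; lia.
rewrite parent_position // [offset _]posE !position_eq //=; last exact: ltnW.
by rewrite eq_sym; lia.
Qed.

Definition symb_position (a : symb m) : nat :=
  match a with
  | inl i => position i 0
  | inr p => position (tag p) (tagged p).+1
  end.

Lemma symb_position_lt a : symb_position a < (spine m).+2.
Proof.
by rewrite -offset_size; case: a => [i|[i l]] /=; apply: position_mono => //=.
Qed.

Lemma symb_position_inj : injective symb_position.
Proof.
move=> [i|[i l]] [j|[j l']] /= /eqP; rewrite position_eq //= ?andbT.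
- by move=> /eqP/val_inj ->.
- by rewrite andbF.
- by rewrite andbF.
by move=> /andP[/eqP/val_inj E]; case: j / E l' => l'; rewrite eqSS => /eqP/val_inj ->.
Qed.

Lemma card_symb : #|{: symb m}| = (spine m).+2.
Proof.
rewrite -offset_size card_sum card_ord card_tagged sumnE big_map big_enum /= /offset.
rewrite -[X in X + _]card_ord -sum1_card -big_split /=.
by apply: eq_bigr => i _; rewrite card_ord add1n.
Qed.

Lemma free_entry_fan_adj a b :
  free_entry a b || free_entry b a = fan_adj S (symb_position a) (symb_position b).
Proof.
have P (i l i' l' : nat) (im : i < size m) (lm : l <= nth 0 m i)
    (im' : i' < size m) (lm' : l' <= nth 0 m i') :
    fan_adj S (position i l) (position i' l') =
    [|| (i == i') && (l == l'), symb_parent i l i' l' | symb_parent i' l' i l].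
  by rewrite /fan_adj /= !parent_symb // position_eq.
have tl (p : {i : 'I_(size m) & 'I_(nth 0 m i)}) : (tagged p).+1 <= nth 0 m (tag p) := ltn_ord _.
have oE (x y : 'I_(size m)) : (x == y) = (nat_of_ord x == nat_of_ord y) by [].
case: a => [i|p]; case: b => [j|q]; rewrite [symb_position _]/= [symb_position _]/= P //=.
- by rewrite !oE; lia.
- by rewrite !oE; case: (nat_of_ord (tagged q)) => [|l]; lia.
- by rewrite !oE; case: (nat_of_ord (tagged p)) => [|l]; lia.
rewrite !oE; case: (nat_of_ord (tagged p)) => [|l]; case: (nat_of_ord (tagged q)) => [|l']; lia.
Qed.

Theorem lambda_polyE :
  lambda_poly m = rank_poly (kill (fun i j : 'I_(spine m).+2 => fan_adj S i j)
                                  (inord (offset (size m).-1))).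
Proof.
pose pat (i j : 'I_#|{: symb m}|) := let a := enum_val i in let b := enum_val j in
  [&& free_entry a b || free_entry b a, ~~ is_last_e a & ~~ is_last_e b].
have patE A : Lambda_form A = sym_pattern pat A.
  apply/andP/sym_patternP => [[/andP[/eqP AT /forallP D] /forallP L] | [AT A0]].
    split=> i j; first by rewrite -{1}AT mxE.
    have := D (enum_val i) => /forallP/(_ (enum_val j)).
    have := L (enum_val i) => /forallP/(_ (enum_val j)).
    have := L (enum_val j) => /forallP/(_ (enum_val i)).
    rewrite /entry !enum_valK /pat.
    case: (is_last_e _) => /= [/andP[_ /eqP ->] // | _].
    case: (is_last_e _) => /= [/andP[/eqP -> _] // | _].
    by rewrite !andbT => /implyP H /H/eqP.
  split.
    apply/andP; split; first by apply/eqP/matrixP => i j; rewrite mxE AT.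
    apply/'forall_forallP => a b; apply/implyP => nf; apply/eqP/A0.
    by rewrite /pat !enum_rankK (negPf nf).
  apply/'forall_forallP => a b; apply/implyP => la; rewrite /entry !A0 ?eqxx //.
    by rewrite /pat !enum_rankK la !andbF.
  by rewrite /pat !enum_rankK la !andbF.
transitivity (rank_poly pat).
  apply/polyP => r; rewrite coef_poly coef_sum.
  under eq_bigr => A _ do rewrite coefXn.
  have -> : (\sum_(A | sym_pattern pat A) (r == \rank A)%:R = (num_Lambda m r)%:R :> int)%R.
    rewrite /num_Lambda -sum1dep_card natr_sum [RHS]big_mkcondr /= [LHS]big_mkcond [RHS]big_mkcond /=.
    apply: eq_bigr => A _; rewrite patE; case: ifP => // _.
    by rewrite eq_sym; case: eqP.
  case: ltnP => // rn; symmetry; rewrite /num_Lambda.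
  rewrite (_ : [set A : symb_matrix m | _] = set0) ?cards0 //.
  apply/setP => A; rewrite !inE; apply/negP => /andP[_ /eqP E].
  by have := rank_leq_row A; rewrite E leqNgt rn.
pose f (i : 'I_#|{: symb m}|) : 'I_(spine m).+2 := Ordinal (symb_position_lt (enum_val i)).
apply: (@rank_poly_iso _ _ _ _ f) => [|i j].
  apply: inj_card_bij; last by rewrite !card_ord card_symb.
  by move=> i j /(congr1 val) /= /symb_position_inj /enum_val_inj.
have lastE k : is_last_e (enum_val k) = (f k == inord (offset (size m).-1)).
  have sz : (size m).-1 < size m by lia.
  have o : offset (size m).-1 = position (size m).-1 0 by rewrite /position addn0.
  rewrite -val_eqE /= inordK; last first.
    by rewrite -offset_size o; apply: position_mono.
  rewrite o; case: (enum_val k) => [i'|[i' l]] /=; rewrite position_eq //= ?andbF //.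
  by rewrite andbT; lia.
by rewrite /pat /kill free_entry_fan_adj !lastE.
Qed.

Let k := (size m).-1.

Let k_lt : 0 < k < size m.
Proof. by rewrite /k; lia. Qed.

Lemma spine_position : (spine m).+1 = position k (nth 0 m k).
Proof.
have := offset_size; have -> : size m = k.+1 by rewrite /k; lia.
by rewrite offsetS /position; lia.
Qed.

Lemma fan_adj_last a : a < (spine m).+1 ->
  fan_adj S (offset k) a =
  (a \in (offset k).-1 :: offset k.-1 :: iota (offset k) (nth 0 m k)).
Proof.
rewrite spine_position !inE mem_iota /position => ak.
have o0 := offset_gt0 (proj1 (andP k_lt)).
have [ak'|] := ltnP a (offset k).
  have np : parent S (offset k) a = false by rewrite /parent ltnNge (ltnW ak').
  by rewrite /fan_adj /= parent_offset // np [offset k == a]gtn_eqF // orbF.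
move=> ka; rewrite ak !orbT; have [l El] : exists l, a = position k l.
  by exists (a - offset k); rewrite /position; lia.
move: ak ka; rewrite El => {a El} ak _; rewrite /fan_adj /=.
have kl := proj2 (andP k_lt).
case: l ak => [|[|l]] ak; first by rewrite /position addn0 eqxx.
  by rewrite parent_position1 // eqxx !orbT.
by rewrite parent_position ?eqxx ?orbT //=; move: ak; rewrite /position; lia.
Qed.

(** The origin of the exponent: once the last face is removed, the row of the last centre has free
    entries at the previous centre, at the end of the previous fan, at itself and at [m_k - 1]
    members of its own fan. *)
Lemma card_fan_adj_last :
  #|[pred a : 'I_(spine m).+1 | fan_adj S (offset k) a]| = (nth 0 m k).+2.
Proof.
have [j Ej] : exists j, k = j.+1 by exists k.-1; have := k_lt; lia.
have jm : j < size m by have := k_lt; lia.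
have oj : offset k = position j (nth 0 m j).+1 by rewrite Ej offsetS.
have oj1 : offset k.-1 = offset j by rewrite Ej.
have m0 := m_gt0 jm.
rewrite -[RHS](_ : size ((offset k).-1 :: offset k.-1 :: iota (offset k) (nth 0 m k)) = _); last first.
  by rewrite /= size_iota.
rewrite -(@card_ord_mem (spine m).+1); first last.
- apply/allP => a; rewrite spine_position !inE mem_iota oj1 /position /=.
  by rewrite /position in oj; lia.
- by rewrite /= iota_uniq !inE !mem_iota oj1; rewrite /position in oj; lia.
by apply: eq_card => a; rewrite !inE fan_adj_last // !inE.
Qed.

(** For [m_k >= 2] the last two faces belong to the last fan, so the vertex v of the elimination is
    the centre of that fan. *)
Lemma kept_last n : spine m = n.+2 -> 1 < nth 0 m k -> kept S n = offset k.
Proof.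
move=> En mk; have [_ /(_ (nth 0 m k).-1)[|A1 A2]] := side_faces (proj2 (andP k_lt)).
  by lia.
have pE : position k (nth 0 m k).-1 = n.+2.
  by have := spine_position; rewrite En /position; lia.
have := upper_lowerS S n (offset k).
have -> : (offset k == upper S n.+1) || (offset k == lower S n.+1).
  by rewrite -A2 pE /side_face; case: odd; rewrite eqxx ?orbT.
have -> : offset k == n.+2 = false by rewrite -pE /position; lia.
by move=> /esym/eqP.
Qed.

End Positions.

(** * The recurrence *)

(** The sides for parameters that are followed by at least one more: none of these blocks is last,
    so all but the first get the extra leaf. *)
Definition sides_prefix (s : seq nat) : seq bool :=
  flatten [seq nseq (nth 0 s i + (0 < i)) (~~ odd i) | i <- iota 0 (size s)].

Lemma sides_rcons s q : sides (rcons s q) = sides_prefix s ++ nseq q (~~ odd (size s)).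
Proof.
rewrite /sides size_rcons iota_rcons map_rcons flatten_rcons; congr (flatten _ ++ _).
  apply/eq_in_map => i; rewrite mem_iota add0n => /= iq.
  by rewrite /block nth_rcons size_rcons iq /= andbT.
by rewrite /block nth_rcons ltnn eqxx size_rcons /= ltnn andbF addn0.
Qed.

Lemma sides_prefix_rcons s p :
  sides_prefix (rcons s p) = sides_prefix s ++ nseq (p + (0 < size s)) (~~ odd (size s)).
Proof.
rewrite /sides_prefix size_rcons iota_rcons map_rcons flatten_rcons; congr (flatten _ ++ _).
  by apply/eq_in_map => i; rewrite mem_iota add0n => /= iq; rewrite nth_rcons iq.
by rewrite nth_rcons ltnn eqxx.
Qed.

Lemma nth_cat_prefix (T : Type) (x0 : T) (a b c : seq T) i :
  i < size a -> nth x0 (a ++ b) i = nth x0 (a ++ c) i.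
Proof. by move=> ia; rewrite !nth_cat ia. Qed.

Local Open Scope ring_scope.

Theorem theorem3p4
  (* one fixed spanning tree for each of the graphs H_m *)
  (T : forall m : seq nat, {set edge (halin m)})
  (hT : forall m : seq nat, halin_params m -> spanning_tree (T m)) :
  let E (m : seq nat) : {poly int} := euler_genus_poly (T m) in
  (* s = (m_1, ..., m_(k-2)) and p = m_(k-1) *)
  forall (k : nat) (hk : (3 <= k)%N) (s : seq nat) (hsize : size s = (k - 2)%N)
    (p : nat) (hs : all (leq 1) s) (hp : (1 <= p)%N),
  (forall mk : nat, (2 <= mk)%N ->
     E (s ++ [:: p; mk]) =
       (1 + 4 *: 'X) * E (s ++ [:: p; (mk - 1)%N])
       + 16 *: 'X^2 * E (s ++ [:: p; (mk - 2)%N])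
       + 2 ^+ (mk + 3) *: 'X^2 * lambda_poly (s ++ [:: p; (mk - 1)%N]))
  /\ E (s ++ [:: p; 0%N]) = E (s ++ [:: (p + 1)%N])
  /\ E (s ++ [:: p; 1%N]) = E (s ++ [:: (p + 2)%N]).
Proof.
move=> E k hk s hsize p hs hp.
have s_gt0 : (0 < size s)%N by lia.
have EE (m : seq nat) : halin_params m -> (0 < spine m)%N ->
    E m = 2 *: fan_poly (sides m) (spine m).+2.
  by move=> mP m0; apply: halin_genus_poly => //; apply/spanning_tree_like/hT.
have catE q : s ++ [:: p; q] = rcons (rcons s p) q by rewrite -!cats1 -catA.
have sidesE q : sides (s ++ [:: p; q]) =
    sides_prefix s ++ nseq p.+1 (~~ odd (size s)) ++ nseq q (odd (size s)).
  rewrite catE sides_rcons sides_prefix_rcons size_rcons s_gt0 addn1 catA.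
  by rewrite /= negbK.
have sides1E q : sides (s ++ [:: q]) = sides_prefix s ++ nseq q (~~ odd (size s)).
  by rewrite cats1 sides_rcons.
have spineE q : spine (s ++ [:: p; q]) = (size (sides_prefix s) + p.+1 + q)%N.
  by rewrite -size_sides sidesE !size_cat !size_nseq addnA.
have spine1E q : spine (s ++ [:: q]) = (size (sides_prefix s) + q)%N.
  by rewrite -size_sides sides1E size_cat size_nseq.
have E2 q : E (s ++ [:: p; q]) = 2 *: fan_poly (sides (s ++ [:: p; q])) (spine (s ++ [:: p; q])).+2.
  apply: EE; last by rewrite spineE; lia.
  rewrite /halin_params catE !size_rcons /= -!cats1 take_size_cat ?size_cat ?addn1 //.
  by rewrite all_cat hs /= hp.
have E1 q : E (s ++ [:: q.+1]) = 2 *: fan_poly (sides (s ++ [:: q.+1])) (spine (s ++ [:: q.+1])).+2.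
  apply: EE; last by rewrite spine1E; lia.
  rewrite /halin_params cats1 !size_rcons /= -!cats1 take_size_cat // hs andbT; lia.
split; last first.
  (* An empty last block leaves [p] as a middle block with [p + 1] leaves, just as a last block with
     parameter [p + 1] has; the side sequences coincide. *)
  rewrite E2 addn1 E1 spineE spine1E sidesE sides1E cats0 addn0; split=> //.
  rewrite E2 addn2 E1 spineE spine1E sidesE sides1E; congr (_ *: _).
  have -> : (size (sides_prefix s) + p.+1 + 1 = size (sides_prefix s) + p.+2)%N by lia.
  (* The two side sequences differ in the last leaf only. *)
  apply: eq_fan_poly => i; rewrite inE => ip; rewrite -[p.+2]addn1 nseqD !catA.
  by apply: nth_cat_prefix; rewrite size_cat size_nseq; lia.
move=> mk mk2; have [q Eq] : exists q, mk = q.+2 by exists (mk - 2)%N; lia.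
rewrite {mk}Eq in mk2 *.
have -> : (q.+2 - 1 = q.+1)%N by lia.
have -> : (q.+2 - 2 = q)%N by lia.
set m := s ++ [:: p; q.+2]; set m1 := s ++ [:: p; q.+1].
have m_size : (1 < size m)%N by rewrite /m size_cat /=; lia.
have m1_size : (1 < size m1)%N by rewrite /m1 size_cat /=; lia.
have gt0 r : forall i, (i < size (s ++ [:: p; r.+1]))%N -> (0 < nth 0 (s ++ [:: p; r.+1]) i)%N.
  by apply/all_nthP; rewrite all_cat hs /= hp.
have m_last : nth 0 m (size m).-1 = q.+2 by rewrite nth_last last_cat.
have offsetE : offset m (size m).-1 = offset m1 (size m1).-1.
  rewrite /offset /m /m1 !size_cat /= !addn2 /=; apply: eq_bigr => i _.
  by rewrite !nth_cat; case: ltnP => // si; have -> : (i - size s = 0)%N by have := ltn_ord i; lia.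
pose n := (spine m - 2)%N.
have sp : spine m = n.+2 by rewrite /n /m spineE; lia.
have sp1 : spine m1 = n.+1 by rewrite /n /m /m1 !spineE; lia.
have sp2 : spine (s ++ [:: p; q]) = n by rewrite /n /m !spineE; lia.
have agree r i : (r <= q.+2)%N -> (i < spine (s ++ [:: p; r]))%N ->
    nth false (sides m) i = nth false (sides (s ++ [:: p; r])) i.
  rewrite spineE => rq ir; rewrite /m !sidesE -(subnKC rq) nseqD !catA.
  by rewrite -[in RHS](cats0 (_ ++ nseq r _)); apply: nth_cat_prefix; rewrite !size_cat !size_nseq.
have kl := kept_last m_size (gt0 q.+1) sp.
rewrite m_last in kl.
rewrite !E2 -/m -/m1 sp sp1 sp2 fan_poly_rec (kl isT).
have -> : fan_poly (sides m) n.+3 = fan_poly (sides m1) n.+3.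
  by apply: eq_fan_poly => i; rewrite inE => i_n; apply: agree; rewrite // -/m1 sp1; lia.
have -> : fan_poly (sides m) n.+2 = fan_poly (sides (s ++ [:: p; q])) n.+2.
  by apply: eq_fan_poly => i; rewrite inE => i_n; apply: agree; rewrite ?sp2; lia.
have := card_fan_adj_last m_size (gt0 q.+1); rewrite -/m sp m_last => ->.
rewrite (lambda_polyE m1_size (gt0 q)) -/m1 sp1 -offsetE.
have -> : rank_poly (kill (fun i j : 'I_n.+3 => fan_adj (sides m) i j) (inord (offset m (size m).-1))) =
  rank_poly (kill (fun i j : 'I_n.+3 => fan_adj (sides m1) i j) (inord (offset m (size m).-1))).
  apply: eq_rank_poly => i j; rewrite /kill (@eq_fan_adj _ (sides m1) n.+3) // => a.
  by rewrite inE => a_n; apply: agree; rewrite // -/m1 sp1; lia.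
rewrite !scalerDr -!scalerAr -!scalerAl; congr (_ + _).
(* The factor 2 of E turns the exponent [m_k + 2] into [m_k + 3]; on the right-hand side
   [lambda_poly] carries no such factor. *)
by rewrite scalerA -exprS addn3.
Qed.
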